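(* Let $\{X_t\}_{t\ge 0}$ be the Ornstein-Uhlenbeck convenience dividend process, $\{\xi_t\}_{t\ge 0}$ the market information process, and $\{\mathcal F_t\}_{t\ge0}$ the market filtration they jointly generate, as specified in the context, with constant interest rate $r>0$. Let $T>0$, let $$S_T=e^{rT}\,\mathbb E\left[\left.\int_T^\infty e^{-ru}X_u\,\mathrm du\,\right|\,\mathcal F_T\right]$$ be the commodity price at time $T$, and let $K$ be a real constant (the strike). Then the price $C_0=e^{-rT}\,\mathbb E\left[(S_T-K)^+\right]$ of a European call option with strike $K$ and maturity $T$ is $$C_0=e^{-rT}\left[\sqrt{\frac{\mathrm{Var}[S_T]}{2\pi}}\,\exp\left(-\frac{(\mathbb E[S_T]-K)^2}{2\,\mathrm{Var}[S_T]}\right)+(\mathbb E[S_T]-K)\,N\left(\frac{\mathbb E[S_T]-K}{\sqrt{\mathrm{Var}[S_T]}}\right)\right],$$ where $$\mathbb E[S_T]=\frac1r\left[\frac{\kappa}{r+\kappa}\,\theta+\frac{r}{r+\kappa}\left(e^{-\kappa T}X_0+\theta\,(1-e^{-\kappa T})\right)\right]$$ and $$\mathrm{Var}[S_T]=\frac{\psi^2}{2\kappa(r+\kappa)^2}\left(1-e^{-2\kappa T}\right)+z_T^2\left[\frac{\psi^2}{2r(r+\kappa)^2}+\frac{e^{2rT}}{\sigma^2T}\right],\qquad z_T=\frac{\sigma^2\psi^2T}{2r(r+\kappa)^2e^{2rT}+\sigma^2\psi^2T}.$$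
   Context: Work on a probability space $(\Omega,\mathcal F,\mathbb Q)$ ($\mathbb Q$ is the pricing measure; $\mathbb E$ and $\mathrm{Var}$ denote expectation and variance under $\mathbb Q$) carrying two independent standard one-dimensional Brownian motions $\{\beta_t\}_{t\ge0}$ and $\{B_t\}_{t\ge 0}$. Dividend process: $\{X_t\}_{t\ge0}$ is the Ornstein-Uhlenbeck process with constant (deterministic) initial value $X_0$ solving $$\mathrm dX_t=\kappa(\theta-X_t)\,\mathrm dt+\psi\,\mathrm d\beta_t,$$ with constants $\kappa>0$, $\theta\in\mathbb R$, $\psi>0$. Thus $\{X_t\}$ is independent of $\{B_t\}$. Information process: for a constant $\sigma>0$ and constant interest rate $r>0$ (discount factor $e^{-rt}$), $$\xi_t=\sigma t\int_t^\infty e^{-ru} X_u\,\mathrm du+B_t,\qquad t\ge0.$$ Market filtration: $\mathcal F_t$ is the $\sigma$-algebra generated by $\{\xi_s\}_{0\le s\le t}$ and $\{X_s\}_{0\le s\le t}$. Notation: $x^+=\max(x,0)$; $N(x)$ is the standard normal distribution function; in the factor $\sqrt{\mathrm{Var}[S_T]/(2\pi)}$ the symbol $\pi$ is the usual numerical constant. *)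

(* Defs.v *)
From HB Require Import structures.
From mathcomp Require Import all_boot all_order all_algebra.
From mathcomp Require Import all_classical all_reals all_analysis.

Set Implicit Arguments.
Unset Strict Implicit.
Unset Printing Implicit Defensive.

Import Order.TTheory GRing.Theory Num.Theory.
Import numFieldNormedType.Exports.

Local Open Scope classical_set_scope.
Local Open Scope ring_scope.

(* Processes are indexed by R, but only their values at times t >= 0 matter.   *)

Section Definitions.
Context (d : measure_display) (Omega : measurableType d) (R : realType)
        (P : probability Omega R).

Definition sigma_gen (I : Type) (D : set I) (f : I -> Omega -> R) :
    set (set Omega) :=
  <<s \bigcup_(i in D) preimage_set_system setT (f i) measurable >>.

Definition indep_sys (F G : set (set Omega)) : Prop :=
  forall A A', F A -> G A' -> P (A `&` A') = (P A * P A')%E.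

(* The normal law is only compared with the distribution on Borel sets (both   *)
(* sides are total set functions), and only for s < t (normal_prob m 0 is not  *)
(* the Dirac mass at m in the library).                                        *)
Definition brownian_motion (W : R -> {RV P >-> R}) : Prop :=
  [/\ {ae P, forall w, W 0 w = 0},
      (forall s t, 0 <= s -> s < t -> forall A, measurable A ->
         P [set w | A (W t w - W s w)] = normal_prob 0 (Num.sqrt (t - s)) A),
      (forall s t, 0 <= s -> s < t ->
         indep_sys (sigma_gen `[0, s] (fun u w => W u w))
                   (sigma_gen [set: unit] (fun _ w => W t w - W s w))) &
      {ae P, forall w, {within `[0, +oo[, continuous (fun t => W t w)}} ].

Definition indep_processes (W W' : R -> {RV P >-> R}) : Prop :=
  indep_sys (sigma_gen `[0, +oo[ (fun t w => W t w))
            (sigma_gen `[0, +oo[ (fun t w => W' t w)).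

(* X has continuous paths and solves                                           *)
(*   dX_t = kappa (theta - X_t) dt + psi dW_t,  X_0 = x0.                      *)
(* The noise is additive, so the stochastic integral of the constant psi is    *)
(* psi W_t and the equation in integral form is pathwise.                      *)
Definition ornstein_uhlenbeck (kappa theta psi x0 : R)
    (W X : R -> {RV P >-> R}) : Prop :=
  (forall w, {within `[0, +oo[, continuous (fun t => X t w)}) /\
  {ae P, forall w, forall t, 0 <= t ->
    X t w = x0
      + \int[lebesgue_measure]_(u in `[0, t]) (kappa * (theta - X u w))
      + psi * W t w}.

Definition discounted_dividends (r : R) (X : R -> {RV P >-> R}) (t : R)
    (w : Omega) : R :=
  \int[lebesgue_measure]_(u in `[t, +oo[) (expR (- (r * u)) * X u w).

Definition information (sigma r : R) (X B : R -> {RV P >-> R}) (t : R)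
    (w : Omega) : R :=
  sigma * t * discounted_dividends r X t w + B t w.

Definition market_filtration (sigma r : R) (X B : R -> {RV P >-> R}) (t : R) :
    set (set Omega) :=
  <<s sigma_gen `[0, t] (information sigma r X B)
      `|` sigma_gen `[0, t] (fun s w => X s w) >>.

(* Z is a version of the conditional expectation E[Y | G].                     *)
Definition is_cond_exp (G : set (set Omega)) (Y Z : Omega -> R) : Prop :=
  [/\ (forall A, measurable A -> G (Z @^-1` A)),
      P.-integrable setT (EFin \o Z) &
      (forall A, G A ->
         \int[P]_(w in A) (Z w)%:E = \int[P]_(w in A) (Y w)%:E)%E ].

(* S is (a version of) e^{rt} E[ int_t^oo e^{-ru} X_u du | F_t ].              *)
Definition commodity_price (sigma r : R) (X B : R -> {RV P >-> R}) (t : R)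
    (S : Omega -> R) : Prop :=
  exists2 Z, is_cond_exp (market_filtration sigma r X B t)
                         (discounted_dividends r X t) Z
           & forall w, S w = expR (r * t) * Z w.

End Definitions.

Definition std_normal_cdf (R : realType) (x : R) : R :=
  fine (normal_prob 0 1 `]-oo, x]).

(* Main.v *)
Require Import Defs.
From HB Require Import structures.
From mathcomp Require Import all_boot all_order all_algebra.
From mathcomp Require Import all_classical all_reals all_analysis.
From mathcomp Require Import measurable_realfun ring lra.

Set Implicit Arguments.
Unset Strict Implicit.
Unset Printing Implicit Defensive.

Import Order.TTheory GRing.Theory Num.Theory.
Import numFieldNormedType.Exports.

Local Open Scope classical_set_scope.
Local Open Scope ring_scope.

(* Let N be the discounted dividend integral after T minus its conditional mean
   given the path of beta up to T.  It is a multiple of the integral of a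
   deterministic exponential against beta after T, hence a centered Gaussian
   independent of that path.  The information process differs from
   eta_s = sigma s N + B_s by a function of the path, so the market filtration at
   T is contained in the completed sigma-algebra of the path and of the eta_s,
   s <= T.  As (eta_s) is a Brownian motion with an unknown Gaussian drift, eta_T
   is sufficient: N - c_T eta_T is independent of this sigma-algebra, by the Kalman
   recursion on finite grids.  Hence S_T is an explicit affine function of the
   independent Gaussian variables X_T and eta_T, and the price is the integral of
   (m + s z - K)^+ against the standard normal law.
   No stochastic integral is needed: integrals of exponentials against beta are
   limits of Riemann sums, expressed by pathwise primitives of X.  The Gaussian
   computations reduce to the rotation invariance of the product of two standard
   normal laws. *)

(** The market filtration is generated by a continuum of observations and contains no added null
    events, whereas the equation determines X from beta only almost surely. The conditional
    expectation is therefore caught between two sigma-algebras. The estimate is measurable for the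
    market filtration itself, being affine in xi_T and X_T at every sample point; the error is
    independent of the larger sigma-algebra that contains the null events. Together these identify
    every version of the conditional expectation almost surely.

    All Gaussian reasoning goes through one predicate, [normal_indep H v Y]: Y is centered normal
    with variance v and independent of H. It passes to sums, almost sure limits, generated
    sigma-algebras and null extensions. Only pairs of Gaussian variables are ever handled jointly,
    because each recursion adds a single increment to what is already known. The value v = 0 is
    allowed, so inductions can start from the constant 0.

    The coefficient z_T is sigma T times the regression coefficient of N on eta_T. *)

(** * Affine substitutions and rotations of the standard normal law *)

Section lebesgue_affine.
Context {R : realType}.
Local Notation mu := (@lebesgue_measure R).

(** Uniqueness of Lebesgue measure: the rescaled pushforward gives each []x, y]] its length. For c <
    0 the preimage is closed on the left instead of the right, with the same length. *)
Lemma lebesgue_measure_affine (c a : R) (A : set R) : c != 0 -> measurable A ->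
  mu ((fun x => c * x + a) @^-1` A) = (`|c|^-1%:E * mu A)%E.
Proof.
move=> c0 mA.
have mf : measurable_fun [set: measurableTypeR R]
    (fun x : measurableTypeR R => (c * x + a) : measurableTypeR R).
  by apply: measurable_funD => //; exact: measurable_funM.
have cpos : (0 <= `|c|) by [].
pose m' := mscale (NngNum cpos)
  (measure_function_pushforward__canonical__measure_function_Measure mu mf).
suff -> : mu A = m' A.
  rewrite /m' /mscale/= /pushforward muleA -EFinM mulVf ?mul1e// normr_eq0//.
apply: lebesgue_measure_unique => // _ [[x y]] /= _ <-.
rewrite /m' /mscale/= /pushforward.
have [cp|cn] := ltP 0 c.
  have -> : (fun z : R => c * z + a) @^-1` `]x, y]%classic = `](x - a) / c, (y - a) / c]%classic.
    apply/seteqP; split => z/=; rewrite !in_itv/= ltr_pdivrMr// ler_pdivlMr// ltrBlDr lerBrDr (mulrC z)//.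
  rewrite !lebesgue_measure_itv/= !lte_fin ltr_pM2r ?invr_gt0// ltrD2r.
  case: ifP => _; rewrite ?mule0// -!EFinB -EFinM gtr0_norm//; congr EFin.
  by field.
have {}cn : c < 0 by rewrite lt_neqAle c0.
have -> : (fun z : R => c * z + a) @^-1` `]x, y]%classic = `[(y - a) / c, (x - a) / c[%classic.
  apply/seteqP; split => z/=; rewrite !in_itv/= ler_ndivrMr// ltr_ndivlMr// ltrBlDr lerBrDr (mulrC z) andbC//.
rewrite !lebesgue_measure_itv/= !lte_fin ltr_nM2r ?invr_lt0// ltrD2r.
case: ifP => _; rewrite ?mule0// -!EFinB -EFinM ltr0_norm//; congr EFin.
by field; rewrite ltr0_neq0.
Qed.

Lemma ge0_integral_affine (c a : R) (f : R -> \bar R) : c != 0 ->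
  measurable_fun setT f -> (forall x, 0 <= f x)%E ->
  (\int[mu]_x f (c * x + a)%R = `|c|^-1%:E * \int[mu]_x f x)%E.
Proof.
move=> c0 mf f0.
have mg : measurable_fun [set: measurableTypeR R]
    (fun x : measurableTypeR R => (c * x + a) : measurableTypeR R).
  by apply: measurable_funD => //; exact: measurable_funM.
rewrite -(@ge0_integral_pushforward _ _ _ _ _ _ mg mu setT f)//.
have cpos : (0 <= `|c|^-1) by rewrite invr_ge0.
have mE (A : set (measurableTypeR R)) : measurable A -> A `<=` setT ->
   pushforward mu (fun x : measurableTypeR R => (c * x + a) : measurableTypeR R) A = mscale (NngNum cpos) mu A.
  by move=> mA _; rewrite /mscale/= /pushforward lebesgue_measure_affine.
rewrite (eq_measure_integral _ mE); last exact: mg.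
by rewrite ge0_integral_mscale.
Qed.

End lebesgue_affine.

Section standard_normal.
Context {R : realType}.
Local Notation mu := (@lebesgue_measure R).
Local Notation n01 := (@normal_prob R 0 1).
Local Notation phi := (@normal_pdf R 0 1).

Lemma std_normal_pdfE (x : R) : phi x = normal_peak 1 * expR (- x ^+ 2 / 2).
Proof. by rewrite normal_pdfE ?oner_neq0// /normal_fun subr0 expr1n. Qed.

(** Integration against [n01] is first rewritten with its Radon-Nikodym derivative, which equals
    [phi] almost everywhere because both have the same integral over every measurable set. *)
Lemma ge0_integral_std_normal (f : R -> \bar R) :
  measurable_fun setT f -> (forall x, 0 <= f x)%E ->
  (\int[n01]_x f x = \int[mu]_x (f x * (phi x)%:E))%E.
Proof.
move=> mf f0.
have dom := @normal_prob_dominates R 0 1.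
rewrite -(Radon_Nikodym_SigmaFinite.change_of_variables dom)//.
apply: ae_eq_integral => //.
- apply: emeasurable_funM => //.
  exact: measurable_int (Radon_Nikodym_SigmaFinite.f_integrable _).
- apply: emeasurable_funM => //; apply/measurableT_comp => //.
  exact: measurable_normal_pdf.
- apply: ae_eqe_mul2l.
  apply: integral_ae_eq => //.
  + exact: Radon_Nikodym_SigmaFinite.f_integrable.
  + by apply/measurableT_comp => //; exact: measurable_normal_pdf.
  + by move=> A _ mA; rewrite -Radon_Nikodym_SigmaFinite.f_integral.
Qed.

Lemma std_normal_probE (C : set R) : measurable C ->
  n01 C = (\int[mu]_x (\1_C x * phi x)%:E)%E.
Proof.
move=> mC; transitivity (\int[n01]_x (\1_C x)%:E)%E.
  by rewrite integral_indic// setIT.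
rewrite ge0_integral_std_normal//.
by apply/measurable_EFinP; exact: measurable_indic.
Qed.

Lemma std_normal_pdf_rotation (a b x y : R) : a ^+ 2 + b ^+ 2 = 1 ->
  phi (b * x + a * y) * phi (a * x - b * y) = phi x * phi y.
Proof.
move=> ab; rewrite !std_normal_pdfE.
rewrite mulrACA [RHS]mulrACA -!expRD; congr (_ * expR _).
rewrite -!mulrDl; congr (_ / _).
have -> : - (b * x + a * y) ^+ 2 - (a * x - b * y) ^+ 2 =
  - (a ^+ 2 + b ^+ 2) * (x ^+ 2 + y ^+ 2) by ring.
by rewrite ab; ring.
Qed.

(* Substituting w = a x + b y in the inner integral, then x = a w - b u in the
   outer one, turns the density phi x phi y into phi w phi u. *)
Lemma std_normal_rotation (a b : R) (C1 C2 : set R) :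
  a ^+ 2 + b ^+ 2 = 1 -> b != 0 -> measurable C1 -> measurable C2 ->
  (\int[n01]_x \int[n01]_y ((\1_C1 (a * x + b * y) * \1_C2 (a * y - b * x))%:E)
   = n01 C1 * n01 C2)%E.
Proof.
move=> ab b0 mC1 mC2.
have mphi : measurable_fun setT phi by exact: measurable_normal_pdf.
have phi0 x : (0 <= phi x) by exact: normal_pdf_ge0.
have m1 : measurable_fun setT (\1_C1 : R -> R) by exact: measurable_indic.
have m2 : measurable_fun setT (\1_C2 : R -> R) by exact: measurable_indic.
pose F (x w : R) : R := \1_C1 w * \1_C2 (a * ((w - a * x) / b) - b * x) * phi ((w - a * x) / b).
have mw : measurable_fun [set: R * R] (fun p : R * R => (p.2 - a * p.1) / b).
  by apply: measurable_funM => //; apply: measurable_funB => //; exact: measurable_funM.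
have mF : measurable_fun [set: R * R] (fun p : R * R => F p.1 p.2).
  apply: measurable_funM; last exact: measurableT_comp.
  apply: measurable_funM; first exact: measurableT_comp.
  apply: measurableT_comp => //; apply: measurable_funB; exact: measurable_funM.
have F0 x w : 0 <= F x w by rewrite !mulr_ge0.

pose G (x y : R) : R := \1_C1 (a * x + b * y) * \1_C2 (a * y - b * x).
have mG : measurable_fun [set: R * R] (fun p : R * R => G p.1 p.2).
  apply: measurable_funM; apply: measurableT_comp => //.
    by apply: measurable_funD => //; exact: measurable_funM.
  by apply: measurable_funB => //; exact: measurable_funM.
have G0 x y : 0 <= G x y by rewrite mulr_ge0.
have mGx x : measurable_fun [set: R] (G x).
  exact: (measurableT_comp mG (pair1_measurable x)).
have mFx x : measurable_fun [set: R] (F x).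
  exact: (measurableT_comp mF (pair1_measurable x)).
have mphiE : measurable_fun setT (EFin \o phi) by exact/measurable_EFinP.
transitivity (\int[mu]_x \int[mu]_w (`|b|^-1 * (F x w * phi x))%:E)%E.
  rewrite ge0_integral_std_normal//; first last.
  - by move=> x; apply: integral_ge0 => y _; rewrite lee_fin.
  - apply: (measurable_fun_fubini_tonelli_F (m2 := n01) (fun p : measurableTypeR R * measurableTypeR R => (G p.1 p.2)%:E)) => //.
      exact/measurable_EFinP.
    by move=> x; rewrite lee_fin.
  apply: eq_integral => x _.
  rewrite ge0_integral_std_normal//; first last.
by apply/measurable_EFinP; exact: (mGx x).
  under eq_integral => y _.
    rewrite -EFinM.
    have -> : (\1_C1 (a * x + b * y) * \1_C2 (a * y - b * x) * phi y =
       F x (b * y + a * x)).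
      rewrite /F addrK (mulrC b y) mulfK// (addrC (y * b)) (mulrC y b)//.
    over.
  rewrite (ge0_integral_affine _ (f := fun w => (F x w)%:E))//; first last.
  - by move=> w; rewrite lee_fin.
  - by apply/measurable_EFinP; exact: (mFx x).
  rewrite muleAC -EFinM -ge0_integralZl//; first last.
  - by rewrite lee_fin mulr_ge0// invr_ge0.
  - by move=> w _; rewrite lee_fin.
  - by apply/measurable_EFinP; exact: (mFx x).
  by apply: eq_integral => w _; rewrite -EFinM; congr EFin; ring.
rewrite (fubini_tonelli (m1 := mu) (m2 := mu) (fun p : measurableTypeR R * measurableTypeR R =>
   (`|b|^-1 * (F p.1 p.2 * phi p.1))%:E)); first last.
- by move=> [x y]; rewrite lee_fin/= !mulr_ge0 ?invr_ge0.
- apply/measurable_EFinP; apply: measurable_funM => //.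
  by apply: measurable_funM => //; exact: measurableT_comp.
(* [J] is the integrand in the rotated coordinates. The first substitution produced the factor
   [|b|^-1]; the second, of slope - 1 / b, produces |b|, and the two cancel. *)
pose J (w u : R) : R := \1_C1 w * \1_C2 u * (phi w * phi u).
have J0 w u : 0 <= J w u by rewrite !mulr_ge0.
have mJw w : measurable_fun [set: R] (J w).
  by apply: measurable_funM; exact: measurable_funM.
have bV0 : - b^-1 != 0 by rewrite oppr_eq0 invr_eq0.
transitivity (\int[mu]_w ((\1_C1 w * phi w)%:E * n01 C2))%E.
  apply: eq_integral => w _ /=.
  under eq_integral => x _.
    have -> : (`|b|^-1 * (F x w * phi x) = `|b|^-1 * J w (- b^-1 * x + a * w / b)).
      have e1 : a * ((w - a * x) / b) - b * x = - b^-1 * x + a * w / b.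
        have -> : a * ((w - a * x) / b) - b * x =
           - (a ^+ 2 + b ^+ 2) * x / b + a * w / b by field.
        by rewrite ab; field.
      have e2 : (w - a * x) / b = b * w + a * (- b^-1 * x + a * w / b).
        have -> : b * w + a * (- b^-1 * x + a * w / b) =
           (a ^+ 2 + b ^+ 2) * w / b - a * x / b by field.
        by rewrite ab; field.
      have e3 : a * w - b * (- b^-1 * x + a * w / b) = x by field.
      rewrite /J /F -(std_normal_pdf_rotation w _ ab) e3 -e2 e1.
      by rewrite !mulrA.
    rewrite EFinM; over.
  rewrite ge0_integralZl//; first last.
  - by move=> x _; rewrite lee_fin.
  - apply/measurable_EFinP; apply: (measurableT_comp (mJw w)).
    by apply: measurable_funD => //; exact: measurable_funM.
  rewrite (ge0_integral_affine _ (f := fun u => (J w u)%:E))//; first last.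
  - by move=> u; rewrite lee_fin.
  - by apply/measurable_EFinP; exact: (mJw w).
  rewrite muleA -EFinM normrN normfV invrK mulVf ?mul1e ?normr_eq0//.
  rewrite std_normal_probE// -ge0_integralZl//; first last.
  - by rewrite lee_fin mulr_ge0.
  - by move=> u _; rewrite lee_fin mulr_ge0.
  - by apply/measurable_EFinP; exact: measurable_funM.
  by apply: eq_integral => u _; rewrite -EFinM; congr EFin; rewrite /J; ring.
rewrite ge0_integralZr//; first last.
- by move=> u _; rewrite lee_fin mulr_ge0.
- by apply/measurable_EFinP; exact: measurable_funM.
by rewrite -std_normal_probE.
Qed.

End standard_normal.

Section centered_normal.
Context {R : realType}.
Local Notation n01 := (@normal_prob R 0 1).
Local Notation phi := (@normal_pdf R 0 1).

(* The Dirac mass at 0 when v = 0, unlike normal_prob 0 0. *)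
Definition centered_normal (v : R) : set (measurableTypeR R) -> \bar R :=
  pushforward n01 (fun x : measurableTypeR R => (Num.sqrt v * x : measurableTypeR R)).

Let mscal (c : R) : measurable_fun [set: measurableTypeR R]
  (fun x : measurableTypeR R => (c * x : measurableTypeR R)).
Proof. exact: measurable_funM. Qed.

HB.instance Definition _ (v : R) := Measure.copy (centered_normal v)
  (measure_function_pushforward__canonical__measure_function_Measure n01
     (mscal (Num.sqrt v))).

Let centered_normalT v : centered_normal v setT = 1%E.
Proof. by rewrite /centered_normal /pushforward preimage_setT probability_setT. Qed.

HB.instance Definition _ v :=
  @Measure_isProbability.Build _ _ R (centered_normal v) (centered_normalT v).

Lemma std_normalN (C : set R) : measurable C -> n01 (-%R @^-1` C) = n01 C.
Proof.
move=> mC.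
have mC' : measurable (-%R @^-1` C) by rewrite -[X in measurable X]setTI; exact: oppr_measurable.
rewrite !std_normal_probE//.
have := @ge0_integral_affine R (-1) 0 (fun x => (\1_C x * phi x)%:E).
rewrite oppr_eq0 oner_neq0 normrN normr1 invr1 mul1e => <-//.
- apply: eq_integral => x _; rewrite mulN1r addr0 !std_normal_pdfE sqrrN.
  by rewrite !indicE.
- apply/measurable_EFinP; apply: measurable_funM; first exact: measurable_indic.
  exact: measurable_normal_pdf.
- by move=> x; rewrite lee_fin mulr_ge0// normal_pdf_ge0.
Qed.

(** The square root of s^2 is |s|, and the sign is absorbed by the symmetry of [n01]. Coefficients
    of either sign can thus be used without case distinctions. *)
Lemma centered_normal_sqr (s : R) (C : set R) : measurable C ->
  n01 ((fun x => s * x) @^-1` C) = centered_normal (s ^+ 2) C.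
Proof.
move=> mC; rewrite /centered_normal /pushforward sqrtr_sqr.
have [s0|s0] := leP 0 s; first by rewrite ger0_norm.
rewrite ltr0_norm// -std_normalN.
  by congr (n01 _); apply/seteqP; split => x /=; rewrite mulNr mulrN.
by rewrite -[X in measurable X]setTI; exact: (mscal s).
Qed.

Lemma normal_probE_centered (s : R) (C : set R) : 0 < s -> measurable C ->
  normal_prob 0 s C = centered_normal (s ^+ 2) C.
Proof.
move=> s0 mC; rewrite -centered_normal_sqr// std_normal_probE; last first.
  by rewrite -[X in measurable X]setTI; exact: (mscal s).
have mf : measurable_fun setT (fun y : R => (\1_C y * phi (s^-1 * y))).
  apply: measurable_funM; first exact: measurable_indic.
  by apply: measurableT_comp; [exact: measurable_normal_pdf|exact: (mscal s^-1)].
have := @ge0_integral_affine R s 0 (fun y => (\1_C y * phi (s^-1 * y))%:E).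
rewrite gt_eqF//.
under eq_integral => x _ do rewrite addr0 mulKf ?gt_eqF//.
rewrite /= => ->//; first last.
- by move=> x; rewrite lee_fin mulr_ge0// normal_pdf_ge0.
- exact/measurable_EFinP.
rewrite gtr0_norm// -ge0_integralZl//; first last.
- by rewrite lee_fin invr_ge0 ltW.
- by move=> x _; rewrite lee_fin mulr_ge0// normal_pdf_ge0.
- exact/measurable_EFinP.
rewrite /normal_prob [LHS]integral_mkcond; apply: eq_integral => x _.
rewrite patchE indicE; case: ifPn => xC /=; last by rewrite mul0r mule0.
rewrite mul1r -EFinM; congr EFin.
rewrite normal_pdfE ?gt_eqF// std_normal_pdfE /normal_fun subr0 mulrA; congr (_ * expR _).
  rewrite /normal_peak expr1n mul1r -invfM -mulrnAr sqrtrM ?sqr_ge0//.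
  by rewrite sqrtr_sqr gtr0_norm.
by rewrite -mulr_natr; field; rewrite gt_eqF.
Qed.

End centered_normal.

Section centered_normal_pair.
Context {R : realType}.
Local Notation n01 := (@normal_prob R 0 1).

Lemma measurable_preimage_scale (c : R) (C : set R) : measurable C ->
  measurable ((fun x => c * x) @^-1` C).
Proof.
move=> mC; rewrite -[X in measurable X]setTI.
by apply: (_ : measurable_fun setT (fun x : R => c * x)) => //; exact: measurable_funM.
Qed.

(** In standard coordinates the first combination is a multiple of the coordinate along a unit
    vector (a, b); by orthogonality the second is a multiple of the perpendicular coordinate, so the
    rotation lemma applies. The variance [v1] may be 0, while [0 < v2] and [q != 0] ensure b !=
    0. *)
Lemma centered_normal_orthogonal (v1 v2 p q p' q' : R) (C1 C2 : set R) :
  0 <= v1 -> 0 < v2 -> q != 0 -> p * p' * v1 + q * q' * v2 = 0 ->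
  measurable C1 -> measurable C2 ->
  ((centered_normal v1 \x centered_normal v2)
     [set z : measurableTypeR R * measurableTypeR R | C1 (p * z.1 + q * z.2)%R /\ C2 (p' * z.1 + q' * z.2)%R] =
   centered_normal (p ^+ 2 * v1 + q ^+ 2 * v2) C1 *
   centered_normal (p' ^+ 2 * v1 + q' ^+ 2 * v2) C2)%E.
Proof.
move=> v10 v20 q0 orth mC1 mC2.
set E := (X in product_measure1 _ _ X).
have mlin c c' : measurable_fun [set: measurableTypeR R * measurableTypeR R]
    (fun z => (c * z.1 + c' * z.2 : measurableTypeR R)).
  by apply: measurable_funD; exact: measurable_funM.
have mE : measurable E.
  apply: measurableI; rewrite -[X in measurable X]setTI; exact: mlin.
set s1 := Num.sqrt v1; set s2 := Num.sqrt v2.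
have s1E : s1 ^+ 2 = v1 by rewrite sqr_sqrtr.
have s2E : s2 ^+ 2 = v2 by rewrite sqr_sqrtr// ltW.
have s20 : 0 < s2 by rewrite sqrtr_gt0.
set rho := p ^+ 2 * v1 + q ^+ 2 * v2.
have rho0 : 0 < rho.
  apply: ltr_wpDl; first exact: mulr_ge0 (sqr_ge0 _) v10.
  by apply: mulr_gt0 => //; rewrite exprn_even_gt0.
set sr := Num.sqrt rho.
have srE : sr ^+ 2 = rho by rewrite sqr_sqrtr// ltW.
have sr0 : 0 < sr by rewrite sqrtr_gt0.
pose a := p * s1 / sr; pose b := q * s2 / sr.
have ab : a ^+ 2 + b ^+ 2 = 1.
  rewrite /a /b !exprMn exprVn -mulrDl srE s1E s2E divff// gt_eqF//.
have b0 : b != 0 by rewrite !mulf_neq0 ?invr_neq0// gt_eqF.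
(* Component of the second coefficient vector along (- b, a). Its component along (a, b) is 0 by
   [orth], so t^2 is the full squared length; t itself may be negative or 0. *)
pose t := a * (q' * s2) - b * (p' * s1).
have tE : t ^+ 2 = p' ^+ 2 * v1 + q' ^+ 2 * v2.
  have -> : t ^+ 2 = (a ^+ 2 + b ^+ 2) * ((p' * s1) ^+ 2 + (q' * s2) ^+ 2)
     - (a * (p' * s1) + b * (q' * s2)) ^+ 2 by rewrite /t; ring.
  have -> : a * (p' * s1) + b * (q' * s2) = (p * p' * s1 ^+ 2 + q * q' * s2 ^+ 2) / sr.
    by rewrite /a /b; field; rewrite gt_eqF.
  by rewrite s1E s2E orth mul0r expr0n subr0 ab mul1r !exprMn s1E s2E.
have orth' : a * (p' * s1) + b * (q' * s2) = 0.
  have -> : a * (p' * s1) + b * (q' * s2) = (p * p' * s1 ^+ 2 + q * q' * s2 ^+ 2) / sr.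
    by rewrite /a /b; field; rewrite gt_eqF.
  by rewrite s1E s2E orth mul0r.
have e1 x y : p * (s1 * x) + q * (s2 * y) = sr * (a * x + b * y).
  by rewrite /a /b; field; rewrite gt_eqF.
have e2 x y : p' * (s1 * x) + q' * (s2 * y) = t * (a * y - b * x).
  have -> : t * (a * y - b * x) = (a ^+ 2 + b ^+ 2) * (p' * s1 * x + q' * s2 * y)
     - (a * x + b * y) * (a * (p' * s1) + b * (q' * s2)) by rewrite /t; ring.
  by rewrite ab orth'; ring.
rewrite -tE -srE -!centered_normal_sqr// -(std_normal_rotation ab b0); first last.
- exact: measurable_preimage_scale.
- exact: measurable_preimage_scale.
rewrite /product_measure1.
rewrite ge0_integral_pushforward//=; first last.
- exact: measurable_fun_xsection.
- exact: measurable_funM.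
apply: eq_integral => x _ /=.
rewrite {1}/centered_normal /pushforward.
transitivity (n01 [set y | C1 (sr * (a * x + b * y)) /\ C2 (t * (a * y - b * x))]).
  congr (n01 _).
  by apply/seteqP; split => y; rewrite /xsection /E /= inE /= e1 e2.
rewrite -[X in n01 X]setIT -integral_indic//; last first.
  have m1 : measurable ((fun y => sr * (a * x + b * y)) @^-1` C1).
    rewrite -[X in measurable X]setTI.
    apply: (_ : measurable_fun setT (fun y : R => sr * (a * x + b * y))) => //.
    apply: measurable_funM => //.
    by apply: measurable_funD => //; exact: measurable_funM.
  have m2 : measurable ((fun y => t * (a * y - b * x)) @^-1` C2).
    rewrite -[X in measurable X]setTI.
    apply: (_ : measurable_fun setT (fun y : R => t * (a * y - b * x))) => //.
    apply: measurable_funM => //.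
    by apply: measurable_funB => //; exact: measurable_funM.
  exact: measurableI m1 m2.
apply: eq_integral => y _; congr EFin.
rewrite !indicE -natrM mulnb; congr (_%:R); congr nat_of_bool.
by apply/idP/andP; rewrite !inE.
Qed.

End centered_normal_pair.

(** * Gaussian variables independent of a sigma-algebra *)

Section independence.
Context {d : measure_display} {Omega : measurableType d} {R : realType}
        (P : probability Omega R).
Implicit Types (G H : set (set Omega)) (Y D W U : Omega -> R) (v : R).

Definition adapted G Y := forall C : set R, measurable C -> G (Y @^-1` C).

(** Law and independence in a single equation. [H] is any family of events: a pi-system is enough to
    start with, and [[set setT]] expresses the law alone. *)
Definition normal_indep H v Y :=
  measurable_fun setT Y /\
  forall A (C : set R), H A -> measurable C ->
    P (A `&` Y @^-1` C) = (P A * centered_normal v C)%E.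

Lemma measurable_preimage Y (C : set R) : measurable_fun setT Y -> measurable C ->
  measurable (Y @^-1` C).
Proof. by move=> mY mC; rewrite -[X in measurable X]setTI; exact: mY. Qed.

Lemma normal_indepS G H v Y : G `<=` H -> normal_indep H v Y -> normal_indep G v Y.
Proof. by move=> GH [mY hY]; split=> // A C /GH HA mC; exact: hY. Qed.

(** Independence is chained: D is independent of [H'], which contains the events A with Y in C, and
    Y is independent of [H]. *)
Lemma normal_indep_pair H H' v1 v2 Y D : H `<=` measurable ->
  normal_indep H v1 Y -> normal_indep H' v2 D ->
  (forall A (C : set R), H A -> measurable C -> H' (A `&` Y @^-1` C)) ->
  forall A (E : set (measurableTypeR R * measurableTypeR R)), H A -> measurable E ->
    P (A `&` (fun w => (Y w, D w)) @^-1` E) =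
    (P A * (centered_normal v1 \x centered_normal v2) E)%E.
Proof.
move=> Hm [mY hY] [mD hD] HH' A E HA mE.
have mA := Hm _ HA.
have mYD : measurable_fun [set: Omega] (fun w => (Y w, D w) : measurableTypeR R * measurableTypeR R).
  exact: measurable_fun_pair.
have PAfin : P A \is a fin_num by rewrite fin_num_measure.
have [PA0|PA0] := eqVneq (P A) 0%E.
  rewrite PA0 mul0e; apply/eqP; rewrite eq_le measure_ge0 andbT -PA0.
  apply: le_measure; rewrite ?inE//.
  by apply: measurableI => //; rewrite -[X in measurable X]setTI; exact: mYD.
pose c := fine (P A).
have c0 : 0 < c by rewrite fine_gt0// lt0e PA0 measure_ge0/= -ge0_fin_numE.
have cV0 : 0 <= c^-1 by rewrite invr_ge0 ltW.
have PAE : P A = c%:E by rewrite fineK.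
(* The law of (Y, D) under P conditioned on A. Uniqueness of the product measure leaves only
   rectangles to compare. *)
pose m' := mscale (NngNum cV0)
  (measure_function_pushforward__canonical__measure_function_Measure
    (mrestr P mA) mYD).
rewrite (@product_measure_unique _ _ _ _ _ (centered_normal v1) (centered_normal v2) m')//.
  by rewrite /m' /mscale /= /pushforward /mrestr muleA PAE -EFinM mulfV ?gt_eqF// mul1e setIC.
move=> C1 C2 mC1 mC2.
transitivity (c^-1%:E * P ((A `&` Y @^-1` C1) `&` D @^-1` C2))%E.
  congr (_ * P _)%E.
  by apply/seteqP; split => w /=; tauto.
rewrite hD//; last exact: HH'.
rewrite hY// PAE !muleA -EFinM mulVf ?gt_eqF// mul1e//.
Qed.

Lemma normal_indep_orthogonal H H' v1 v2 Y D (p q p' q' : R) : H `<=` measurable ->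
  normal_indep H v1 Y -> normal_indep H' v2 D ->
  (forall A (C : set R), H A -> measurable C -> H' (A `&` Y @^-1` C)) ->
  0 <= v1 -> 0 < v2 -> q != 0 -> p * p' * v1 + q * q' * v2 = 0 ->
  forall A (C1 C2 : set R), H A -> measurable C1 -> measurable C2 ->
  P (A `&` (fun w => p * Y w + q * D w) @^-1` C1
       `&` (fun w => p' * Y w + q' * D w) @^-1` C2) =
  (P A * centered_normal (p ^+ 2 * v1 + q ^+ 2 * v2) C1
       * centered_normal (p' ^+ 2 * v1 + q' ^+ 2 * v2) C2)%E.
Proof.
move=> Hm hY hD HH' v10 v20 q0 orth A C1 C2 HA mC1 mC2.
rewrite -muleA -centered_normal_orthogonal// -(normal_indep_pair Hm hY hD HH')//.
  by congr (P _); apply/seteqP; split => w /=; tauto.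
have mlin c c' : measurable_fun [set: measurableTypeR R * measurableTypeR R]
    (fun z => (c * z.1 + c' * z.2 : measurableTypeR R)).
  by apply: measurable_funD; exact: measurable_funM.
by apply: measurableI; rewrite -[X in measurable X]setTI; exact: mlin.
Qed.

(** Dynkin's argument: for fixed C, the events A satisfying the product formula form a lambda-system
    containing the pi-system [G]. *)
Lemma normal_indep_generated G v Y : G `<=` measurable -> setI_closed G -> G setT ->
  normal_indep G v Y -> normal_indep <<s G >> v Y.
Proof.
move=> Gm GI GT [mY hY]; split=> // A C.
have sG : <<s G >> `<=` @measurable _ Omega.
  by apply: smallest_sub => //; exact: sigma_algebra_measurable.
pose L := [set A | measurable A /\
   P (A `&` Y @^-1` C) = (P A * centered_normal v C)%E].
move=> sGA mC.
have mYC := measurable_preimage mY mC.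
have PYC : P (Y @^-1` C) = centered_normal v C.
  by rewrite -[Y @^-1` C]setTI hY// probability_setT mul1e.
suff sL : <<s G >> `<=` L by have [] := sL _ sGA.
apply: lambda_system_subset => //; last by move=> B GB; split; [exact: Gm|exact: hY].
have cfin : centered_normal v C \is a fin_num by rewrite fin_num_measure.
have PF B : measurable B -> P B \is a fin_num by move=> mB; rewrite fin_num_measure.
apply/dynkin_lambda_system; split.
- by split => //; exact: hY.
- move=> B [mB hB]; split; first exact: measurableC.
  rewrite setIC -setDE measureD//; last by rewrite ltey_eq PF.
  rewrite probability_setC// muleBl ?mul1e//.
  by rewrite (setIC _ B); congr (_ - _)%E; [exact: PYC|exact: hB].
- move=> F tF hF; split; first by apply: bigcup_measurable => k _; exact: (hF k).1.
  rewrite setI_bigcupl measure_bigcup//=; last 2 first.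
  + by move=> k _; apply: measurableI => //; exact: (hF k).1.
  + exact: trivIset_setIr.
  rewrite measure_bigcup//=; last by move=> k _; exact: (hF k).1.
  under eq_eseriesr => k _ do rewrite (hF k).2 muleC.
  by rewrite -(fineK cfin) nneseriesZl// muleC.
Qed.

End independence.

Section sub_sigma_algebras.
Context {d : measure_display} {Omega : measurableType d} {R : realType}
        (P : probability Omega R).
Implicit Types (G H : set (set Omega)) (Y D W U : Omega -> R) (v : R).

(** Gives access, for a sub-sigma-algebra, to all closure properties of measurable functions, by
    regarding [H] as the structure of another measurable type. *)
Lemma adaptedP H Y : sigma_algebra setT H ->
  adapted H Y <-> measurable_fun [set: g_sigma_algebraType H] Y.
Proof.
move=> sH; have HE : <<s H >> = H by exact: sigma_algebra_id.
split=> [hY _ C mC|hY C mC]; last first.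
  by have := hY measurableT C mC; rewrite setTI /measurable/= HE.
by rewrite setTI /measurable/= HE; exact: hY.
Qed.

Lemma adaptedS G H Y : G `<=` H -> adapted G Y -> adapted H Y.
Proof. by move=> GH hY C mC; exact/GH/hY. Qed.

Lemma adapted_measurable H Y : H `<=` measurable -> adapted H Y -> measurable_fun setT Y.
Proof. by move=> Hm hY _ C mC; rewrite setTI; exact/Hm/hY. Qed.

Lemma adapted_cvg H (h : nat -> Omega -> R) Y : sigma_algebra setT H ->
  (forall n, adapted H (h n)) -> (forall w, h n w @[n --> \oo] --> Y w) ->
  adapted H Y.
Proof.
move=> sH hh hY; apply/adaptedP => //.
apply: (@measurable_fun_cvg _ (g_sigma_algebraType H) R setT h) => [n|w _].
  exact/adaptedP.
exact: hY.
Qed.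

Definition join_sigma H W : set (set Omega) :=
  <<s H `|` preimage_set_system setT W measurable >>.

Lemma join_sigma_sub H W G : sigma_algebra setT G -> H `<=` G -> adapted G W ->
  join_sigma H W `<=` G.
Proof.
move=> sG HG WG; apply: smallest_sub => // A [/HG//|[C mC <-]].
by rewrite setTI; exact: WG.
Qed.

Lemma sub_join_sigma H W : H `<=` join_sigma H W.
Proof. by move=> A HA; apply: sub_gen_smallest; left. Qed.

Lemma adapted_join_sigma H W : adapted (join_sigma H W) W.
Proof.
by move=> C mC; apply: sub_gen_smallest; right; exists C => //; rewrite setTI.
Qed.

Lemma normal_indep_sum H H' v1 v2 Y D (p q : R) : H `<=` measurable ->
  normal_indep P H v1 Y -> normal_indep P H' v2 D ->
  (forall A (C : set R), H A -> measurable C -> H' (A `&` Y @^-1` C)) ->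
  0 <= v1 -> 0 < v2 -> q != 0 ->
  normal_indep P H (p ^+ 2 * v1 + q ^+ 2 * v2) (fun w => p * Y w + q * D w).
Proof.
move=> Hm hY hD HH' v10 v20 q0; split.
  by apply: measurable_funD; apply: measurable_funM => //; [exact: hY.1|exact: hD.1].
move=> A C HA mC.
(* The second combination is taken to be 0, which is trivially orthogonal to the first, and its
   event is the whole space. *)
have := normal_indep_orthogonal (p := p) (q := q) (p' := 0) (q' := 0) Hm hY hD HH' v10 v20 q0.
rewrite !mulr0 !mul0r addr0 => /(_ erefl A C setT HA mC measurableT).
by rewrite preimage_setT setIT probability_setT mule1.
Qed.

(** Abstract form of a filtering update: once the combination p Y + q D has been observed, any
    combination uncorrelated with it stays independent of the enlarged information. *)
Lemma normal_indep_residual H H' v1 v2 Y D (p q p' q' : R) : H `<=` measurable ->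
  sigma_algebra setT H ->
  normal_indep P H v1 Y -> normal_indep P H' v2 D ->
  (forall A (C : set R), H A -> measurable C -> H' (A `&` Y @^-1` C)) ->
  0 <= v1 -> 0 < v2 -> q != 0 -> p * p' * v1 + q * q' * v2 = 0 ->
  normal_indep P (join_sigma H (fun w => p * Y w + q * D w))
    (p' ^+ 2 * v1 + q' ^+ 2 * v2) (fun w => p' * Y w + q' * D w).
Proof.
move=> Hm sH hY hD HH' v10 v20 q0 orth.
set W := (X in join_sigma _ X).
have mW : measurable_fun setT W.
  by apply: measurable_funD; apply: measurable_funM => //; [exact: hY.1|exact: hD.1].
have HT : H setT.
  by case: sH => H0 HC _; rewrite -setC0 -setTD; exact: HC.
(* A pi-system that generates the join; on it the claim is the orthogonality formula, regrouped with
   the law of W. *)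
pose G := [set B | exists A (C : set R), [/\ H A, measurable C & B = A `&` W @^-1` C]].
have HI A B : H A -> H B -> H (A `&` B).
  by rewrite -(sigma_algebra_id sH) => HA HB; exact: (@measurableI _ (g_sigma_algebraType H)).
apply: (@normal_indepS _ _ _ P _ <<s G >>).
  apply: smallest_sub => [|A [HA|[C mC <-]]]; first exact: smallest_sigma_algebra.
    by apply: sub_gen_smallest; exists A, setT; split => //; rewrite preimage_setT setIT.
  by rewrite setTI; apply: sub_gen_smallest; exists setT, C; split => //; rewrite setTI.
apply: normal_indep_generated.
- by move=> _ [A [C [/Hm mA mC ->]]]; apply: measurableI => //; exact: measurable_preimage.
- move=> _ _ [A [C [HA mC ->]]] [B [C' [HB mC' ->]]]; exists (A `&` B), (C `&` C'); split.
  + exact: HI.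
  + exact: measurableI.
  + by rewrite preimage_setI setIACA.
- by exists setT, setT; split => //; rewrite preimage_setT setIT.
split.
  by apply: measurable_funD; apply: measurable_funM => //; [exact: hY.1|exact: hD.1].
move=> _ C2 [A [C1 [HA mC1 ->]]] mC2.
rewrite (normal_indep_orthogonal Hm hY hD HH')//.
congr (_ * _)%E.
have := normal_indep_sum p Hm hY hD HH' v10 v20 q0.
by move=> -[_ ->].
Qed.

(** Completion inside the ambient sigma-algebra: only measurable events are added, so P remains
    defined on all of them. It is needed because X is a function of beta only up to null events. *)
Definition null_ext G : set (set Omega) := [set A | measurable A /\
  exists2 A0, G A0 & P ((A `\` A0) `|` (A0 `\` A)) = 0%E].

Lemma measure_symdiff0 (A B : set Omega) : measurable A -> measurable B ->
  P ((A `\` B) `|` (B `\` A)) = 0%E -> P A = P B.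
Proof.
move=> mA mB AB0.
have le0 (C E : set Omega) : measurable C -> measurable E -> P (C `\` E) = 0%E -> (P C <= P E)%E.
  move=> mC mE CE0; apply: (@le_trans _ _ (P (E `|` (C `\` E)))).
    apply: le_measure; rewrite ?inE//; first by apply: measurableU => //; exact: measurableD.
    by move=> w Cw; have [Ew|nEw] := pselect (E w); [left|right].
  apply: (@le_trans _ _ (P E + P (C `\` E))%E); last by rewrite CE0 adde0.
  exact: measureU2 mE (measurableD mC mE).
have sub0 C : measurable C -> C `<=` (A `\` B) `|` (B `\` A) -> P C = 0%E.
  move=> mC CS; apply/eqP; rewrite eq_le measure_ge0 andbT -AB0.
  by apply: le_measure; rewrite ?inE//; apply: measurableU; exact: measurableD.
by apply/eqP; rewrite eq_le !le0//; apply: sub0; rewrite //; exact: measurableD.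
Qed.

Lemma null_ext_sub G : null_ext G `<=` measurable.
Proof. by move=> A []. Qed.

Lemma sub_null_ext G : G `<=` measurable -> G `<=` null_ext G.
Proof.
by move=> Gm A GA; split; [exact: Gm|exists A => //; rewrite setDv setU0 measure0].
Qed.

Lemma null_ext_null G A : G set0 -> measurable A -> P A = 0%E -> null_ext G A.
Proof. by move=> G0 mA PA; split=> //; exists set0; rewrite // setD0 set0D setU0. Qed.

Lemma sigma_algebra_null_ext G : G `<=` measurable -> sigma_algebra setT G ->
  sigma_algebra setT (null_ext G).
Proof.
move=> Gm sG; split.
- by apply: sub_null_ext => //; case: sG.
- move=> A [mA [A0 GA0 PA0]]; split; first by rewrite setTD; exact: measurableC.
  exists (setT `\` A0); first by case: sG => _ + _; exact.
  rewrite -[RHS]PA0; congr (P _); apply/seteqP.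
  by split => w/=; have := pselect (A w); have := pselect (A0 w); tauto.
- move=> F hF; split; first by apply: bigcup_measurable => k _; exact: (hF k).1.
  have /choice[F0 hF0] : forall k, exists A0, G A0 /\ P ((F k `\` A0) `|` (A0 `\` F k)) = 0%E.
    by move=> k; have [_ [A0 ? ?]] := hF k; exists A0.
  exists (\bigcup_k F0 k); first by case: sG => _ _; apply => k; exact: (hF0 k).1.
  have mk k : measurable ((F k `\` F0 k) `|` (F0 k `\` F k)).
    by apply: measurableU; apply: measurableD; [exact: (hF k).1|exact/Gm/(hF0 k).1|exact/Gm/(hF0 k).1|exact: (hF k).1].
  apply/negligibleP.
    by apply: measurableU; apply: measurableD; apply: bigcup_measurable => k _;
      [exact: (hF k).1|exact/Gm/(hF0 k).1|exact/Gm/(hF0 k).1|exact: (hF k).1].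
  apply: (@negligibleS _ _ _ _ (\bigcup_k ((F k `\` F0 k) `|` (F0 k `\` F k)))).
    move=> w [[[k _ Fkw] nw]|[[k _ Fkw] nw]]; exists k => //; [left|right]; split => //.
      by move=> ?; apply: nw; exists k.
    by move=> ?; apply: nw; exists k.
  apply: negligible_bigcup => k; apply/negligibleP => //; exact: (hF0 k).2.
Qed.

Lemma normal_indep_null_ext G v Y : G `<=` measurable -> normal_indep P G v Y ->
  normal_indep P (null_ext G) v Y.
Proof.
move=> Gm [mY hY]; split => // A C [mA [A0 GA0 PA0]] mC.
have mA0 := Gm _ GA0; have mYC := measurable_preimage mY mC.
rewrite (measure_symdiff0 mA mA0 PA0) -hY//.
apply: measure_symdiff0; [exact: measurableI..|].
apply/eqP; rewrite eq_le measure_ge0 andbT -PA0; apply: le_measure; rewrite ?inE.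
- by apply: measurableU; apply: measurableD; exact: measurableI.
- by apply: measurableU; exact: measurableD.
- by move=> w /=; tauto.
Qed.

Lemma adapted_ae_eq H Y Z : sigma_algebra setT H -> H `<=` measurable ->
  (forall A, measurable A -> P A = 0%E -> H A) ->
  measurable_fun setT Y -> adapted H Z -> {ae P, forall w, Y w = Z w} -> adapted H Y.
Proof.
move=> sH Hm Hnull mY hZ [N [mN PN NS]] C mC.
have HN := Hnull _ mN PN.
have -> : Y @^-1` C = ((Z @^-1` C) `\` N) `|` (Y @^-1` C `&` N).
  apply/seteqP; split => w /=.
    have [Nw|nNw] := pselect (N w); first by right.
    move=> Cw; left; split=> //; suff <- : Y w = Z w by [].
    by apply: contrapT => YZ; apply/nNw/NS.
  move=> [[Cw nNw]|[]//]; suff -> : Y w = Z w by [].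
  by apply: contrapT => YZ; apply/nNw/NS.
have HU A B : H A -> H B -> H (A `|` B).
  by rewrite -(sigma_algebra_id sH) => HA HB; exact: (@measurableU _ (g_sigma_algebraType H)).
have HD A B : H A -> H B -> H (A `\` B).
  by rewrite -(sigma_algebra_id sH) => HA HB; exact: (@measurableD _ (g_sigma_algebraType H)).
apply: HU; first by apply: HD => //; exact: hZ.
apply: Hnull; first by apply: measurableI => //; exact: measurable_preimage.
apply/eqP; rewrite eq_le measure_ge0 andbT -PN; apply: le_measure; rewrite ?inE//.
by apply: measurableI => //; exact: measurable_preimage.
Qed.

End sub_sigma_algebras.

(** * Integrals and limits of independent Gaussian variables *)

Section normal_integrals.
Context {d : measure_display} {Omega : measurableType d} {R : realType}
        (P : probability Omega R).
Local Notation n01 := (@normal_prob R 0 1).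
Implicit Types (H : set (set Omega)) (Y : Omega -> R) (v : R).

Lemma ge0_integral_mrestr (A : set Omega) (mA : measurable A) (f : Omega -> \bar R) :
  measurable_fun setT f -> (forall w, 0 <= f w)%E ->
  (\int[mrestr P mA]_w f w = \int[P]_(w in A) f w)%E.
Proof.
move=> mf f0; rewrite -(setUv A) ge0_integral_setU//; last 3 first.
- exact: measurableC.
- by rewrite setUv.
- by apply/disj_setPCl.
rewrite [X in (_ + X)%E]null_set_integral ?adde0//; last 3 first.
- exact: measurableC.
- exact: measurable_funTS.
- by rewrite -(measure0 P) /mrestr; congr (P _); rewrite setICl.
by apply: eq_measure_integral => B mB BA; congr (P _); exact: setIidl.
Qed.

(** The image under Y of P restricted to A is P(A) times the centered normal law. *)
Lemma normal_indep_ge0_integral H v Y A (f : R -> \bar R) :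
  normal_indep P H v Y -> H A -> measurable A ->
  measurable_fun setT f -> (forall x, 0 <= f x)%E ->
  (\int[P]_(w in A) f (Y w) = P A * \int[n01]_x f (Num.sqrt v * x)%R)%E.
Proof.
move=> [mY hY] HA mA mf f0.
have mfY : measurable_fun setT (f \o Y) by exact: measurableT_comp.
have PAfin : P A \is a fin_num by rewrite fin_num_measure.
have c0 : 0 <= fine (P A) by rewrite fine_ge0.
rewrite -ge0_integral_mrestr//.
have mY' : measurable_fun [set: Omega] (Y : Omega -> measurableTypeR R) by [].
transitivity (\int[pushforward (mrestr P mA) (Y : Omega -> measurableTypeR R)]_y f y)%E.
  by rewrite ge0_integral_pushforward.
have mE (B : set (measurableTypeR R)) : measurable B -> B `<=` setT ->
   pushforward (mrestr P mA) (Y : Omega -> measurableTypeR R) B =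
   mscale (NngNum c0) (centered_normal v) B.
  move=> mB _; rewrite /mscale/= /pushforward /mrestr setIC hY//.
  by rewrite fineK.
rewrite (eq_measure_integral _ mE)//.
rewrite ge0_integral_mscale//; congr (_ * _)%E; first exact: fineK.
by rewrite ge0_integral_pushforward//; exact: measurable_funM.
Qed.

Lemma normal_indep_integral H v Y A (f : R -> R) :
  normal_indep P H v Y -> H A -> measurable A ->
  measurable_fun setT f -> n01.-integrable setT (fun x => (f (Num.sqrt v * x))%:E) ->
  (\int[P]_(w in A) (f (Y w))%:E = P A * \int[n01]_x (f (Num.sqrt v * x))%:E)%E.
Proof.
move=> hY HA mA mf If.
have mEf : measurable_fun setT (EFin \o f) by exact/measurable_EFinP.
rewrite integralE [in RHS]integralE.
rewrite muleBr; last 2 first.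
- by rewrite fin_num_measure.
- by apply: fin_num_adde_defl; rewrite fin_numN; exact: integrable_neg_fin_num.
have Ep := normal_indep_ge0_integral hY HA mA (measurable_funepos mEf)
  (funepos_ge0 _).
have En := normal_indep_ge0_integral hY HA mA (measurable_funeneg mEf)
  (funeneg_ge0 _).
congr (_ - _)%E.
  apply: etrans (etrans Ep _); last congr (_ * _)%E;
  by apply: eq_integral => x _; rewrite !funeposE.
apply: etrans (etrans En _); last congr (_ * _)%E;
by apply: eq_integral => x _; rewrite !funenegE.
Qed.

(** Open half-lines are stable under intersection, exhaust the line and generate the Borel sets, so
    finite measures that agree on them coincide. This is the criterion suited to passing to
    limits. *)
Lemma normal_indepP H v Y : H `<=` measurable -> measurable_fun setT Y ->
  (forall A (c : R), H A ->
    P (A `&` [set w | Y w < c]) = (P A * centered_normal v [set x : measurableTypeR R | (x < c)%R])%E) ->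
  normal_indep P H v Y.
Proof.
move=> Hm mY hY; split => // A C HA mC.
have mA := Hm _ HA.
have PAfin : P A \is a fin_num by rewrite fin_num_measure.
have c0 : 0 <= fine (P A) by rewrite fine_ge0.
have mY' : measurable_fun [set: Omega] (Y : Omega -> measurableTypeR R) by [].
have ltE (c : R) : `]-oo, c[%classic = [set x | x < c].
  by apply/seteqP; split => x /=; rewrite in_itv.
pose m1 := measure_function_pushforward__canonical__measure_function_Measure (mrestr P mA) mY'.
pose m2 := mscale (NngNum c0) (centered_normal v).
have m2E B : m2 B = (P A * centered_normal v B)%E.
  by rewrite /m2 /mscale/=; congr (_ * _)%E; exact: fineK.
have m1E B : m1 B = P (A `&` Y @^-1` B).
  by rewrite /m1 /= /pushforward /mrestr setIC.
rewrite -m1E -m2E.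
apply: (@measure_unique _ R (measurableTypeR R) (@RGenInftyO.G R)
  (fun k => `]-oo, k%:R[%classic) (@RGenInftyO.measurableE R)) => //.
- move=> _ _ [x ->] [y ->]; exists (Num.min x y).
  by apply/seteqP; split => z /=; rewrite !in_itv/= lt_min => /andP.
- by move=> k; exists k%:R.
- apply/seteqP; split => // x _; exists (Num.truncn `|x|).+1 => //=.
  by rewrite in_itv/=; apply: (le_lt_trans (ler_norm x)); exact: truncnS_gt.
- move=> _ [c ->]; rewrite ltE.
  exact: etrans (m1E _) (etrans (hY _ _ HA) (esym (m2E _))).
- move=> k; apply: (le_lt_trans (_ : m1 _ <= P (A `&` Y @^-1` `]-oo, k%:R[%classic))%E).
    by rewrite m1E.
  apply: (le_lt_trans (measureIl P mA _)); last by rewrite ltey_eq PAfin.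
  exact: measurable_preimage.
Qed.

End normal_integrals.

Section normal_limits.
Context {d : measure_display} {Omega : measurableType d} {R : realType}
        (P : probability Omega R).
Local Notation n01 := (@normal_prob R 0 1).
Implicit Types (H : set (set Omega)) (Y : Omega -> R) (v : R).

Lemma bounded_cvg_integral d' (T : measurableType d') (mu : probability T R)
  (D : set T) (f_ : nat -> T -> R) (f : T -> R) : measurable D ->
  (forall n, measurable_fun setT (f_ n)) -> measurable_fun setT f ->
  (forall n x, `|f_ n x| <= 1) ->
  {ae mu, forall x, f_ n x @[n --> \oo] --> f x} ->
  (\int[mu]_(x in D) (f_ n x)%:E @[n --> \oo] --> \int[mu]_(x in D) (f x)%:E)%E.
Proof.
move=> mD mf_ mf b cv.
have [] // := @dominated_convergence _ T R mu D mD (fun n x => (f_ n x)%:E)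
  (fun x => (f x)%:E) (cst 1%E).
- by move=> n; apply/measurable_funTS/measurable_EFinP.
- by apply/measurable_funTS/measurable_EFinP.
- apply: filterS cv => x fx _; apply/fine_cvgP; split; [exact: nearW|exact: fx].
- by apply: finite_measure_integrable_cst.
- by apply: aeW => x n _; rewrite abse_EFin lee_fin.
Qed.

(** Indicators do not pass to the limit in n, but continuous bounded functions do. Hence a double
    limit: in n for a fixed continuous function, then along functions approaching the indicator of a
    half-line. *)
Lemma normal_indep_cvg H v (v_ : nat -> R) (Y_ : nat -> Omega -> R) Y :
  H `<=` measurable -> (forall n, normal_indep P H (v_ n) (Y_ n)) ->
  measurable_fun setT Y -> {ae P, forall w, Y_ n w @[n --> \oo] --> Y w} ->
  v_ n @[n --> \oo] --> v -> normal_indep P H v Y.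
Proof.
move=> Hm hY_ mY YY vv; apply: normal_indepP => // A c HA.
have mA := Hm _ HA.
have PAfin : P A \is a fin_num by rewrite fin_num_measure.
(* Continuous ramps with values in [0, 1] that tend everywhere to the indicator of y < c. They are
   all 0 at y = c, which is why the half-lines are open. *)
pose f (k : nat) (y : R) := Num.min 1 (k%:R * Num.max 0 (c - y)).
have f01 k y : 0 <= f k y <= 1.
  by rewrite ge_min lexx/= le_min ler01/= mulr_ge0// le_max lexx.
have fb k y : `|f k y| <= 1 by have /andP[? ?] := f01 k y; rewrite ger0_norm.
have cf k : continuous (f k).
  move=> y.
  apply: (@continuous_min _ _ (cst 1) (fun y => k%:R * Num.max 0 (c - y))); first exact: cvg_cst.
  apply: cvgM; first exact: cvg_cst.
  apply: (@continuous_max _ _ (cst 0) (fun y => c - y)); first exact: cvg_cst.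
  by apply: cvgB; [exact: cvg_cst|exact: cvg_id].
have mf k : measurable_fun setT (f k) by exact: continuous_measurable_fun.
have mfs k s : measurable_fun [set: measurableTypeR R] (fun x : measurableTypeR R => f k (s * x)).
  by apply: (measurableT_comp (mf k)); exact: measurable_funM.
have cvf y : f k y @[k --> \oo] --> ((y < c)%R%:R : R).
  have [yc|yc] := ltP y c; last first.
    apply: cvg_near_cst; near=> k; rewrite /f max_l ?subr_le0// mulr0.
    by apply/min_idPr.
  apply: cvg_near_cst; near=> k; rewrite /f max_r ?subr_ge0 ?(ltW yc)//.
  apply/min_idPl; rewrite -ler_pdivrMr ?subr_gt0//.
  near: k; exact: nbhs_infty_ger.
have If k v' : n01.-integrable setT (fun x => (f k (Num.sqrt v' * x))%:E).
  apply: (@le_integrable _ _ _ _ _ measurableT _ (cst 1%E)) => //.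
  - by apply/measurable_EFinP; exact: (mfs k (Num.sqrt v')).
  - by move=> x _; rewrite /= lee_fin normr1.
  - exact: finite_measure_integrable_cst.
have fE k : (\int[P]_(w in A) (f k (Y w))%:E = P A * \int[n01]_x (f k (Num.sqrt v * x))%:E)%E.
  have c1 : (\int[P]_(w in A) (f k (Y_ n w))%:E @[n --> \oo] --> \int[P]_(w in A) (f k (Y w))%:E)%E.
    apply: bounded_cvg_integral => //.
    - by move=> n; apply: measurableT_comp => //; exact: (hY_ n).1.
    - exact: measurableT_comp.
    - by apply: filterS YY => w Yw; exact: (cvg_comp _ _ Yw (cf k _)).
  (* All these laws are images of the one measure [n01] under scalings, so convergence of the
     variances becomes pointwise convergence of integrands, also when the limit is 0. *)
  have c2 : (P A * \int[n01]_x (f k (Num.sqrt (v_ n) * x))%:E @[n --> \oo] -->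
             P A * \int[n01]_x (f k (Num.sqrt v * x))%:E)%E.
    apply: cvgeZl => //; apply: bounded_cvg_integral => //.
    apply: aeW => x.
    have h : Num.sqrt (v_ n) * x @[n --> \oo] --> Num.sqrt v * x.
      by apply: cvgM; [exact: (cvg_comp _ _ vv (@sqrt_continuous _ v))|exact: cvg_cst].
    exact: (cvg_comp _ _ h (cf k _)).
  have e : (fun n => \int[P]_(w in A) (f k (Y_ n w))%:E)%E =
           (fun n => P A * \int[n01]_x (f k (Num.sqrt (v_ n) * x))%:E)%E.
    by apply/funext => n; exact: (normal_indep_integral (hY_ n) HA mA (mf k) (If k _)).
  by move: c1; rewrite e => c1; exact: (cvg_unique _ c1 c2).
have c1 : (\int[P]_(w in A) (f k (Y w))%:E @[k --> \oo] --> P (A `&` [set w | (Y w < c)%R]))%E.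
  have mYc : measurable [set w | Y w < c].
    by rewrite -[X in measurable X]setTI; apply: measurable_fun_ltr.
  rewrite setIC -integral_indic//.
  apply: bounded_cvg_integral => //; first by move=> k; exact: measurableT_comp.
  apply: aeW => w; rewrite indicE mem_setE; exact: cvf.
have c2 : (P A * \int[n01]_x (f k (Num.sqrt v * x))%:E @[k --> \oo] -->
   P A * centered_normal v [set x : measurableTypeR R | (x < c)%R])%E.
  apply: cvgeZl => //; rewrite /centered_normal /pushforward.
  have mc : measurable [set x : measurableTypeR R | Num.sqrt v * x < c].
    rewrite -[X in measurable X]setTI.
    apply: (@measurable_fun_ltr _ (measurableTypeR R) R setT (fun x => Num.sqrt v * x) (cst c)) => //.
    exact: measurable_funM.
  rewrite -[X in n01 X]setIT -integral_indic//.
  apply: bounded_cvg_integral => //.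
  apply: aeW => x; rewrite indicE mem_setE; exact: cvf.
by move: c1; rewrite (funext fE) => c1; exact: (cvg_unique _ c1 c2).
Unshelve. all: by end_near. Qed.

Lemma normal_indep_ae_eq H v Y Y' : H `<=` measurable -> normal_indep P H v Y ->
  measurable_fun setT Y' -> {ae P, forall w, Y w = Y' w} -> normal_indep P H v Y'.
Proof.
move=> Hm hY mY' YY'.
apply: (@normal_indep_cvg H v (fun=> v) (fun=> Y)) => //; last exact: cvg_cst.
by apply: filterS YY' => w ->; exact: cvg_cst.
Qed.

Lemma normal_indepZ H v Y (c : R) : 0 <= v -> normal_indep P H v Y ->
  normal_indep P H (c ^+ 2 * v) (fun w => c * Y w).
Proof.
move=> v0 [mY hY]; split; first exact: measurable_funM.
move=> A C HA mC.
have mcC : measurable ((fun x => c * x) @^-1` C) by exact: measurable_preimage_scale.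
have := hY A _ HA mcC; rewrite -comp_preimage => ->; congr (_ * _)%E.
have -> : c ^+ 2 * v = (c * Num.sqrt v) ^+ 2 by rewrite exprMn sqr_sqrtr.
rewrite -centered_normal_sqr// /centered_normal /pushforward; congr (n01 _).
by apply/seteqP; split => x /=; rewrite mulrA.
Qed.

End normal_limits.

(** * Moments of the standard normal law *)

Section normal_moments.
Context {R : realType}.
Local Notation mu := (@lebesgue_measure R).
Local Notation n01 := (@normal_prob R 0 1).
Local Notation phi := (@normal_pdf R 0 1).

Lemma is_derive_std_normal_pdf (x : R) : is_derive x 1 phi (- x * phi x).
Proof.
have -> : phi = (fun y => normal_peak 1 * expR (- y ^+ 2 / 2)).
  by apply/funext => y; rewrite std_normal_pdfE.
apply: is_derive_eq; rewrite !scaler0 add0r /GRing.scale/=.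
by field.
Qed.

Lemma cvg_std_normal_pdf : phi x @[x --> +oo%R] --> (0 : R).
Proof.
have -> : phi = (fun y => normal_peak 1 * gauss_fun ((Num.sqrt 2)^-1 * y)).
  apply/funext => y; rewrite std_normal_pdfE /gauss_fun exprMn exprVn sqr_sqrtr//.
  by congr (_ * expR _); ring.
rewrite -[X in _ --> X](mulr0 (normal_peak 1)).
apply: cvgM; first exact: cvg_cst.
apply: (cvg_comp _ _ _ cvg_gauss_fun).
by apply: gt0_cvgMry; rewrite ?invr_gt0 ?sqrtr_gt0.
Qed.

(** From 1 + x^2 / 2 <= exp(x^2 / 2) follows x phi(x) <= 2 phi(0) / x for x > 0. *)
Lemma cvg_id_std_normal_pdf : x * phi x @[x --> +oo%R] --> (0 : R).
Proof.
have p0 : 0 <= @normal_peak R 1 by exact: normal_peak_ge0.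
apply: (@squeeze_cvgr _ _ _ _ (cst 0) (fun x => (2 * normal_peak 1) * x^-1)).
- near=> x.
  have x0 : 0 < x by near: x; exact: nbhs_pinfty_gt.
  rewrite mulr_ge0 ?normal_pdf_ge0 ?(ltW x0)//= std_normal_pdfE.
  have E0 : 0 < expR (x ^+ 2 / 2) by exact: expR_gt0.
  have : 1 + x ^+ 2 / 2 <= expR (x ^+ 2 / 2) by exact: expR_ge1Dx.
  rewrite mulNr expRN => h.
  have -> : x * (normal_peak 1 * (expR (x ^+ 2 / 2))^-1) =
     normal_peak 1 * x^-1 * (x ^+ 2 / expR (x ^+ 2 / 2)) by field; rewrite !gt_eqF.
  rewrite -[leRHS]mulrA [leRHS]mulrC ler_wpM2l ?mulr_ge0 ?invr_ge0 ?(ltW x0)//.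
  by rewrite ler_pdivrMr//; lra.
- exact: cvg_cst.
- rewrite -[X in _ --> X](mulr0 (2 * normal_peak 1)).
  apply: cvgM; first exact: cvg_cst.
  apply/gtr0_cvgV0; last exact: cvg_id.
  exact: nbhs_pinfty_gt.
Unshelve. all: by end_near. Qed.

Lemma continuous_std_normal_pdf : continuous phi.
Proof. by apply: continuous_normal_pdf; rewrite oner_neq0. Qed.

Lemma std_normal_pdf_ge0 x : 0 <= phi x.
Proof. exact: normal_pdf_ge0. Qed.

Lemma std_normal_pdfN x : phi (- x) = phi x.
Proof. by rewrite !std_normal_pdfE sqrrN. Qed.

Lemma measurable_std_normal_pdf : measurable_fun setT phi.
Proof. exact: measurable_normal_pdf. Qed.

Lemma integral_id_std_normal_pdf (a : R) : 0 <= a ->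
  (\int[mu]_(x in `[a, +oo[) (x * phi x)%:E = (phi a)%:E)%E.
Proof.
move=> a0; rewrite (@ge0_continuous_FTC2y _ _ (fun x => - phi x) a 0).
- by rewrite EFinN oppeK add0e.
- by move=> x ax; rewrite mulr_ge0 ?std_normal_pdf_ge0// (le_trans a0).
- apply: continuous_subspaceT => x; apply: cvgM; first exact: cvg_id.
  exact: continuous_std_normal_pdf.
- by rewrite -[X in _ --> X]oppr0; apply: cvgN; exact: cvg_std_normal_pdf.
- by move=> x _; apply: derivableN; have [] := is_derive_std_normal_pdf x.
- apply: cvg_at_right_filter; apply: cvgN; exact: continuous_std_normal_pdf.
- move=> x _; rewrite derive1E deriveN; last by have [] := is_derive_std_normal_pdf x.
  by have [_ ->] := is_derive_std_normal_pdf x; rewrite mulNr opprK.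
Qed.

Lemma is_derive_id_std_normal_pdf (x : R) :
  is_derive x 1 (fun x => - (x * phi x)) ((x ^+ 2 - 1) * phi x).
Proof.
have h := is_derive_std_normal_pdf x.
by apply: is_derive_eq; rewrite /GRing.scale/=; ring.
Qed.

Lemma continuous_sqr_std_normal_pdf : continuous (fun x : R => (x ^+ 2 - 1) * phi x).
Proof.
move=> x; apply: cvgM; last exact: continuous_std_normal_pdf.
by apply: cvgB; [exact: exprn_continuous|exact: cvg_cst].
Qed.

Lemma integral_sqr_std_normal_pdf_1y :
  (\int[mu]_(x in `[1%R, +oo[) ((x ^+ 2 - 1) * phi x)%:E = (phi 1)%:E)%E.
Proof.
rewrite (@ge0_continuous_FTC2y _ _ (fun x => - (x * phi x)) 1 0).
- by rewrite EFinN oppeK add0e mul1r.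
- move=> x x1; rewrite mulr_ge0 ?std_normal_pdf_ge0// subr_ge0.
  by rewrite exprn_ege1.
- apply: continuous_subspaceT; exact: continuous_sqr_std_normal_pdf.
- by rewrite -[X in _ --> X]oppr0; apply: cvgN; exact: cvg_id_std_normal_pdf.
- by move=> x _; have [] := is_derive_id_std_normal_pdf x.
- apply: cvg_at_right_filter; apply: cvgN; apply: cvgM; first exact: cvg_id.
  exact: continuous_std_normal_pdf.
- by move=> x _; rewrite derive1E; have [_ ->] := is_derive_id_std_normal_pdf x.
Qed.

Lemma integral_sqr_std_normal_pdf_01 :
  (\int[mu]_(x in `[0%R, 1%R]) ((x ^+ 2 - 1) * phi x)%:E = - (phi 1)%:E)%E.
Proof.
rewrite (@continuous_FTC2 _ _ (fun x => - (x * phi x)) 0 1)//.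
- by rewrite mul1r mul0r oppr0 EFinN sube0.
- apply: continuous_subspaceT; exact: continuous_sqr_std_normal_pdf.
- split.
  + by move=> x _; have [] := is_derive_id_std_normal_pdf x.
  + apply: cvg_at_right_filter; apply: cvgN; apply: cvgM; first exact: cvg_id.
    exact: continuous_std_normal_pdf.
  + apply: cvg_at_left_filter; apply: cvgN; apply: cvgM; first exact: cvg_id.
    exact: continuous_std_normal_pdf.
- by move=> x _; rewrite derive1E; have [_ ->] := is_derive_id_std_normal_pdf x.
Qed.

(** Integration by parts: (x^2 - 1) phi(x) is the derivative of - x phi(x), which vanishes at 0 and
    at infinity. The integrand changes sign at 1, so the half-line is cut there to keep integrands
    of constant sign, and the two boundary terms phi(1) cancel. *)
Lemma integral_sqr_std_normal_pdf_0y :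
  (\int[mu]_(x in `[0%R, +oo[) (x ^+ 2 * phi x)%:E = \int[mu]_(x in `[0%R, +oo[) (phi x)%:E)%E.
Proof.
have m0 : measurable_fun setT (fun x : R => (x ^+ 2 * phi x)%:E).
  apply/measurable_EFinP; apply: measurable_funM; last exact: measurable_std_normal_pdf.
  exact: measurable_funX.
have m1 : measurable_fun setT (fun x : R => ((x ^+ 2 - 1) * phi x)%:E).
  apply/measurable_EFinP; apply: continuous_measurable_fun; exact: continuous_sqr_std_normal_pdf.
have m2 : measurable_fun setT (fun x : R => (phi x)%:E).
  by apply/measurable_EFinP; exact: measurable_std_normal_pdf.
have split01 (f : R -> \bar R) : measurable_fun setT f -> (forall x, 0 <= f x)%E ->
   (\int[mu]_(x in `[0%R, +oo[) f x = \int[mu]_(x in `[0%R, 1%R]) f x + \int[mu]_(x in `[1%R, +oo[) f x)%E.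
  move=> mf f0.
  have -> : `[0%R, +oo[%classic = `[0%R, 1%R]%classic `|` `]1%R, +oo[%classic :> set R.
    by rewrite -itv_bndbnd_setU// bnd_simp.
  rewrite ge0_integral_setU//.
  - by rewrite integral_itv_obnd_cbnd//; exact: measurable_funTS.
  - exact: measurable_funTS.
  - apply/disj_setPS => x /= [] /[!in_itv]/= /andP[_ x1] /[!andbT] /(le_lt_trans x1).
    by rewrite ltxx.
have p1 : 0 <= phi 1 by exact: std_normal_pdf_ge0.
rewrite !split01//; last 2 first.
- by move=> x; rewrite lee_fin std_normal_pdf_ge0.
- by move=> x; rewrite lee_fin mulr_ge0 ?sqr_ge0 ?std_normal_pdf_ge0.
have e1 : (\int[mu]_(x in `[1%R, +oo[) (x ^+ 2 * phi x)%:E =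
   (phi 1)%:E + \int[mu]_(x in `[1%R, +oo[) (phi x)%:E)%E.
  rewrite -integral_sqr_std_normal_pdf_1y -ge0_integralD//.
  - by apply: eq_integral => x _; rewrite -EFinD; congr EFin; ring.
  - move=> x; rewrite /= in_itv/= andbT => x1.
    by rewrite lee_fin mulr_ge0 ?std_normal_pdf_ge0// subr_ge0 exprn_ege1.
  - exact: measurable_funTS.
  - by move=> x _; rewrite lee_fin std_normal_pdf_ge0.
  - exact: measurable_funTS.
have e2 : (\int[mu]_(x in `[0%R, 1%R]) (x ^+ 2 * phi x)%:E + (phi 1)%:E =
   \int[mu]_(x in `[0%R, 1%R]) (phi x)%:E)%E.
  have -> : (phi 1)%:E = (\int[mu]_(x in `[0%R, 1%R]) ((1 - x ^+ 2) * phi x)%:E)%E.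
    rewrite -[LHS]oppeK -integral_sqr_std_normal_pdf_01 -integralN//.
      by apply: eq_integral => x _; rewrite -EFinN; congr EFin; ring.
    apply: integrable_add_def => //; apply: continuous_compact_integrable; first exact: segment_compact.
    by apply: continuous_subspaceT; exact: continuous_sqr_std_normal_pdf.
  rewrite -ge0_integralD//.
  - by apply: eq_integral => x _; rewrite -EFinD; congr EFin; ring.
  - by move=> x _; rewrite lee_fin mulr_ge0 ?sqr_ge0 ?std_normal_pdf_ge0.
  - exact: measurable_funTS.
  - move=> x; rewrite /= in_itv/= => /andP[x0 x1].
    by rewrite lee_fin mulr_ge0 ?std_normal_pdf_ge0// subr_ge0 exprn_ile1.
  - apply: measurable_funTS; apply/measurable_EFinP.
    apply: measurable_funM; last exact: measurable_std_normal_pdf.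
    by apply: measurable_funB => //; exact: measurable_funX.
by rewrite e1 addeA e2.
Qed.

Lemma std_normal_second_moment : (\int[n01]_x (x ^+ 2)%:E = 1)%E.
Proof.
rewrite ge0_integral_std_normal; last 2 first.
- by apply/measurable_EFinP; exact: measurable_funX.
- by move=> x; rewrite lee_fin sqr_ge0.
under eq_integral => x _ do rewrite -EFinM.
have sE : [set x : R | 0 <= x] = `[0, +oo[%classic by rewrite set_itvcy.
rewrite ge0_symfun_integralT; last 3 first.
- by move=> x; rewrite mulr_ge0 ?sqr_ge0 ?std_normal_pdf_ge0.
- move=> x; apply: cvgM; [exact: exprn_continuous|exact: continuous_std_normal_pdf].
- by move=> x /=; rewrite sqrrN std_normal_pdfN.
rewrite sE integral_sqr_std_normal_pdf_0y -sE -ge0_symfun_integralT; last 3 first.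
- exact: std_normal_pdf_ge0.
- exact: continuous_std_normal_pdf.
- by move=> x /=; rewrite std_normal_pdfN.
exact: integral_normal_pdf.
Qed.

Lemma ge0_integral_std_normalN (f : R -> \bar R) : measurable_fun setT f ->
  (forall x, 0 <= f x)%E -> (\int[n01]_x f (- x)%R = \int[n01]_x f x)%E.
Proof.
move=> mf f0.
have mN : measurable_fun [set: R] (fun x : R => f (- x)%R) by exact: measurableT_comp.
rewrite !ge0_integral_std_normal//.
pose g x := (f x * (phi x)%:E)%E.
have mg : measurable_fun setT g.
  apply: emeasurable_funM => //.
  by apply/measurable_EFinP; exact: measurable_std_normal_pdf.
have g0 x : (0 <= g x)%E by rewrite mule_ge0// lee_fin std_normal_pdf_ge0.
have m10 : (-1 : R) != 0 by rewrite oppr_eq0 oner_neq0.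
have e : (`|-1|^-1%:E = 1 :> \bar R)%E by rewrite normrN normr1 invr1.
have := ge0_integral_affine 0 m10 mg g0; rewrite e mul1e => E.
apply: etrans E; apply: eq_integral => x _.
by rewrite mulN1r addr0 /g std_normal_pdfN.
Qed.

(** For c <= 0 the positive part lives on [- c, +oo[, where x >= 0. Moving the term in c to the
    other side leaves only integrals of nonnegative functions; finiteness then comes out of the
    identity. *)
Lemma std_normal_posN (c : R) : c <= 0 ->
  (\int[n01]_x (Num.max (c + x) 0)%R%:E = (phi c + c * fine (n01 `]-oo, c]))%:E)%E.
Proof.
move=> c0.
have mphi : measurable_fun setT (fun x : R => (phi x)%:E).
  by apply/measurable_EFinP; exact: measurable_std_normal_pdf.
have mx : measurable_fun setT (fun x : R => (x * phi x)%:E).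
  apply/measurable_EFinP; apply: measurable_funM => //.
  exact: measurable_std_normal_pdf.
have mcx : measurable_fun setT (fun x : R => ((c + x) * phi x)%:E).
  apply/measurable_EFinP; apply: measurable_funM; last exact: measurable_std_normal_pdf.
  exact: measurable_funD.
rewrite ge0_integral_std_normal; last 2 first.
- apply/measurable_EFinP; apply: measurable_maxr => //; exact: measurable_funD.
- by move=> x; rewrite lee_fin le_max lexx orbT.
have -> : (\int[mu]_x ((Num.max (c + x) 0)%R%:E * (phi x)%:E) =
   \int[mu]_(x in `[(- c)%R, +oo[) ((c + x) * phi x)%:E)%E.
  rewrite [RHS]integral_mkcond; apply: eq_integral => x _; rewrite patchE -EFinM.
  have [cx|cx] := leP (- c) x.
    rewrite mem_set/= ?in_itv/= ?cx//.
    by rewrite max_l// -lerBlDl sub0r.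
  rewrite memNset/=; last by rewrite in_itv/= andbT; apply/negP; rewrite -ltNge.
  by rewrite max_r ?mul0r// -lerBrDl sub0r ltW.
have nE : n01 `[- c, +oo[ = n01 `]-oo, c].
  rewrite -std_normalN//; congr (n01 _); apply/seteqP.
  by split => x/=; rewrite !in_itv/= andbT lerN2.
have key : (\int[mu]_(x in `[(- c)%R, +oo[) ((c + x) * phi x)%:E + (- c)%:E * n01 `[(- c)%R, +oo[ = (phi c)%:E)%E.
  rewrite -[phi c]std_normal_pdfN -integral_id_std_normal_pdf ?oppr_ge0//.
  rewrite /normal_prob -ge0_integralZl//; last 3 first.
  - exact: measurable_funTS.
  - by move=> x _; rewrite lee_fin std_normal_pdf_ge0.
  - by rewrite lee_fin oppr_ge0.
  rewrite -ge0_integralD//.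
  - by apply: eq_integral => x _; rewrite -EFinM -EFinD; congr EFin; ring.
  - move=> x; rewrite /= in_itv/= andbT => cx.
    by rewrite lee_fin mulr_ge0 ?std_normal_pdf_ge0// -lerBlDl sub0r.
  - exact: measurable_funTS.
  - by move=> x _; rewrite mule_ge0// lee_fin ?oppr_ge0 ?std_normal_pdf_ge0.
  - by apply: measurable_funTS; exact: emeasurable_funM.
have nfin : n01 `]-oo, c] \is a fin_num by rewrite fin_num_measure.
move: key; rewrite nE -(fineK nfin) -EFinM.
case: (integral _ _ _) => [i| |]//; rewrite -EFinD => -[<-].
by congr EFin; ring.
Qed.

End normal_moments.

(** * The expected call payoff under a normal law *)

Section normal_call.
Context {R : realType}.
Local Notation n01 := (@normal_prob R 0 1).
Local Notation phi := (@normal_pdf R 0 1).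

Lemma std_normal_cdfN (c : R) : std_normal_cdf (- c) = 1 - std_normal_cdf c.
Proof.
rewrite /std_normal_cdf.
have -> : n01 `]-oo, (- c)%R] = n01 `]c, +oo[.
  rewrite -std_normalN//.
  have -> : -%R @^-1` `]-oo, (- c)%R]%classic = `[c, +oo[%classic :> set R.
    by apply/seteqP; split => x/=; rewrite !in_itv/= andbT lerN2.
  rewrite /normal_prob integral_itv_obnd_cbnd//.
  apply: measurable_funTS; apply/measurable_EFinP; exact: measurable_std_normal_pdf.
have -> : `]c, +oo[%classic = ~` `]-oo, c]%classic :> set R by rewrite setCitvl.
rewrite probability_setC// fineB//; last by rewrite fin_num_measure.
Qed.

Let mmax (f : R -> R) : measurable_fun setT f ->
  measurable_fun [set: R] (fun x => (Num.max (f x) 0)%:E).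
Proof. by move=> mf; apply/measurable_EFinP; exact: measurable_maxr. Qed.

Let maxge0 (x : R) : (0 <= (Num.max x 0)%:E)%E.
Proof. by rewrite lee_fin le_max lexx orbT. Qed.

Lemma integral_std_normal_pos0 : (\int[n01]_x (Num.max x 0)%:E = (phi 0)%:E)%E.
Proof.
have := @std_normal_posN R 0 (lexx _); rewrite mul0r addr0 => <-.
by apply: eq_integral => x _; rewrite add0r.
Qed.

Lemma integral_std_normal_pos (c : R) :
  (\int[n01]_x (Num.max (c + x) 0)%R%:E = (phi c + c * std_normal_cdf c)%:E)%E.
Proof.
have [c0|c0] := leP c 0; first exact: std_normal_posN.
have I0 := integral_std_normal_pos0.
have I0N : (\int[n01]_x (Num.max (- x)%R 0)%:E = (phi 0)%:E)%E.
  rewrite -I0 (@ge0_integral_std_normalN R (fun x => (Num.max x 0)%:E))//.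
  exact: (mmax (@measurable_id _ _ _)).
have Ic : (\int[n01]_x (Num.max (- c - x) 0)%R%:E = (phi c - c * std_normal_cdf (- c))%:E)%E.
  have c0' : - c <= 0 by rewrite oppr_le0 ltW.
  have := std_normal_posN c0'; rewrite std_normal_pdfN mulNr => <-.
  rewrite -(@ge0_integral_std_normalN R (fun x => (Num.max (- c + x) 0)%R%:E))//.
  by apply: mmax; exact: measurable_funD.
have mc : measurable_fun [set: R] (fun x : R => (Num.max (c + x) 0)%R%:E).
  by apply: mmax; exact: measurable_funD.
have mn : measurable_fun [set: R] (fun x : R => (Num.max (- x) 0)%R%:E).
  by apply: mmax; exact: measurable_funN.
have mcn : measurable_fun [set: R] (fun x : R => (Num.max (- c - x) 0)%R%:E).
  by apply: mmax; exact: measurable_funB.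
have mx : measurable_fun [set: R] (fun x : R => (Num.max x 0)%R%:E) by apply: mmax.
(* Put-call parity y^+ - (- y)^+ = y, taken at y = c + x and at y = x and subtracted; the terms are
   arranged so that every summand is nonnegative. It reduces c > 0 to the case - c <= 0. *)
have key : (\int[n01]_x (Num.max (c + x) 0)%R%:E + \int[n01]_x (Num.max (- x) 0)%R%:E =
  c%:E + \int[n01]_x (Num.max x 0)%R%:E + \int[n01]_x (Num.max (- c - x) 0)%R%:E)%E.
  rewrite -ge0_integralD//.
  have -> : c%:E = (\int[n01]_x (cst c%:E x))%E.
    rewrite integral_cst// -[LHS]mule1; congr (_ * _)%E; exact/esym/probability_setT.
  rewrite -ge0_integralD//; last by move=> x _; rewrite lee_fin ltW.
  rewrite -ge0_integralD//.
  - apply: eq_integral => x _ /=; rewrite -!EFinD; congr EFin.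
    by have [h1|h1] := leP (c + x) 0; have [h2|h2] := leP (- x) 0;
      have [h3|h3] := leP x 0; have [h4|h4] := leP (- c - x) 0; lra.
  - by move=> x _; apply: adde_ge0 => //; rewrite lee_fin ltW.
  - by apply: emeasurable_funD.
move: key; rewrite I0N I0 Ic std_normal_cdfN.
case: (integral _ _ _) => [i| |]//; rewrite -!EFinD => -[h].
by congr EFin; lra.
Qed.

Lemma integrable_std_normal_id : n01.-integrable setT (fun x : R => x%:E).
Proof.
apply/integrableP; split; first exact/measurable_EFinP.
under eq_integral => x _.
  have -> : (`|x%:E| = (Num.max x 0)%:E + (Num.max (- x)%R 0)%:E)%E.
    by rewrite -EFinD; congr EFin; have [h1|h1] := leP x 0; rewrite ?(ler0_norm h1) ?(gtr0_norm h1);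
      have [h2|h2] := leP (- x) 0; lra.
  over.
rewrite ge0_integralD//; last 2 first.
- exact: (mmax (@measurable_id _ _ _)).
- by apply: mmax; exact: measurable_funN.
rewrite (@ge0_integral_std_normalN R (fun x => (Num.max x 0)%:E))//; last first.
  exact: (mmax (@measurable_id _ _ _)).
by rewrite integral_std_normal_pos0 -EFinD ltry.
Qed.

Lemma std_normal_first_moment : (\int[n01]_x x%:E = 0)%E.
Proof.
rewrite integralE.
under eq_integral => x _ do rewrite funeposE -EFin_max.
under [X in (_ - X)%E]eq_integral => x _ do rewrite funenegE -EFinN -EFin_max.
rewrite (@ge0_integral_std_normalN R (fun x => (Num.max x 0)%:E))//; last first.
  exact: (mmax (@measurable_id _ _ _)).
by rewrite integral_std_normal_pos0 subee.
Qed.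

(** Bachelier's formula: taking s out of the positive part reduces it to unit variance. *)
Lemma integral_normal_call (a s : R) : 0 < s ->
  (\int[n01]_x (Num.max (a + s * x) 0)%R%:E =
   (Num.sqrt (s ^+ 2 / (2 * pi)) * expR (- (a ^+ 2 / (2 * s ^+ 2)))
    + a * std_normal_cdf (a / s))%:E)%E.
Proof.
move=> s0.
have -> : (\int[n01]_x (Num.max (a + s * x) 0)%R%:E =
           \int[n01]_x (s%:E * (Num.max (a / s + x) 0)%R%:E))%E.
  apply: eq_integral => x _; rewrite -EFinM; congr EFin.
  rewrite maxr_pMr ?(ltW s0)// mulr0 mulrDr mulrCA divff ?gt_eqF// mulr1//.
rewrite ge0_integralZl//; last 2 first.
- by apply: mmax; exact: measurable_funD.
- by rewrite lee_fin ltW.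
rewrite integral_std_normal_pos -EFinM; congr EFin.
rewrite mulrDr; congr (_ + _); last by field; rewrite gt_eqF.
rewrite std_normal_pdfE mulrA /normal_peak expr1n mul1r; congr (_ * expR _).
  rewrite sqrtrM ?sqr_ge0// sqrtr_sqr gtr0_norm// sqrtrV; last by rewrite mulr_ge0// pi_ge0.
  by rewrite mulr_natl.
by field; rewrite gt_eqF.
Qed.

End normal_call.

(** * Riemann sums along paths *)

Section riemann_sums.
Context {R : realType}.
Implicit Types (f x A E F : R -> R) (s t : R).

Lemma uniform_continuity_segment f s t eps : continuous f -> 0 < eps ->
  exists2 delta, 0 < delta & forall a b, s <= a <= t -> `|b - a| < delta ->
    `|f b - f a| < eps.
Proof.
move=> cf eps0.
have /compact_near_coveringP/(_ R (0^'+)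
  (fun delta a => forall b, `|b - a| < delta -> `|f b - f a| < eps)) := @segment_compact R s t.
case.
  move=> a _.
  have e20 : 0 < eps / 2 by rewrite divr_gt0.
  have /cvgrPdist_lt/(_ _ e20) := cf a.
  move=> /nbhs_ballP[eta /= eta0 Heta].
  have eta20 : 0 < eta / 2 by rewrite divr_gt0.
  exists (ball a (eta / 2), [set delta | delta < eta / 2]).
    split; first exact: nbhsx_ballx.
    exact: nbhs_right_lt.
  move=> [a' delta] /= [a'a deltaeta] b ba.
  have h1 : `|f a - f a'| < eps / 2.
    by apply: Heta; apply: le_ball a'a; lra.
  have h2 : `|f a - f b| < eps / 2.
    apply: Heta; rewrite /ball/=.
    rewrite (_ : a - b = (a - a') - (b - a')); last by ring.
    apply: le_lt_trans (ler_normB _ _) _.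
    move: a'a; rewrite /ball/= => a'a; lra.
  rewrite (_ : f b - f a' = (f a - f a') - (f a - f b)); last by ring.
  apply: le_lt_trans (ler_normB _ _) _; lra.
move=> delta /= d0 Hd.
exists (delta / 2); first by rewrite divr_gt0.
move=> a b ab ba.
apply: (Hd (delta / 2)) => //=.
- rewrite sub0r normrN gtr0_norm ?divr_gt0//; lra.
- by rewrite divr_gt0.
Qed.

Lemma segment_bounded f s t : continuous f ->
  exists2 M, 0 <= M & forall a, s <= a <= t -> `|f a| <= M.
Proof.
move=> cf; have [st|ts] := leP s t; last first.
  by exists 0 => // a /andP[sa at_]; have := le_lt_trans (le_trans sa at_) ts; rewrite ltxx.
have := @EVT_max R (fun u => `|f u|) s t st.
case.
  apply: continuous_subspaceT => u; apply: cvg_norm; exact: cf.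
move=> c _ H; exists `|f c| => // a sat; apply: H; rewrite in_itv/=; exact: sat.
Qed.

(** There are [n.+1] steps, so the mesh is never a division by 0; the endpoints are the indices 0
    and [n.+1]. *)
Definition grid s t (n i : nat) : R := s + i%:R * ((t - s) / n.+1%:R).

Lemma gridS s t n i : grid s t n i.+1 = grid s t n i + (t - s) / n.+1%:R.
Proof. by rewrite /grid -natr1 mulrDl mul1r addrA. Qed.

Lemma grid_le s t n i : s <= t -> grid s t n i <= grid s t n i.+1.
Proof. by move=> st; rewrite gridS lerDl divr_ge0// subr_ge0. Qed.

Lemma grid_lt s t n i : s < t -> grid s t n i < grid s t n i.+1.
Proof. by move=> st; rewrite gridS ltrDl divr_gt0// subr_gt0. Qed.

Lemma grid0 s t n : grid s t n 0 = s.
Proof. by rewrite /grid mul0r addr0. Qed.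

Lemma gridn s t n : grid s t n n.+1 = t.
Proof. by rewrite /grid mulrC divfK ?pnatr_eq0// subrKC. Qed.

Lemma grid_ge s t n i : s <= t -> s <= grid s t n i.
Proof. by move=> st; rewrite lerDl mulr_ge0// divr_ge0// subr_ge0. Qed.

Lemma grid_itv s t n i : s <= t -> (i <= n.+1)%N -> grid s t n i <= t.
Proof.
move=> st iN; rewrite -[leRHS](gridn s t n) lerD2l ler_wpM2r ?ler_nat//.
by rewrite divr_ge0// subr_ge0.
Qed.

(** If G(a, b) and F(b) - F(a) differ by o(b - a) uniformly, the errors add up to at most a small
    multiple of t - s while the increments of F telescope. *)
Lemma cvg_telescoping_sum (G : R -> R -> R) F s t : s <= t ->
  (forall eps, 0 < eps -> exists2 delta, 0 < delta &
     forall a b, s <= a -> a <= b -> b <= t -> b - a < delta ->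
       `|G a b - (F b - F a)| <= eps * (b - a)) ->
  \sum_(i < n.+1) G (grid s t n i) (grid s t n i.+1) @[n --> \oo] --> F t - F s.
Proof.
move=> st HG; apply/cvgrPdist_le => eps eps0.
(* The added 1 keeps the denominator positive when s = t. *)
have e'0 : 0 < eps / (t - s + 1) by rewrite divr_gt0// ltr_wpDl// subr_ge0.
have [delta d0 Hd] := HG _ e'0.
near=> n.
have nd : (t - s) / n.+1%:R < delta.
  rewrite ltr_pdivrMr// -ltr_pdivrMl// mulrC.
  near: n; exists (Num.truncn ((t - s) / delta)) => // n /= ngt.
  apply: lt_le_trans (truncnS_gt _) _; rewrite ler_nat//.
have -> : F t - F s = \sum_(i < n.+1) (F (grid s t n i.+1) - F (grid s t n i)).
  by rewrite -(big_mkord xpredT (fun i => F (grid s t n i.+1) - F (grid s t n i)))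
    telescope_sumr// gridn grid0.
rewrite -sumrB; apply: le_trans (ler_norm_sum _ _ _) _.
apply: (@le_trans _ _ (\sum_(i < n.+1) eps / (t - s + 1) * (grid s t n i.+1 - grid s t n i))).
  apply: ler_sum => i _; rewrite distrC; apply: Hd.
  - exact: grid_ge.
  - exact: grid_le.
  - exact: grid_itv.
  - by rewrite gridS addrAC subrr add0r.
rewrite -mulr_sumr -(big_mkord xpredT (fun i => grid s t n i.+1 - grid s t n i))
    telescope_sumr// gridn grid0.
rewrite mulrAC ler_pdivrMr; last by rewrite ltr_wpDl// subr_ge0.
by rewrite ler_pM2l// lerDl.
Unshelve. all: by end_near. Qed.

End riemann_sums.

Section exponential_sums.
Context {R : realType}.
Implicit Types (x A E : R -> R) (s t l k c : R).

Lemma is_derive_expRM (l u : R) : is_derive u 1 (fun v => expR (l * v)) (l * expR (l * u)).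
Proof. by apply: is_derive_eq; rewrite ?scaler0 ?addr0 ?add0r /GRing.scale/= ?mulr1; ring. Qed.

Lemma continuous_expRM (l : R) : continuous (fun v : R => expR (l * v)).
Proof.
move=> u; apply: (@continuous_comp _ _ _ (fun v : R => l * v) expR).
  by apply: cvgM; [exact: cvg_cst|exact: cvg_id].
exact: continuous_expR.
Qed.

Lemma mean_value (f df : R -> R) lo a b : lo < a -> a <= b ->
  (forall u : R, lo < u -> is_derive u 1 f (df u)) ->
  exists2 c, a <= c <= b & f b - f a = df c * (b - a).
Proof.
move=> loa ab fdf.
have cf : {within `[a, b], continuous f}.
  apply: derivable_within_continuous => u; rewrite in_itv/= => /andP[au _].
  by have [] := fdf u (lt_le_trans loa au).
have [|c cab e] := @MVT_segment R f df a b ab _ cf.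
  by move=> u; rewrite in_itv/= => /andP[au _]; exact: fdf (lt_trans loa au).
by exists c => //; move: cab; rewrite in_itv.
Qed.

(* All mean values occurring in an increment over [a, b] are taken at points
   of [a, b], so that uniform continuity makes them all close to the value
   at a, where they cancel. *)
Lemma cvg_exponential_sum_ou x A E lo s t l k c : lo < s -> s <= t -> l != 0 ->
  continuous x ->
  (forall u : R, lo < u -> is_derive u 1 A (x u)) ->
  (forall u : R, lo < u -> is_derive u 1 E (expR (l * u) * x u)) ->
  \sum_(i < n.+1) expR (l * grid s t n i) *
     (x (grid s t n i.+1) - x (grid s t n i) -
      (c * (grid s t n i.+1 - grid s t n i) -
       k * (A (grid s t n i.+1) - A (grid s t n i)))) @[n --> \oo] -->
  (expR (l * t) * x t - c / l * expR (l * t) - (l - k) * E t) -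
  (expR (l * s) * x s - c / l * expR (l * s) - (l - k) * E s).
Proof.
move=> los st l0 cx dA dE.
apply: (@cvg_telescoping_sum R
  (fun a b => expR (l * a) * (x b - x a - (c * (b - a) - k * (A b - A a))))
  (fun u => expR (l * u) * x u - c / l * expR (l * u) - (l - k) * E u) s t st) => eps eps0.
pose f u := expR (l * u).
have cf : continuous f by exact: continuous_expRM.
have [M1 M10 HM1] := segment_bounded s t cx.
have [M2 M20 HM2] := segment_bounded s t cf.
(* The sum of the bounds of the four error terms below, plus 1 so that C is positive. *)
pose C := `|l| * (M1 + M2) + `|c| + `|k| * M2 + `|l - k| * (M1 + M2) + 1.
have C0 : 0 < C by rewrite ltr_wpDl// !addr_ge0// mulr_ge0// addr_ge0.
have e'0 : 0 < eps / C by rewrite divr_gt0.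
have [d1 d10 H1] := uniform_continuity_segment s t cx e'0.
have [d2 d20 H2] := uniform_continuity_segment s t cf e'0.
exists (Num.min d1 d2); first by rewrite lt_min d10.
move=> a b sa ab bt; rewrite lt_min => /andP[bad1 bad2].
have sat : s <= a <= t by rewrite sa (le_trans ab).
have near_a u : a <= u <= b -> [/\ s <= u <= t, `|x u - x a| <= eps / C & `|f u - f a| <= eps / C].
  move=> /andP[au ub]; split.
  - by rewrite (le_trans sa)//= (le_trans ub).
  - by apply/ltW/H1 => //; rewrite ger0_norm ?subr_ge0//; apply: le_lt_trans bad1; rewrite lerD2r.
  - by apply/ltW/H2 => //; rewrite ger0_norm ?subr_ge0//; apply: le_lt_trans bad2; rewrite lerD2r.
have prod_a u w : a <= u <= b -> a <= w <= b -> `|f u * x w - f a * x a| <= (M1 + M2) * (eps / C).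
  move=> /near_a[sut _ fu] /near_a[swt xw _].
  rewrite (_ : f u * x w - f a * x a = (f u - f a) * x w + f a * (x w - x a)); last by ring.
  apply: le_trans (ler_normD _ _) _; rewrite !normrM mulrDl; apply: lerD.
    by rewrite mulrC; apply: ler_pM => //; exact: HM1.
  by apply: ler_pM => //; exact: HM2.
have loa := lt_le_trans los sa.
have [c1 c1ab E1] := mean_value loa ab (fun u _ => is_derive_expRM l u).
have [c2 c2ab E2] := mean_value loa ab dA.
have [c3 c3ab E3] := mean_value loa ab dE.
have bab : a <= b <= b by rewrite ab lexx.
rewrite (_ : _ - _ = (b - a) * (- l * (f c1 * x b - f a * x a) + c * (f c1 - f a)
    + k * (f a * (x c2 - x a)) + (l - k) * (f c3 * x c3 - f a * x a))); last first.
  have -> : E b = E a + expR (l * c3) * x c3 * (b - a) by rewrite -E3; ring.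
  have -> : A b = A a + x c2 * (b - a) by rewrite -E2; ring.
  have -> : expR (l * b) = expR (l * a) + l * expR (l * c1) * (b - a) by rewrite -E1; ring.
  by rewrite /f; field.
rewrite normrM ger0_norm ?subr_ge0// mulrC ler_wpM2r ?subr_ge0//.
apply: (@le_trans _ _ (`|l| * ((M1 + M2) * (eps / C)) + `|c| * (eps / C)
   + `|k| * (M2 * (eps / C)) + `|l - k| * ((M1 + M2) * (eps / C)))).
  apply: le_trans (ler_normD _ _) _; apply: lerD; last first.
    by rewrite normrM ler_wpM2l// prod_a.
  apply: le_trans (ler_normD _ _) _; apply: lerD; last first.
    rewrite normrM ler_wpM2l// normrM; have [_ ? _] := near_a _ c2ab.
    by apply: ler_pM => //; exact: HM2.
  apply: le_trans (ler_normD _ _) _; apply: lerD.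
    by rewrite normrM normrN ler_wpM2l// prod_a.
  by rewrite normrM ler_wpM2l//; have [_ _ ?] := near_a _ c1ab.
rewrite (_ : _ + _ = (C - 1) * (eps / C)); last by rewrite /C; ring.
rewrite mulrBl mulrC divfK ?gt_eqF// mul1r.
by rewrite gerBl ltW.
Qed.

(** These sums are the variances of the exponential sums of Brownian increments; the limit is the
    variance given by the Ito isometry. *)
Lemma cvg_exponential_sum_sqr s t l : s <= t -> l != 0 ->
  \sum_(i < n.+1) (expR (l * grid s t n i) ^+ 2 * (grid s t n i.+1 - grid s t n i))
    @[n --> \oo] -->
  (expR (2 * l * t) / (2 * l)) - (expR (2 * l * s) / (2 * l)).
Proof.
move=> st l0.
apply: (@cvg_telescoping_sum R (fun a b => expR (l * a) ^+ 2 * (b - a))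
  (fun u => expR (2 * l * u) / (2 * l)) s t st) => eps eps0.
have cf := @continuous_expRM (2 * l).
have [d1 d10 H1] := uniform_continuity_segment s t cf eps0.
exists d1 => // a b sa ab bt bad1.
have a1a : a - 1 < a by rewrite ltrBlDr ltrDl.
have [c1 /andP[ac1 c1b] E1] := mean_value a1a ab (fun u _ => is_derive_expRM (2 * l) u).
have -> : expR (l * a) ^+ 2 = expR (2 * l * a).
  by rewrite -expRM_natl; congr expR; ring.
rewrite -mulrBl E1 (_ : _ - _ = (expR (2 * l * a) - expR (2 * l * c1)) * (b - a)); last first.
  by field.
rewrite normrM [X in _ * X]ger0_norm ?subr_ge0// ler_wpM2r ?subr_ge0// distrC.
apply/ltW/H1; first by rewrite sa (le_trans ab).
by rewrite ger0_norm ?subr_ge0//; apply: le_lt_trans bad1; rewrite lerD2r.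
Qed.

End exponential_sums.

(** * Measurability of path integrals *)

Section continuous_processes.
Context {d : measure_display} {T : measurableType d} {R : realType}
  (x : R -> T -> R) (mx : forall u, measurable_fun setT (x u))
  (cx : forall w, continuous (x ^~ w)).
Local Notation mu := (@lebesgue_measure R).

(** Rounding time down to a mesh of step 1 / (n + 1) leaves countably many times, where
    measurability at fixed times suffices; path continuity gives the limit. *)
Lemma measurable_continuous_process :
  measurable_fun [set: T * measurableTypeR R] (fun p => x p.2 p.1).
Proof.
pose fl (n : nat) (u : R) : R := (Num.floor (u * n.+1%:R))%:~R / n.+1%:R.
apply: (@measurable_fun_cvg _ (T * measurableTypeR R)%type R setT
  (fun n p => x (fl n p.2) p.1)) => [n|[w u] _ /=]; last first.
  suff h : fl n u @[n --> \oo] --> u by exact: (cvg_comp _ _ h (@cx w u)).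
  apply/cvgrPdist_le => eps eps0; near=> n.
  have n0 : 0 < n.+1%:R :> R by [].
  have fle : (Num.floor (u * n.+1%:R))%:~R <= u * n.+1%:R by exact: floor_le.
  have flt : u * n.+1%:R < (Num.floor (u * n.+1%:R))%:~R + 1.
    by have := lt_succ_floor (u * n.+1%:R); rewrite intrD.
  rewrite /fl ger0_norm ?subr_ge0 ?ler_pdivrMr//.
  rewrite lerBlDr -lerBlDl ler_pdivlMr// mulrBl lerBlDr.
  have : 1 <= eps * n.+1%:R.
    rewrite mulrC -ler_pdivrMr//.
    near: n; exists (Num.truncn (1 / eps)) => // n /= ngt.
    by apply/ltW; apply: lt_le_trans (truncnS_gt _) _; rewrite ler_nat.
  by move=> h; apply/ltW; apply: lt_le_trans flt _; rewrite lerD2l.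
move=> _ C mC; rewrite setTI.
rewrite (_ : _ @^-1` _ = \bigcup_(k : int)
  ((x (k%:~R / n.+1%:R) @^-1` C) `*` [set u : R | Num.floor (u * n.+1%:R) = k])); last first.
  apply/seteqP; split => [[w u] /= Cw|[w u] [k _ [/= Cw fk]]]; last first.
    by rewrite /fl/= fk.
  by exists (Num.floor (u * n.+1%:R)).
apply: countable_bigcupT_measurable => [//|k].
apply: measurableX; first by rewrite -[X in measurable X]setTI; exact: mx.
rewrite (_ : mkset _ = `[k%:~R / n.+1%:R, (k + 1)%:~R / n.+1%:R[%classic); first exact: measurable_itv.
apply/seteqP; split => u /=; rewrite in_itv/= ler_pdivrMr// ltr_pdivlMr//.
  by move=> kE; rewrite -kE; apply/andP; split; [exact: floor_le|exact: lt_succ_floor].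
by move=> h; exact: floor_def.
Unshelve. all: by end_near. Qed.

Lemma measurable_integral_process (g : R -> R) (D : set R) : measurable D ->
  measurable_fun setT g ->
  measurable_fun setT (fun w => \int[mu]_(u in D) (g u * x u w)).
Proof.
move=> mD mg.
pose f (p : T * measurableTypeR R) : \bar R := ((g p.2 * x p.2 p.1) * \1_D p.2)%:E.
have mf : measurable_fun setT f.
  apply/measurable_EFinP; apply: measurable_funM.
    by apply: measurable_funM; [exact: measurableT_comp|exact: measurable_continuous_process].
  by apply: measurableT_comp => //; exact: measurable_indic.
have fE w : (\int[mu]_(u in D) (g u * x u w)%:E = \int[mu]_u f (w, u))%E.
  rewrite integral_mkcond; apply: eq_integral => u _.
  rewrite patchE /f/= indicE; case: ifPn => _; first by rewrite mulr1.
  by rewrite mulr0.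
rewrite /Rintegral.
under eq_fun => w do rewrite fE.
apply: measurableT_comp => //.
have -> : (fun w => \int[mu]_u f (w, u))%E =
   (fun w => \int[mu]_u (f^\+ (w, u)) - \int[mu]_u (f^\- (w, u)))%E.
  apply/funext => w; rewrite integralE; congr (_ - _)%E; apply: eq_integral => u _.
    by rewrite !funeposE.
  by rewrite !funenegE.
apply: emeasurable_funB.
  exact: (measurable_fun_fubini_tonelli_F (m2 := mu) (f^\+)%E (measurable_funepos mf) (funepos_ge0 f)).
exact: (measurable_fun_fubini_tonelli_F (m2 := mu) (f^\-)%E (measurable_funeneg mf) (funeneg_ge0 f)).
Qed.

End continuous_processes.

(** * Brownian motion *)

Section brownian_sums.
Context {d : measure_display} {Omega : measurableType d} {R : realType}
        (P : probability Omega R).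
Implicit Types (W : R -> {RV P >-> R}) (G H : set (set Omega)).

Lemma sigma_algebra_sigma_gen (I : Type) (D : set I) (f : I -> Omega -> R) :
  sigma_algebra setT (sigma_gen D f).
Proof. exact: smallest_sigma_algebra. Qed.

Lemma adapted_sigma_gen (I : Type) (D : set I) (f : I -> Omega -> R) i :
  D i -> adapted (sigma_gen D f) (f i).
Proof.
move=> Di C mC; apply: sub_gen_smallest; exists i => //.
by exists C => //; rewrite setTI.
Qed.

Lemma sigma_gen_sub (I : Type) (D : set I) (f : I -> Omega -> R) G :
  sigma_algebra setT G -> (forall i, D i -> adapted G (f i)) -> sigma_gen D f `<=` G.
Proof.
move=> sG fG; apply: smallest_sub => // A [i Di [C mC <-]].
by rewrite setTI; exact: fG.
Qed.

Lemma sigma_genS (I : Type) (D D' : set I) (f : I -> Omega -> R) :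
  D `<=` D' -> sigma_gen D f `<=` sigma_gen D' f.
Proof.
move=> DD'; apply: sigma_gen_sub => [|i /DD' Di]; first exact: sigma_algebra_sigma_gen.
exact: adapted_sigma_gen.
Qed.

Lemma sigma_gen_measurable (I : Type) (D : set I) (f : I -> {RV P >-> R}) :
  sigma_gen D (fun i w => f i w) `<=` measurable.
Proof.
apply: sigma_gen_sub; first exact: sigma_algebra_measurable.
by move=> i _ C mC; exact: measurable_preimage.
Qed.

Lemma brownian_increment W s t : brownian_motion W -> 0 <= s -> s < t ->
  normal_indep P (sigma_gen `[0, s] (fun u w => W u w)) (t - s)
    (fun w => W t w - W s w).
Proof.
move=> [_ law ind _] s0 st; split; first exact: measurable_funB.
move=> A C HA mC; rewrite (ind _ _ s0 st)//; last first.
  exact: (@adapted_sigma_gen unit setT (fun _ w => W t w - W s w) tt).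
congr (_ * _)%E; apply: etrans (law _ _ s0 st _ mC) _.
have ts : 0 < t - s by rewrite subr_gt0.
rewrite normal_probE_centered ?sqrtr_gt0//.
by rewrite sqr_sqrtr// ltW.
Qed.

Lemma normal_indep0 H : normal_indep P H 0 (fun=> 0).
Proof.
split=> // A C HA mC; rewrite /centered_normal /pushforward.
have [C0|C0] := pselect (C 0).
  rewrite (_ : _ @^-1` C = setT); last by apply/seteqP; split.
  rewrite (_ : _ @^-1` C = setT); last by apply/seteqP; split => x //=; rewrite sqrtr0 mul0r.
  by rewrite setIT probability_setT mule1.
rewrite (_ : _ @^-1` C = set0); last by apply/seteqP; split.
rewrite (_ : _ @^-1` C = set0); last by apply/seteqP; split => x //=; rewrite sqrtr0 mul0r.
by rewrite setI0 !measure0 mule0.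
Qed.

(** Stopped after [m] of the [n.+1] steps of a fixed grid, so that its law can be found by induction
    on [m]. *)
Definition wiener_sum W (a : R -> R) s t n m (w : Omega) : R :=
  \sum_(i < m) a (grid s t n i) * (W (grid s t n i.+1) w - W (grid s t n i) w).

Lemma adapted_sum G m (f : 'I_m -> Omega -> R) : sigma_algebra setT G ->
  (forall i, adapted G (f i)) -> adapted G (fun w => \sum_(i < m) f i w).
Proof.
move=> sG fG; apply/adaptedP => //; apply: measurable_sum => i.
exact/adaptedP.
Qed.

Lemma adapted_affine G (f : Omega -> R) (a b : R) : sigma_algebra setT G ->
  adapted G f -> adapted G (fun w => a * f w + b).
Proof.
move=> sG /adaptedP-/(_ sG) fG; apply/adaptedP => //.
by apply: measurable_funD => //; exact: measurable_funM.
Qed.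

Lemma adaptedD G (f g : Omega -> R) : sigma_algebra setT G ->
  adapted G f -> adapted G g -> adapted G (fun w => f w + g w).
Proof.
move=> sG /adaptedP-/(_ sG) fG /adaptedP-/(_ sG) gG; apply/adaptedP => //.
exact: measurable_funD.
Qed.

Lemma adaptedZ G (f : Omega -> R) (a : R) : sigma_algebra setT G ->
  adapted G f -> adapted G (fun w => a * f w).
Proof.
move=> sG /adaptedP-/(_ sG) fG; apply/adaptedP => //; exact: measurable_funM.
Qed.

Lemma adapted_wiener_sum W a s t n m G : sigma_algebra setT G ->
  (forall i, (i <= m)%N -> adapted G (W (grid s t n i))) ->
  adapted G (wiener_sum W a s t n m).
Proof.
move=> sG hW; apply: adapted_sum => // i.
apply: adaptedZ => //.
have -> : (fun w => W (grid s t n i.+1) w - W (grid s t n i) w) =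
  (fun w => W (grid s t n i.+1) w + (-1) * W (grid s t n i) w).
  by apply/funext => w; rewrite mulN1r.
apply: adaptedD => //; first exact: hW.
by apply: adaptedZ => //; apply: hW; exact: ltnW.
Qed.

Lemma sigma_algebraI H A B : sigma_algebra setT H -> H A -> H B -> H (A `&` B).
Proof.
move=> sH; rewrite -(sigma_algebra_id sH) => HA HB.
exact: (@measurableI _ (g_sigma_algebraType H)).
Qed.

(** Each new increment is independent of the past up to its left grid point, which contains both the
    events before s and the preceding partial sum. *)
Lemma normal_indep_wiener_sum W a s t n m : brownian_motion W -> 0 <= s -> s < t ->
  (forall u, a u != 0) -> (m <= n.+1)%N ->
  normal_indep P (sigma_gen `[0, s] (fun u w => W u w))
    (\sum_(i < m) a (grid s t n i) ^+ 2 * (grid s t n i.+1 - grid s t n i))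
    (wiener_sum W a s t n m).
Proof.
move=> bW s0 st a0; elim: m => [_|m IH mn].
  have -> : wiener_sum W a s t n 0 = fun=> 0.
    by apply/funext => w; rewrite /wiener_sum big_ord0.
  by rewrite big_ord0; exact: normal_indep0.
have g0 : 0 <= grid s t n m by apply: le_trans (grid_ge _ _ (ltW st)).
have := @normal_indep_sum _ _ _ P _ _ _ _ _ _ 1 (a (grid s t n m))
  _ (IH (ltnW mn)) (brownian_increment bW g0 (grid_lt n m st)).
rewrite expr1n mul1r.
rewrite [X in normal_indep _ _ _ (X)](_ : _ = wiener_sum W a s t n m.+1); last first.
  by apply/funext => w; rewrite /wiener_sum big_ord_recr/= mul1r.
rewrite big_ord_recr/=; apply.
- exact: sigma_gen_measurable.
- have ad : adapted (sigma_gen `[0, grid s t n m] (fun u w => W u w))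
      (wiener_sum W a s t n m); last first.
    move=> A C HA mC.
    apply: (sigma_algebraI (sigma_algebra_sigma_gen _ _) _ (ad _ mC)).
    apply: (@sigma_genS _ `[0, s]%classic) HA => u; rewrite /= !in_itv/= => /andP[-> us].
    by apply: le_trans us _; exact/grid_ge/ltW.
  apply: adapted_wiener_sum; first exact: sigma_algebra_sigma_gen.
  move=> i im; apply: (@adapted_sigma_gen _ `[0, grid s t n m]%classic (fun u w => W u w)).
  rewrite /= in_itv/=.
  rewrite (le_trans s0) ?grid_ge ?(ltW st)//=.
  by rewrite lerD2l ler_wpM2r ?ler_nat// divr_ge0// subr_ge0 ltW.
- apply: sumr_ge0 => i _; rewrite mulr_ge0 ?sqr_ge0// subr_ge0.
  exact/grid_le/ltW.
- by rewrite subr_gt0; exact: grid_lt.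
- exact: a0.
Qed.

End brownian_sums.

Section primitive.
Context {R : realType}.
Local Notation mu := (@lebesgue_measure R).
Implicit Types f : R -> R.

(* Based at -1, so as to be differentiable at 0. *)
Definition primitive f (u : R) : R := \int[mu]_(t in `[-1, u]) f t.

Lemma continuous_integrable_segment f (a b : R) : continuous f ->
  mu.-integrable `[a, b] (EFin \o f).
Proof.
move=> cf; apply: continuous_compact_integrable; first exact: segment_compact.
exact: continuous_subspaceT.
Qed.

Lemma is_derive_primitive f (u : R) : continuous f -> -1 < u ->
  is_derive u 1 (primitive f) (f u).
Proof.
move=> cf u1.
have uu : u < u + 1 by rewrite ltrDl.
have [D1 D2] := @continuous_FTC1_closed R f (-1) u (u + 1) uu
  (continuous_integrable_segment _ _ cf) u1 (cf u).
by apply: DeriveDef; [exact: D1|rewrite -derive1E; exact: D2].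
Qed.

Lemma integral_segment_primitive f (a b : R) : continuous f -> -1 <= a -> a <= b ->
  \int[mu]_(t in `[a, b]) f t = primitive f b - primitive f a.
Proof.
move=> cf a1 ab; rewrite /primitive.
rewrite (@Rintegral_itvB R f (BLeft (-1)) (BRight b) a)//.
- rewrite Rintegral_itv_obnd_cbnd//.
  apply: integrableS (continuous_integrable_segment a b cf) => //.
  exact: subset_itv_oc_cc.
- exact: continuous_integrable_segment.
Qed.

End primitive.

(** * Ornstein-Uhlenbeck processes *)

Section ornstein_uhlenbeck_process.
Context {d : measure_display} {Omega : measurableType d} {R : realType}
        (P : probability Omega R) (kappa theta psi x0 : R)
        (beta X : R -> {RV P >-> R})
        (hbeta : brownian_motion beta)
        (hX : ornstein_uhlenbeck kappa theta psi x0 beta X).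
Local Notation mu := (@lebesgue_measure R).

(* The paths of X are continuous on [0, +oo[ only; freezing them at time 0
   makes them continuous on the whole line. *)
Definition frozen (u : R) (w : Omega) : R := X (Num.max 0 u) w.
Local Notation x := frozen.

Lemma frozenE u w : 0 <= u -> x u w = X u w.
Proof. by move=> u0; rewrite /frozen max_r. Qed.

Lemma continuous_frozen w : continuous (x ^~ w).
Proof.
move=> u; have [cX _] := hX.
have /subspace_continuousP/(_ (Num.max 0 u)) := cX w.
have m0 (v : R) : `[0, +oo[%classic (Num.max 0 v).
  by rewrite /= in_itv/= andbT le_max lexx.
move=> /(_ (m0 u)) cXu N NX; have := cXu _ NX.
rewrite /nbhs/= /within/= => near0.
have cmax : Num.max 0 v @[v --> u] --> Num.max 0 u.
  by apply: (@continuous_max _ _ (cst 0) id); [exact: cvg_cst|exact: cvg_id].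
have near1 := cmax _ near0.
by apply: (@filterS _ (nbhs u) _ _ _ _ near1) => v hv; exact: hv (m0 v).
Qed.

Lemma measurable_frozen u : measurable_fun setT (x u).
Proof. by rewrite /frozen; exact: measurable_funPT. Qed.

Definition expX l (w : Omega) (u : R) := expR (l * u) * x u w.

Lemma continuous_expX l w : continuous (expX l w).
Proof.
move=> u; apply: cvgM; first exact: (@continuous_expRM _ l).
exact: continuous_frozen.
Qed.

Lemma measurable_primitive_expX l u : measurable_fun setT (fun w => primitive (expX l w) u).
Proof.
have mg : measurable_fun setT (fun v : R => expR (l * v)).
  by apply: continuous_measurable_fun; exact: (@continuous_expRM R l).
exact: (@measurable_integral_process _ _ _ x measurable_frozen
  (fun w => @continuous_frozen w) (fun v => expR (l * v)) _ (measurable_itv _) mg).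
Qed.

Lemma measurable_primitive_frozen u : measurable_fun setT (fun w => primitive (x ^~ w) u).
Proof.
have := measurable_primitive_expX 0 u; congr measurable_fun.
apply/funext => w; congr primitive; apply/funext => v.
by rewrite /expX mul0r expR0 mul1r.
Qed.

(** The exceptional event does not depend on a and b, so the identity can be summed over any
    grid. *)
Lemma ou_increment : {ae P, forall w, forall a b, 0 <= a -> a <= b ->
  psi * (beta b w - beta a w) = x b w - x a w -
    (kappa * theta * (b - a)
     - kappa * (primitive (x ^~ w) b - primitive (x ^~ w) a))}.
Proof.
have [cX eX] := hX; apply: filterS eX => w ew.
have cx := @continuous_frozen w.
have key t : 0 <= t -> x t w = x0 + kappa * theta * t
    - kappa * (primitive (x ^~ w) t - primitive (x ^~ w) 0) + psi * beta t w.
  move=> t0; rewrite frozenE// ew//; congr (_ + _); rewrite -addrA; congr (_ + _).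
  have n1 : -1 <= 0 :> R by rewrite oppr_le0.
  have -> : \int[mu]_(u in `[0, t]) (kappa * (theta - X u w)) =
     \int[mu]_(u in `[0, t]) (kappa * theta - kappa * x u w).
    apply: eq_Rintegral => u; rewrite inE/= in_itv/= => /andP[u0 _].
    by rewrite frozenE// mulrBr.
  have i1 : mu.-integrable `[0, t] (EFin \o x ^~ w) by exact: continuous_integrable_segment.
  rewrite RintegralB//; last 2 first.
  - by apply: continuous_integrable_segment => u; exact: cvg_cst.
  - apply: continuous_integrable_segment => u; apply: cvgM; first exact: cvg_cst.
    exact: cx.
  congr (_ - _); last by rewrite RintegralZl// (integral_segment_primitive cx n1 t0).
  have mt : fine (mu `[0, t]%classic) = t.
    rewrite lebesgue_measure_itv/= lte_fin; case: ltP => [_|t0'].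
      by rewrite -EFinB/= subr0.
    by apply/le_anti; rewrite t0 t0'.
  by rewrite Rintegral_cst//; congr (_ * _); exact: mt.
move=> a b a0 ab; rewrite (key b (le_trans a0 ab)) (key a a0); ring.
Qed.

(** Its increments are psi times the Wiener integral of exp(l u) against beta: in that integral psi
    dbeta is replaced by dX - kappa (theta - X) du, and exp(l u) dX is integrated by parts. *)
Definition ou_potential l (u : R) (w : Omega) : R :=
  expR (l * u) * x u w - kappa * theta / l * expR (l * u)
  - (l - kappa) * primitive (expX l w) u.

(** The Riemann sum of the same integral with psi dbeta read off the path of X; it converges at
    every sample point, and agrees with the sum over beta almost surely. *)
Definition ou_sum l s t n (w : Omega) : R :=
  \sum_(i < n.+1) expR (l * grid s t n i) *
     (x (grid s t n i.+1) w - x (grid s t n i) w -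
      (kappa * theta * (grid s t n i.+1 - grid s t n i) -
       kappa * (primitive (x ^~ w) (grid s t n i.+1) - primitive (x ^~ w) (grid s t n i)))).

Lemma cvg_ou_sum l s t w : 0 <= s -> s <= t -> l != 0 ->
  ou_sum l s t n w @[n --> \oo] --> ou_potential l t w - ou_potential l s w.
Proof.
move=> s0 st l0.
apply: (@cvg_exponential_sum_ou R (x ^~ w) (primitive (x ^~ w)) (primitive (expX l w)) (-1)) => //.
- by apply: lt_le_trans s0; rewrite oppr_lt0.
- exact: continuous_frozen.
- by move=> u u1; apply: is_derive_primitive => //; exact: continuous_frozen.
- by move=> u u1; apply: (@is_derive_primitive _ (expX l w)) => //; exact: continuous_expX.
Qed.

Lemma measurable_ou_sum l s t n : measurable_fun setT (ou_sum l s t n).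
Proof.
apply: measurable_sum => i; apply: measurable_funM => //.
apply: measurable_funB; first by apply: measurable_funB; exact: measurable_frozen.
apply: measurable_funB => //; apply: measurable_funM => //.
by apply: measurable_funB; exact: measurable_primitive_frozen.
Qed.

Lemma measurable_ou_potential l u : measurable_fun setT (ou_potential l u).
Proof.
apply: measurable_funB.
  apply: measurable_funB => //; apply: measurable_funM => //; exact: measurable_frozen.
by apply: measurable_funM => //; exact: measurable_primitive_expX.
Qed.

Lemma ou_sum_wiener l s t n : 0 <= s -> s <= t ->
  {ae P, forall w, ou_sum l s t n w =
     psi * wiener_sum beta (fun u => expR (l * u)) s t n n.+1 w}.
Proof.
move=> s0 st; apply: filterS ou_increment => w ew.
rewrite /ou_sum /wiener_sum mulr_sumr; apply: eq_bigr => i _.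
rewrite mulrCA ew//; first exact: le_trans (grid_ge _ _ st).
exact: grid_le.
Qed.

(** A limit of Gaussian sums over beta, each independent of the path up to s; their variances
    converge as well. *)
Lemma ou_potential_increment l s t : 0 <= s -> s < t -> l != 0 ->
  normal_indep P (sigma_gen `[0, s] (fun u w => beta u w))
    (psi ^+ 2 * (expR (2 * l * t) / (2 * l) - expR (2 * l * s) / (2 * l)))
    (fun w => ou_potential l t w - ou_potential l s w).
Proof.
move=> s0 st l0.
apply: (@normal_indep_cvg _ _ _ P _ _
  (fun n => psi ^+ 2 * \sum_(i < n.+1) (expR (l * grid s t n i) ^+ 2 * (grid s t n i.+1 - grid s t n i)))
  (fun n w => psi * wiener_sum beta (fun u => expR (l * u)) s t n n.+1 w)).
- exact: sigma_gen_measurable.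
- move=> n; apply: normal_indepZ.
    apply: sumr_ge0 => i _; rewrite mulr_ge0 ?sqr_ge0// subr_ge0.
    exact/grid_le/ltW.
  by apply: normal_indep_wiener_sum => // u; rewrite gt_eqF// expR_gt0.
- by apply: measurable_funB; exact: measurable_ou_potential.
- have : {ae P, forall w, forall n, ou_sum l s t n w =
     psi * wiener_sum beta (fun u => expR (l * u)) s t n n.+1 w}.
    by apply: ae_foralln => n; exact: ou_sum_wiener (ltW st).
  apply: filterS => w ew; under eq_fun => n do rewrite -ew.
  exact: cvg_ou_sum (ltW st) l0.
- apply: cvgM; first exact: cvg_cst.
  exact: cvg_exponential_sum_sqr (ltW st) l0.
Qed.

Lemma adapted_ou_potential G l s t : sigma_algebra setT G -> G `<=` measurable ->
  (forall A, measurable A -> P A = 0%E -> G A) ->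
  (forall u, 0 <= u <= t -> adapted G (beta u)) ->
  0 <= s -> s <= t -> l != 0 ->
  adapted G (fun w => ou_potential l t w - ou_potential l s w).
Proof.
move=> sG Gm Gnull Gbeta s0 st l0.
apply: (@adapted_cvg _ _ _ _ (ou_sum l s t)) => // [n|w]; last exact: cvg_ou_sum.
apply: adapted_ae_eq (ou_sum_wiener l n s0 st) => //; first exact: measurable_ou_sum.
apply: adaptedZ => //; apply: adapted_wiener_sum => // i im.
by apply: Gbeta; rewrite (le_trans s0) ?grid_ge//= grid_itv.
Qed.

End ornstein_uhlenbeck_process.

Section almost_sure_limits.
Context {d : measure_display} {Omega : measurableType d} {R : realType}
        (P : probability Omega R).

(** The sum of the |f n| has finite expectation, hence is finite almost surely, and the terms of a
    convergent series tend to 0. *)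
Lemma ae_cvg0_geometric (f : nat -> Omega -> R) (C q : R) : 0 <= C -> 0 <= q < 1 ->
  (forall n, measurable_fun setT (f n)) ->
  (forall n, \int[P]_w `|f n w|%:E <= (C * q ^+ n)%:E)%E ->
  {ae P, forall w, f n w @[n --> \oo] --> 0}.
Proof.
move=> C0 /andP[q0 q1] mf fle.
pose g n w : \bar R := `|f n w|%:E.
have mg n : measurable_fun setT (g n).
  by apply/measurable_EFinP; exact: measurableT_comp.
have g0 n w : (0 <= g n w)%E by rewrite lee_fin.
have msum : measurable_fun setT (fun w => \sum_(n <oo) g n w)%E.
  by apply: ge0_emeasurable_sum.
have sum0 w : (0 <= \sum_(n <oo) g n w)%E by apply: nneseries_ge0.
have fin : (\int[P]_w (\sum_(n <oo) g n w) < +oo)%E.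
  rewrite integral_nneseries//.
  apply: (@le_lt_trans _ _ (C / (1 - q))%:E); last by rewrite ltry.
  apply: lime_le; first by apply: is_cvg_nneseries => n _ _; apply: integral_ge0.
  apply: nearW => n.
  have nq : `|q| < 1 by rewrite ger0_norm.
  apply: (@le_trans _ _ (\sum_(0 <= k < n) (C * q ^+ k)%:E)%E).
    by apply: lee_sum => k _; exact: fle.
  rewrite sumEFin lee_fin.
  have nd : nondecreasing_seq (series (geometric C q)).
    by apply/nondecreasing_seqP => k; rewrite seriesSr lerDl /geometric/= mulr_ge0 ?exprn_ge0.
  have := nondecreasing_cvgn_le nd (is_cvg_geometric_series nq) n.
  by rewrite (cvg_lim _ (cvg_geometric_series nq)).
have : P.-integrable setT (fun w => \sum_(n <oo) g n w)%E.
  apply/integrableP; split => //.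
  by under eq_integral => w _ do rewrite gee0_abs//.
move=> /(integrable_ae measurableT); apply: filterS => w /(_ I) wfin.
have wlt : (\sum_(0 <= n <oo) g n w < +oo)%E by rewrite ltey_eq wfin.
have tl := @nneseries_tail_cvg R (g ^~ w) predT wlt (fun k _ => g0 k w).
have gw : g n w @[n --> \oo] --> 0%E.
  apply: (@squeeze_cvge _ _ _ _ (cst 0%E) _ (fun N => \sum_(N <= k <oo) g k w)%E) => //.
    apply: nearW => n; rewrite g0/=.
    have := @nneseries_lim_ge R (g ^~ w) predT n n.+1 (fun k _ _ => g0 k w).
    by rewrite big_nat1.
  exact: cvg_cst.
by move/fine_cvg : gw => /= /norm_cvg0.
Qed.

Lemma adapted_ae_cvg H (h : nat -> Omega -> R) (Y : Omega -> R) :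
  sigma_algebra setT H -> H `<=` measurable ->
  (forall A, measurable A -> P A = 0%E -> H A) ->
  (forall n, adapted H (h n)) -> measurable_fun setT Y ->
  {ae P, forall w, h n w @[n --> \oo] --> Y w} -> adapted H Y.
Proof.
move=> sH Hm Hnull hh mY [N [mN PN NS]].
have HN := Hnull _ mN PN.
have mNC : measurable (~` N) by exact: measurableC.
(* Multiplying by the indicator of the complement of [N] changes functions only on a null event and
   makes the convergence hold everywhere. *)
have aeN (f : Omega -> R) : {ae P, forall w, f w = f w * \1_(~` N) w}.
  exists N; split => // w /= Hw; apply: contrapT => nNw; apply: Hw.
  by rewrite indicE mem_set// mulr1.
have aeN' (f : Omega -> R) : {ae P, forall w, f w * \1_(~` N) w = f w}.
  by apply: filterS (aeN f).
apply: (adapted_ae_eq sH Hm Hnull mY _ (aeN Y)).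
apply: (@adapted_cvg _ _ _ _ (fun n w => h n w * \1_(~` N) w)) => // [n|w].
  apply: (adapted_ae_eq sH Hm Hnull _ (hh n) (aeN' _)).
  apply: measurable_funM; first exact: adapted_measurable Hm (hh n).
  exact: measurable_indic.
have [Nw|nNw] := pselect (N w).
  rewrite indicE memNset ?mulr0; last by move=> /=; apply.
  under eq_fun do rewrite mulr0; exact: cvg_cst.
rewrite indicE mem_set// mulr1.
under eq_fun do rewrite mulr1.
by apply: contrapT => hw; apply/nNw/NS.
Qed.

End almost_sure_limits.

Section ornstein_uhlenbeck_law.
Context {d : measure_display} {Omega : measurableType d} {R : realType}
        (P : probability Omega R) (kappa theta psi x0 : R)
        (beta X : R -> {RV P >-> R})
        (hkappa : 0 < kappa)
        (hbeta : brownian_motion beta)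
        (hX : ornstein_uhlenbeck kappa theta psi x0 beta X).
Local Notation n01 := (@normal_prob R 0 1).
Local Notation x := (frozen X).
Local Notation F := (ou_potential kappa theta X).

Lemma ou_initial : {ae P, forall w, x 0 w = x0}.
Proof.
have [_ eX] := hX; have [b0 _ _ _] := hbeta.
apply: filterS2 b0 eX => w bw ew.
rewrite frozenE// ew// bw mulr0 addr0 set_itv1 Rintegral_set1 addr0//.
Qed.

Definition ou_mean (u : R) := expR (- (kappa * u)) * x0 + theta * (1 - expR (- (kappa * u))).

Definition ou_var (u : R) := psi ^+ 2 / (2 * kappa) * (1 - expR (- (2 * kappa * u))).

Lemma ou_var_ge0 u : 0 <= u -> 0 <= ou_var u.
Proof.
move=> u0; rewrite mulr_ge0 ?divr_ge0 ?sqr_ge0 ?mulr_ge0 ?(ltW hkappa)//.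
by rewrite subr_ge0 -[leRHS]expR0 ler_expR oppr_le0 !mulr_ge0// ltW.
Qed.

Lemma ou_var_le u : ou_var u <= psi ^+ 2 / (2 * kappa).
Proof.
apply: ler_piMr; last by rewrite gerBl expR_ge0.
by rewrite divr_ge0 ?sqr_ge0 ?mulr_ge0// ltW.
Qed.

(** Variation of constants: for l = kappa the primitive drops out of the potential, which can then
    be solved for x. *)
Lemma ou_solution u w : x u w =
  expR (- (kappa * u)) * (F kappa u w - F kappa 0 w) + theta
   + expR (- (kappa * u)) * (x 0 w - theta).
Proof.
rewrite /ou_potential mulr0 expR0 expRN.
by field; rewrite !gt_eqF// expR_gt0.
Qed.

Lemma ou_centered_ae u : {ae P, forall w,
  expR (- (kappa * u)) * (F kappa u w - F kappa 0 w) = x u w - ou_mean u}.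
Proof.
apply: filterS ou_initial => w w0.
by rewrite (ou_solution u w) w0 /ou_mean; ring.
Qed.

Lemma ou_law u : 0 <= u ->
  normal_indep P (sigma_gen `[0, 0] (fun v w => beta v w)) (ou_var u)
    (fun w => x u w - ou_mean u).
Proof.
(* Increments of the potential are treated for s < t only, so the degenerate law at u = 0 is handled
   apart. *)
rewrite le_eqVlt => /predU1P[<-|u0].
  have -> : ou_var 0 = 0 by rewrite /ou_var mulr0 oppr0 expR0 subrr mulr0.
  apply: normal_indep_ae_eq (normal_indep0 P _) _ _.
  - exact: sigma_gen_measurable.
  - by apply: measurable_funB => //; exact: measurable_frozen.
  - apply: filterS ou_initial => w ->.
    by rewrite /ou_mean mulr0 oppr0 expR0; ring.
apply: normal_indep_ae_eq (ou_centered_ae u).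
- exact: sigma_gen_measurable.
- have -> : ou_var u = expR (- (kappa * u)) ^+ 2 * (psi ^+ 2 * (expR (2 * kappa * u) / (2 * kappa) - expR (2 * kappa * 0) / (2 * kappa))).
    rewrite /ou_var mulr0 expR0 expRN.
    have -> : expR (- (kappa * u)) ^+ 2 = expR (- (2 * kappa * u)).
      by rewrite -expRM_natl; congr expR; ring.
    by rewrite expRN; field; rewrite !gt_eqF ?expR_gt0.
  apply: normal_indepZ.
    rewrite mulr_ge0 ?sqr_ge0// -mulrBl divr_ge0 ?mulr_ge0 ?(ltW hkappa)//.
    by rewrite subr_ge0 ler_expR ler_pM2l ?mulr_gt0// ltW.
  have k0 : kappa != 0 by rewrite gt_eqF.
  exact: (ou_potential_increment hbeta hX (lexx 0) u0 k0).
- by apply: measurable_funB => //; exact: measurable_frozen.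
Qed.

Lemma adapted_ou G u : sigma_algebra setT G -> G `<=` measurable ->
  (forall A, measurable A -> P A = 0%E -> G A) ->
  (forall v, 0 <= v <= u -> adapted G (beta v)) -> 0 <= u -> adapted G (x u).
Proof.
move=> sG Gm Gnull Gbeta u0.
have ae' : {ae P, forall w, x u w =
    expR (- (kappa * u)) * (F kappa u w - F kappa 0 w) + ou_mean u}.
  by apply: filterS (ou_centered_ae u) => w ->; rewrite subrK.
apply: (adapted_ae_eq sG Gm Gnull (measurable_frozen _ _) _ ae').
apply: adapted_affine => //.
by apply: (adapted_ou_potential hX) => //; rewrite gt_eqF.
Qed.

(** Mean reversion keeps mean and variance bounded in time, so discounting makes the absolute
    moments integrable over [0, +oo[. *)
Lemma ou_abs_bound : exists2 C : R, 0 <= C &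
  forall u, 0 <= u -> (\int[P]_w `|x u w|%:E <= C%:E)%E.
Proof.
pose M := fine (\int[n01]_z `|z|%:E)%E.
have In := @integrable_std_normal_id R.
have Mfin : (\int[n01]_z `|z|%:E)%E \is a fin_num.
  rewrite ge0_fin_numE; last by apply: integral_ge0 => z _; rewrite lee_fin.
  by have /integrableP[_ h] := In; exact: h.
have M0 : 0 <= M by rewrite fine_ge0// integral_ge0.
pose m := `|x0| + `|theta|.
exists (Num.sqrt (psi ^+ 2 / (2 * kappa)) * M + m).
  by rewrite addr_ge0// ?mulr_ge0 ?sqrtr_ge0// addr_ge0.
move=> u u0.
have sG : sigma_gen `[0, 0] (fun v w => beta v w) setT.
  by have [h0 hC _] := sigma_algebra_sigma_gen `[0, 0] (fun v w => beta v w);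
    rewrite -setC0 -setTD; exact: hC.
have mabs : measurable_fun [set: R] (fun z : R => `|z|%:E).
  by apply/measurable_EFinP.
have := @normal_indep_ge0_integral _ _ _ P _ _ _ setT (fun z : R => `|z|%:E) (ou_law u0) sG
  measurableT mabs (fun z => (normr_ge0 z : (0 <= `|z|%:E)%E)).
rewrite probability_setT mul1e => e.
have mm : `|ou_mean u| <= m.
  have e0 : 0 <= expR (- (kappa * u)) by exact: expR_ge0.
  have e1 : expR (- (kappa * u)) <= 1.
    by rewrite -[leRHS]expR0 ler_expR oppr_le0 mulr_ge0// ltW.
  apply: le_trans (ler_normD _ _) _; rewrite !normrM; apply: lerD.
    by rewrite ger0_norm// ler_piMl.
  by rewrite [X in _ * X]ger0_norm ?subr_ge0// ler_piMr// gerBl.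
apply: (@le_trans _ _ (\int[P]_w (`|x u w - ou_mean u|%:E + m%:E))%E).
  apply: ge0_le_integral => //.
  - by apply/measurable_EFinP; apply: measurableT_comp => //; exact: measurable_frozen.
  - apply: emeasurable_funD => //; apply/measurable_EFinP; apply: measurableT_comp => //.
    by apply: measurable_funB => //; exact: measurable_frozen.
  - move=> w _; rewrite -EFinD lee_fin.
    rewrite -[X in `|X|](subrK (ou_mean u)); apply: le_trans (ler_normD _ _) _.
    by rewrite lerD2l.
have m0 : 0 <= m by rewrite addr_ge0.
have mabsx : measurable_fun setT (fun w => `|x u w - ou_mean u|%:E).
  apply/measurable_EFinP; apply: measurableT_comp => //.
  by apply: measurable_funB => //; exact: measurable_frozen.
rewrite ge0_integralD//.
have Im : (\int[P]_(w in [set: Omega]) m%:E = m%:E)%E.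
  by rewrite integral_cst// -[RHS]mule1; congr (_ * _)%E; exact: probability_setT.
rewrite e Im [leRHS]EFinD; apply: leeD2r.
have -> : (\int[n01]_z `|Num.sqrt (ou_var u) * z|%:E =
    (Num.sqrt (ou_var u))%:E * \int[n01]_z `|z|%:E)%E.
  rewrite -ge0_integralZl//.
  by apply: eq_integral => z _; rewrite normrM ger0_norm// sqrtr_ge0.
rewrite -(fineK Mfin) -EFinM lee_fin ler_wpM2r//.
by rewrite ler_wsqrtr// ou_var_le.
Qed.

End ornstein_uhlenbeck_law.

(** * The discounted dividends after a given time *)

Section discounted_tail.
Context {d : measure_display} {Omega : measurableType d} {R : realType}
        (P : probability Omega R) (kappa theta psi x0 r : R)
        (beta X : R -> {RV P >-> R})
        (hkappa : 0 < kappa) (hr : 0 < r)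
        (hbeta : brownian_motion beta)
        (hX : ornstein_uhlenbeck kappa theta psi x0 beta X).
Local Notation mu := (@lebesgue_measure R).
Local Notation x := (frozen X).
Local Notation F := (ou_potential kappa theta X).
Local Notation E := (fun w => primitive (expX X (- r) w)).
Local Notation Y := (discounted_dividends r X).

Lemma discounted_dividendsE t w : 0 <= t ->
  Y t w = \int[mu]_(u in `[t, +oo[) expX X (- r) w u.
Proof.
move=> t0; apply: eq_Rintegral => u; rewrite inE/= in_itv/= andbT => tu.
by rewrite /expX mulNr frozenE// (le_trans t0).
Qed.

Lemma measurable_discounted_dividends t : 0 <= t -> measurable_fun setT (Y t).
Proof.
move=> t0.
have mg : measurable_fun setT (fun v : R => expR (- r * v)).
  by apply: continuous_measurable_fun; exact: (@continuous_expRM R (- r)).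
have := @measurable_integral_process _ _ _ x (measurable_frozen X)
  (fun w => @continuous_frozen _ _ _ _ _ _ _ _ _ _ hX w) (fun v => expR (- r * v))
  `[t, +oo[%classic (measurable_itv _) mg.
by congr measurable_fun; apply/funext => w; rewrite discounted_dividendsE.
Qed.

Lemma ae_integrable_discounted : {ae P, forall w,
  mu.-integrable `[0, +oo[ (EFin \o expX X (- r) w)}.
Proof.
have [C C0 HC] := ou_abs_bound hkappa hbeta hX.
have cx := fun w => @continuous_frozen _ _ _ _ _ _ _ _ _ _ hX w.
(* The exponential density, of total mass 1 and zero for negative times, serves as discount factor;
   its extra factor r is divided out at the end. *)
pose f (p : Omega * measurableTypeR R) : \bar R := (exponential_pdf r p.2 * x p.2 p.1)%:E.
have mf : measurable_fun setT f.
  apply/measurable_EFinP; apply: measurable_funM.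
    by apply: measurableT_comp => //; exact: measurable_exponential_pdf.
  exact: (measurable_continuous_process (measurable_frozen X) cx).
have e0 u : 0 <= exponential_pdf r u by apply: exponential_pdf_ge0; exact: ltW.
have If : (P \x mu)%E.-integrable setT f.
  apply/integrable21ltyP => //.
  apply: (@le_lt_trans _ _ (\int[mu]_u (C%:E * (exponential_pdf r u)%:E))%E).
    apply: ge0_le_integral => //.
    - by move=> u _; exact: integral_ge0.
    - apply: (measurable_fun_fubini_tonelli_G (m1 := P) (fun p => `|f p|)%E) => //.
      exact: measurableT_comp.
    - apply: emeasurable_funM => //; apply/measurable_EFinP; exact: measurable_exponential_pdf.
    - move=> u _; have [u0|u0] := leP 0 u; last first.
        rewrite lt0_exponential_pdf// mule0.
        under eq_integral => w _ do rewrite /f/= lt0_exponential_pdf// mul0r normr0.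
        by rewrite integral0.
      under eq_integral => w _ do rewrite /f/= normrM ger0_norm// EFinM.
      rewrite ge0_integralZl ?lee_fin//; last first.
        by apply/measurable_EFinP; apply: measurableT_comp => //; exact: measurable_frozen.
      by rewrite muleC lee_wpmul2r ?lee_fin//; exact: HC.
  rewrite ge0_integralZl ?lee_fin//; last 2 first.
  - by apply/measurable_EFinP; exact: measurable_exponential_pdf.
  - by move=> u _; rewrite lee_fin.
  by rewrite integral_exponential_pdf// mule1 ltry.
have := ae_integrable1 If; apply: filterS => w Iw.
have I1 : mu.-integrable `[0, +oo[ (fun u => f (w, u)) by apply: integrableS Iw.
have mD : measurable (`[0, +oo[%classic : set (measurableTypeR R)) by exact: measurable_itv.
have := integrableZl mD r^-1 I1.
apply: eq_integrable => // u; rewrite inE/= in_itv/= andbT => u0.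
rewrite -EFinM /f/= exponential_pdfE// /expX; congr EFin.
by field; rewrite gt_eqF.
Qed.

(** Always strictly later than T, so that the law of increments over s < t applies for every n. *)
Definition after (T : R) (n : nat) : R := T + n.+1%:R.

Lemma cvg_primitive_tail t w T : 0 <= t -> t <= T ->
  mu.-integrable `[0, +oo[ (EFin \o expX X (- r) w) ->
  E w (after T n) - E w t @[n --> \oo] --> Y t w.
Proof.
move=> t0 tT Iw; set g := expX X (- r) w.
have cg : continuous g by exact: (continuous_expX hX).
have It : mu.-integrable `[t, +oo[ (EFin \o g).
  by apply: integrableS Iw => //; apply: subset_itvr; rewrite bnd_simp.
have mg : measurable_fun setT (EFin \o g).
  by apply/measurable_EFinP; exact: continuous_measurable_fun.
rewrite discounted_dividendsE//.
have n1 : -1 <= t by apply: le_trans t0; rewrite oppr_le0.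
have key : (fun n => E w (after T n) - E w t) =
    (fun n => fine (\int[mu]_(u in `[t, +oo[) (((EFin \o g) \_ `]-oo, after T n]) u))%E).
  apply/funext => n; have ta : t <= after T n by apply: le_trans tT _; rewrite lerDl.
  rewrite -(integral_segment_primitive cg n1 ta) /Rintegral; congr fine.
  rewrite -integral_mkcondr; congr (integral _ _ _).
  apply/seteqP; split => u /=; rewrite !in_itv/= andbT; first by move=> /andP[-> ->].
  by move=> [-> ->].
rewrite key; apply: fine_cvg; rewrite fineK; last exact: integrable_fin_num.
have mD : measurable (`[t, +oo[%classic : set (measurableTypeR R)) by exact: measurable_itv.
apply: (@dominated_cvg _ _ _ mu _ mD _ _ (abse \o (EFin \o g))) => //.
- move=> n; apply/measurable_funTS; apply/(measurable_restrictT _ _).1 => //.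
  exact: measurable_funTS.
- move=> u _; apply: cvg_near_cst.
  near=> n; rewrite patchE mem_set//= in_itv/=.
  have un : (Num.truncn `|u| <= n)%N by near: n; exists (Num.truncn `|u|).
  apply: (le_trans (ler_norm u)); apply: le_trans (ltW (truncnS_gt _)) _.
  by rewrite /after -[leLHS]add0r lerD ?(le_trans t0)// ler_nat ltnS.
- exact: integrable_abse.
- move=> n u _; rewrite patchE; case: ifPn => // _.
  by rewrite abse0; exact: abse_ge0.
Unshelve. all: by end_near. Qed.

(** Along times spaced by 1 the expected absolute values decay geometrically; convergence along this
    sequence is enough for the tail integral. *)
Lemma ae_discounted_vanish T : 0 <= T -> {ae P, forall w,
  expR (- r * after T n) * x (after T n) w @[n --> \oo] --> 0}.
Proof.
move=> T0; have [C C0 HC] := ou_abs_bound hkappa hbeta hX.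
have a0 n : 0 <= after T n by rewrite addr_ge0.
apply: (@ae_cvg0_geometric _ _ _ P (fun n w => expR (- r * after T n) * x (after T n) w)
  (C * expR (- r * (T + 1))) (expR (- r))).
- by rewrite mulr_ge0// expR_ge0.
- by rewrite expR_ge0/= -expR0 ltr_expR oppr_lt0.
- by move=> n; apply: measurable_funM => //; exact: measurable_frozen.
- move=> n; under eq_integral => w _ do rewrite normrM ger0_norm ?expR_ge0// EFinM.
  rewrite ge0_integralZl ?lee_fin ?expR_ge0//; last first.
    by apply/measurable_EFinP; apply: measurableT_comp => //; exact: measurable_frozen.
  have -> : C * expR (- r * (T + 1)) * expR (- r) ^+ n = expR (- r * after T n) * C.
    rewrite -expRM_natl -mulrA -expRD mulrC; congr (expR _ * _).
    by rewrite /after -natr1; ring.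
  by rewrite EFinM lee_wpmul2l ?lee_fin ?expR_ge0//; exact: HC.
Qed.

(** The integral over u >= T of exp(- r u) (theta + exp(- kappa (u - T)) (X_T - theta)), whose
    second factor is the conditional mean of X_u given the path up to T. *)
Definition tail_mean (T : R) (w : Omega) : R :=
  expR (- r * T) * (x T w / (r + kappa) + kappa * theta / (r * (r + kappa))).

Definition tail_noise (T : R) (w : Omega) : R := Y T w - tail_mean T w.

(** The integral over u >= T of the squared kernel psi exp(- r u) / (r + kappa). *)
Definition tail_var (T : R) : R :=
  psi ^+ 2 * expR (- (2 * r * T)) / (2 * r * (r + kappa) ^+ 2).

(** For l = - r the primitive enters the potential with coefficient r + kappa. Dividing by it and
    letting the upper end go to infinity, where the boundary terms vanish, leaves the tail integral
    minus [tail_mean]. *)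
Lemma cvg_tail_noise T : 0 <= T -> {ae P, forall w,
  (r + kappa)^-1 * (F (- r) (after T n) w - F (- r) T w) @[n --> \oo] --> tail_noise T w}.
Proof.
move=> T0; have rk : 0 < r + kappa by rewrite addr_gt0.
apply: filterS2 (ae_discounted_vanish T0) ae_integrable_discounted => w w0 Iw.
have cE := cvg_primitive_tail T0 (lexx T) Iw.
have q1 : `|expR (- r)| < 1.
  by rewrite ger0_norm ?expR_ge0// -expR0 ltr_expR oppr_lt0.
have ce : expR (- r * after T n) @[n --> \oo] --> 0.
  have -> : (fun n => expR (- r * after T n)) = (fun n => expR (- r * (T + 1)) * expR (- r) ^+ n).
    apply/funext => n; rewrite -expRM_natl -expRD /after -natr1; congr expR; ring.
  rewrite -[X in _ --> X](mulr0 (expR (- r * (T + 1)))).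
  by apply: cvgM; [exact: cvg_cst|exact: cvg_expr].
have -> : (fun n => (r + kappa)^-1 * (F (- r) (after T n) w - F (- r) T w)) =
   (fun n => (r + kappa)^-1 * (expR (- r * after T n) * x (after T n) w
      + kappa * theta / r * expR (- r * after T n)
      + (r + kappa) * (E w (after T n) - E w T)) - tail_mean T w).
  apply/funext => n; rewrite /ou_potential /tail_mean.
  by field; rewrite !gt_eqF.
have -> : tail_noise T w = (r + kappa)^-1 * (0 + kappa * theta / r * 0 + (r + kappa) * Y T w)
   - tail_mean T w.
  by rewrite /tail_noise; field; rewrite !gt_eqF.
apply: cvgB; last exact: cvg_cst.
apply: cvgM; first exact: cvg_cst.
apply: cvgD; last by apply: cvgM; [exact: cvg_cst|exact: cE].
by apply: cvgD => //; apply: cvgM; [exact: cvg_cst|exact: ce].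
Qed.

Lemma measurable_tail_mean T : measurable_fun setT (tail_mean T).
Proof.
apply: measurable_funM => //; apply: measurable_funD => //.
by apply: measurable_funM => //; exact: measurable_frozen.
Qed.

Lemma measurable_tail_noise T : 0 <= T -> measurable_fun setT (tail_noise T).
Proof.
move=> T0; apply: measurable_funB; first exact: measurable_discounted_dividends.
exact: measurable_tail_mean.
Qed.

Lemma tail_noise_law T : 0 <= T ->
  normal_indep P (sigma_gen `[0, T] (fun u w => beta u w)) (tail_var T) (tail_noise T).
Proof.
move=> T0; have rk : 0 < r + kappa by rewrite addr_gt0.
have Ta n : T < after T n by rewrite ltrDl.
have r0 : - r != 0 by rewrite oppr_eq0 gt_eqF.
apply: (normal_indep_cvg _ _ (measurable_tail_noise T0) (cvg_tail_noise T0)).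
- exact: sigma_gen_measurable.
- move=> n; apply: normal_indepZ (ou_potential_increment hbeta hX T0 (Ta n) r0).
  rewrite mulr_ge0 ?sqr_ge0//.
  set a := expR _; set b := expR _.
  have -> : a / (2 * - r) - b / (2 * - r) = (b - a) / (2 * r) by field; rewrite gt_eqF.
  rewrite divr_ge0 ?mulr_ge0 ?(ltW hr)// subr_ge0 ler_expR ler_wnM2l ?(ltW (Ta n))//.
  by rewrite mulrN oppr_le0 mulr_ge0// ltW.
- have -> : tail_var T = (r + kappa)^-1 ^+ 2 * (psi ^+ 2 * (0 / (2 * - r) - expR (2 * - r * T) / (2 * - r))).
    rewrite /tail_var (_ : 2 * - r * T = - (2 * r * T)); last by ring.
    by field; rewrite !gt_eqF.
  apply: cvgM; first exact: cvg_cst.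
  apply: cvgM; first exact: cvg_cst.
  apply: cvgB; last exact: cvg_cst.
  apply: cvgM; last exact: cvg_cst.
  have -> : (fun n => expR (2 * - r * after T n)) = (fun n => expR (2 * - r * (T + 1)) * expR (2 * - r) ^+ n).
    apply/funext => n; rewrite -expRM_natl -expRD /after -natr1; congr expR; ring.
  rewrite -[X in _ --> X](mulr0 (expR (2 * - r * (T + 1)))).
  apply: cvgM; first exact: cvg_cst.
  apply: cvg_expr.
  by rewrite ger0_norm ?expR_ge0// -expR0 ltr_expR mulrN oppr_lt0 mulr_gt0.
Qed.

Lemma adapted_tail_noise G T : sigma_algebra setT G -> G `<=` measurable ->
  (forall A, measurable A -> P A = 0%E -> G A) ->
  (forall v, 0 <= v -> adapted G (beta v)) -> 0 <= T -> adapted G (tail_noise T).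
Proof.
move=> sG Gm Gnull Gbeta T0.
apply: (adapted_ae_cvg sG Gm Gnull _ (measurable_tail_noise T0) (cvg_tail_noise T0)) => n.
apply: adaptedZ => //; apply: (adapted_ou_potential hX) => //.
- by move=> u /andP[u0 _]; exact: Gbeta.
- by rewrite lerDl.
- by rewrite oppr_eq0 gt_eqF.
Qed.

Lemma discounted_dividends_split T : 0 <= T -> {ae P, forall w, forall s, 0 <= s -> s <= T ->
  Y s w = Y T w + (E w T - E w s)}.
Proof.
move=> T0; apply: filterS ae_integrable_discounted => w Iw s s0 sT.
have cs := cvg_primitive_tail s0 sT Iw.
have cT := cvg_primitive_tail T0 (lexx T) Iw.
apply: (cvg_unique _ cs) => //.
have -> : (fun n => E w (after T n) - E w s) =
   (fun n => (E w (after T n) - E w T) + (E w T - E w s)).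
  by apply/funext => n; ring.
by apply: cvgD => //; exact: cvg_cst.
Qed.

End discounted_tail.

(** * Filtering *)

Section kalman.
Context {d : measure_display} {Omega : measurableType d} {R : realType}
        (P : probability Omega R) (sigma : R) (beta B : R -> {RV P >-> R})
        (hsigma : 0 < sigma) (hB : brownian_motion B) (hindep : indep_processes beta B).

Local Notation sbeta D := (sigma_gen D (fun u w => beta u w)).
Local Notation sB D := (sigma_gen D (fun u w => B u w)).

Lemma null_extS (G G' : set (set Omega)) : G `<=` G' -> null_ext P G `<=` null_ext P G'.
Proof. by move=> GG' A [mA [A0 /GG' GA0 PA0]]; split => //; exists A0. Qed.

Definition past_signal (T : R) : set (set Omega) := null_ext P (sbeta `[0, T]).
Definition whole_signal : set (set Omega) := null_ext P (sbeta `[0, +oo[).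

Lemma sigma_algebra_past_signal T : sigma_algebra setT (past_signal T).
Proof.
by apply: sigma_algebra_null_ext; [exact: sigma_gen_measurable|exact: sigma_algebra_sigma_gen].
Qed.

Lemma past_signal_measurable T : past_signal T `<=` measurable.
Proof. exact: null_ext_sub. Qed.

Lemma past_signal_null T A : measurable A -> P A = 0%E -> past_signal T A.
Proof. by apply: null_ext_null; case: (sigma_algebra_sigma_gen `[0, T] (fun u w => beta u w)). Qed.

Lemma adapted_past_signal T u : 0 <= u <= T -> adapted (past_signal T) (beta u).
Proof.
move=> uT; apply: (@adaptedS _ _ _ (sbeta `[0, T])).
  by apply: sub_null_ext; exact: sigma_gen_measurable.
by apply: (@adapted_sigma_gen _ _ _ R `[0, T]%classic (fun u w => beta u w)); rewrite /= in_itv.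
Qed.

Lemma sigma_algebra_whole_signal : sigma_algebra setT whole_signal.
Proof.
by apply: sigma_algebra_null_ext; [exact: sigma_gen_measurable|exact: sigma_algebra_sigma_gen].
Qed.

Lemma whole_signal_null A : measurable A -> P A = 0%E -> whole_signal A.
Proof. by apply: null_ext_null; case: (sigma_algebra_sigma_gen `[0, +oo[ (fun u w => beta u w)). Qed.

Lemma adapted_whole_signal u : 0 <= u -> adapted whole_signal (beta u).
Proof.
move=> u0; apply: (@adaptedS _ _ _ (sbeta `[0, +oo[)).
  by apply: sub_null_ext; exact: sigma_gen_measurable.
by apply: (@adapted_sigma_gen _ _ _ R `[0, +oo[%classic (fun u w => beta u w)); rewrite /= in_itv/= u0.
Qed.

Lemma past_signalS T : past_signal T `<=` whole_signal.
Proof.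
apply: null_extS; apply: sigma_genS => u; rewrite /= !in_itv/= andbT.
by move=> /andP[].
Qed.

Lemma whole_signal_indep A D : whole_signal A -> sB `[0, +oo[ D ->
  P (A `&` D) = (P A * P D)%E.
Proof.
move=> [mA [A0 GA0 PA0]] GD.
have mA0 : measurable A0 by exact: sigma_gen_measurable GA0.
have mD : measurable D by exact: sigma_gen_measurable GD.
rewrite (measure_symdiff0 mA mA0 PA0) -hindep//.
apply: measure_symdiff0; [exact: measurableI..|].
apply/eqP; rewrite eq_le measure_ge0 andbT -PA0; apply: le_measure; rewrite ?inE.
- by apply: measurableU; apply: measurableD; exact: measurableI.
- by apply: measurableU; exact: measurableD.
- by move=> w /=; tauto.
Qed.

(** The signal is included with its whole future, so that N is known at every s and only the noise B
    is revealed in time. *)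
Definition information_upto (s : R) : set (set Omega) :=
  <<s whole_signal `|` sB `[0, s] >>.

Lemma sigma_algebra_information_upto s : sigma_algebra setT (information_upto s).
Proof. exact: smallest_sigma_algebra. Qed.

Lemma whole_signal_information s : whole_signal `<=` information_upto s.
Proof. by move=> A HA; apply: sub_gen_smallest; left. Qed.

Lemma adapted_information_upto s u : 0 <= u <= s -> adapted (information_upto s) (B u).
Proof.
move=> us C mC; apply: sub_gen_smallest; right.
by apply: (@adapted_sigma_gen _ _ _ R `[0, s]%classic (fun u w => B u w)) => //; rewrite /= in_itv.
Qed.

(** Intersections of a signal event with a past event of B form a generating pi-system. On it the
    independence of beta and B splits off the signal event, and the Brownian property does the
    rest. *)
Lemma noise_increment s t : 0 <= s -> s < t ->
  normal_indep P (information_upto s) (t - s) (fun w => B t w - B s w).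
Proof.
move=> s0 st.
have [mD hD] := brownian_increment hB s0 st.
pose G := [set A | exists A1 A2, [/\ whole_signal A1, sB `[0, s] A2 & A = A1 `&` A2]].
have sS := sigma_algebra_whole_signal.
have sBs := sigma_algebra_sigma_gen `[0, s] (fun u w => B u w).
have T1 : whole_signal setT by case: sS => h0 hC _; rewrite -setC0 -setTD; exact: hC.
have T2 : sB `[0, s] setT by case: sBs => h0 hC _; rewrite -setC0 -setTD; exact: hC.
apply: (@normal_indepS _ _ _ P _ <<s G >>).
  apply: smallest_sub => [|A [HA|HA]]; first exact: smallest_sigma_algebra.
    by apply: sub_gen_smallest; exists A, setT; split => //; rewrite setIT.
  by apply: sub_gen_smallest; exists setT, A; split => //; rewrite setTI.
apply: normal_indep_generated.
- move=> _ [A1 [A2 [[mA1 _] GA2 ->]]]; apply: measurableI => //.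
  exact: sigma_gen_measurable GA2.
- move=> _ _ [A1 [A2 [GA1 GA2 ->]]] [A1' [A2' [GA1' GA2' ->]]].
  exists (A1 `&` A1'), (A2 `&` A2'); split; last by rewrite setIACA.
    exact: sigma_algebraI sS GA1 GA1'.
  exact: sigma_algebraI sBs GA2 GA2'.
- by exists setT, setT; split => //; rewrite setIT.
split => // _ C [A1 [A2 [GA1 GA2 ->]]] mC.
have sBy := sigma_algebra_sigma_gen `[0, +oo[ (fun u w => B u w).
have GA2y : sB `[0, +oo[ A2.
  by apply: (@sigma_genS _ _ _ R `[0, s]%classic) GA2 => u; rewrite /= !in_itv/= andbT => /andP[].
have aB u : 0 <= u -> adapted (sB `[0, +oo[) (fun w => B u w).
  by move=> u0; apply: (@adapted_sigma_gen _ _ _ R `[0, +oo[%classic (fun u w => B u w)); rewrite /= in_itv/= u0.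
have aD : adapted (sB `[0, +oo[) (fun w => B t w + (-1) * B s w).
  apply: adaptedD => //; first by apply: aB; exact: le_trans (ltW st).
  by apply: adaptedZ => //; exact: aB.
rewrite -setIA whole_signal_indep//; last first.
  apply: sigma_algebraI sBy GA2y _.
  have := aD C mC; congr (sigma_gen _ _ _); apply/seteqP.
  by split => w /=; rewrite mulN1r.
by rewrite hD// muleA whole_signal_indep.
Qed.

Context (T V : R) (N : Omega -> R) (hT : 0 < T) (V0 : 0 <= V)
  (NS : adapted whole_signal N) (NV : normal_indep P (past_signal T) V N).

Definition observation (s : R) (w : Omega) := sigma * s * N w + B s w.
(** The regression coefficient of N on [observation s], that is sigma s V / (sigma^2 s^2 V + s),
    with s cancelled so that it has a value at s = 0. *)
Definition gain (s : R) := sigma * V / (sigma ^+ 2 * s * V + 1).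
Definition residual (s : R) (w : Omega) := N w - gain s * observation s w.
(** The posterior variance V - gain(s) sigma s V. *)
Definition residual_var (s : R) := V / (sigma ^+ 2 * s * V + 1).

(** Used with the latest time at the head, so that structural recursion removes the last
    observation. *)
Fixpoint observed (L : seq R) : set (set Omega) :=
  if L is s :: L' then join_sigma (observed L') (observation s) else past_signal T.

Lemma sigma_algebra_observed L : sigma_algebra setT (observed L).
Proof. case: L => [|s L] /=; [exact: sigma_algebra_past_signal|exact: smallest_sigma_algebra]. Qed.

Lemma observed_sub L G : sigma_algebra setT G -> past_signal T `<=` G ->
  (forall s, s \in L -> adapted G (observation s)) -> observed L `<=` G.
Proof.
move=> sG TG; elim: L => [//|s L IH] LG /=; apply: join_sigma_sub => //.
  by apply: IH => u uL; apply: LG; rewrite in_cons uL orbT.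
by apply: LG; rewrite mem_head.
Qed.

Lemma past_signal_observed L : past_signal T `<=` observed L.
Proof. by elim: L => [//|s L IH] A /IH HA; exact: sub_join_sigma. Qed.

Lemma adapted_observed L s : s \in L -> adapted (observed L) (observation s).
Proof.
elim: L => [//|u L IH]; rewrite in_cons => /predU1P[->|/IH h].
  exact: adapted_join_sigma.
by apply: adaptedS h; exact: sub_join_sigma.
Qed.

Lemma observedS L L' : {subset L <= L'} -> observed L `<=` observed L'.
Proof.
move=> LL'; apply: observed_sub.
- exact: sigma_algebra_observed.
- exact: past_signal_observed.
- by move=> s /LL' sL'; exact: adapted_observed.
Qed.

Lemma adapted_observation_information s u : 0 <= u <= s ->
  adapted (information_upto s) (observation u).
Proof.
move=> us; have sI := sigma_algebra_information_upto s.
apply: adaptedD; [exact: sI| |exact: adapted_information_upto].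
apply: adaptedZ; [exact: sI|].
by apply: adaptedS NS; exact: whole_signal_information.
Qed.

Lemma information_upto_measurable s : information_upto s `<=` measurable.
Proof.
apply: smallest_sub; first exact: sigma_algebra_measurable.
by move=> A [[]//|]; exact: sigma_gen_measurable.
Qed.

Lemma observed_information L s : (forall u, u \in L -> 0 <= u <= s) ->
  observed L `<=` information_upto s.
Proof.
move=> Ls; apply: observed_sub; first exact: sigma_algebra_information_upto.
  by move=> A /past_signalS; exact: whole_signal_information.
by move=> u /Ls; exact: adapted_observation_information.
Qed.

Lemma observation0_ae : {ae P, forall w, observation 0 w = 0}.
Proof.
have [b0 _ _ _] := hB; apply: filterS b0 => w bw.
by rewrite /observation mulr0 mul0r add0r.
Qed.

Lemma measurable_observation s : measurable_fun setT (observation s).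
Proof. by apply: measurable_funD => //; apply: measurable_funM => //; exact: NV.1. Qed.

Lemma adapted_observation0 L : adapted (observed L) (observation 0).
Proof.
apply: (@adaptedS _ _ _ (past_signal T)); first exact: past_signal_observed.
apply: (@adapted_ae_eq _ _ _ P _ _ (fun=> 0)).
- exact: sigma_algebra_past_signal.
- exact: past_signal_measurable.
- exact: past_signal_null.
- exact: measurable_observation.
- apply/adaptedP; [exact: sigma_algebra_past_signal|exact: measurable_cst].
- exact: observation0_ae.
Qed.

(* One step of the discrete Kalman filter: the innovation
   observation t - (1 + sigma (t - s) gain s) observation s
     = sigma (t - s) residual s + (B t - B s)
   is uncorrelated with the residual at time t. *)
Lemma residual_indep L : sorted (fun a b => b < a) L -> (forall s, s \in L -> 0 < s) ->
  normal_indep P (observed L) (residual_var (head 0 L)) (residual (head 0 L)).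
Proof.
elim: L => [_ _|t L IH] /=.
  (* Without observations the default head is 0, and the residual at time 0 is N almost surely
     because B vanishes there. *)
  have -> : residual_var 0 = V by rewrite /residual_var mulr0 mul0r add0r divr1.
  apply: normal_indep_ae_eq NV _ _; first exact: past_signal_measurable.
    apply: measurable_funB; first exact: NV.1.
    by apply: measurable_funM => //; exact: measurable_observation.
  by apply: filterS observation0_ae => w ow; rewrite /residual ow mulr0 subr0.
move=> pL Lpos.
have Lpos' s : s \in L -> 0 < s by move=> sL; apply: Lpos; rewrite in_cons sL orbT.
have {}IH := IH (path_sorted pL) Lpos'.
set s := head 0 L in IH.
have t0 : 0 < t by apply: Lpos; rewrite mem_head.
have [s0 st] : 0 <= s /\ s < t.
  rewrite /s; case: L pL Lpos' {IH s Lpos} => [//|s L] /= /andP[ts _] Lpos'; split => //.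
  by apply/ltW/Lpos'; rewrite mem_head.
have Ls u : u \in L -> 0 <= u <= s.
  move=> uL; rewrite (ltW (Lpos' u uL))/=; rewrite /s; move: uL pL.
  case: L {Lpos Lpos' IH s s0 st} => [//|a L]; rewrite in_cons => /predU1P[->|uL]//= /andP[_ pL].
  have tr : transitive (fun a b : R => b < a) by move=> y z1 z2 h1 h2; exact: lt_trans h1.
  by have /allP/(_ u uL)/ltW := order_path_min tr pL.
have den u : 0 <= u -> 0 < sigma ^+ 2 * u * V + 1.
  by move=> u0; apply: ltr_wpDl => //; apply: mulr_ge0 => //; apply: mulr_ge0 => //; exact: sqr_ge0.
have ds := den _ s0; have dt := den _ (ltW t0).
have rv0 : 0 <= residual_var s by rewrite divr_ge0// ltW.
have ts0 : 0 < t - s by rewrite subr_gt0.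
have sI := sigma_algebra_information_upto s.
have obsI u : 0 <= u <= s -> adapted (information_upto s) (observation u).
  exact: adapted_observation_information.
have resI : adapted (information_upto s) (residual s).
  have -> : residual s = (fun w => N w + (- gain s) * observation s w).
    by apply/funext => w; rewrite mulNr.
  apply: adaptedD; [exact: sI| |].
    by apply: adaptedS NS; exact: whole_signal_information.
  by apply: adaptedZ; [exact: sI|apply: obsI; rewrite s0 lexx].
have HH' A C : observed L A -> measurable C -> information_upto s (A `&` residual s @^-1` C).
  move=> HA mC; apply: (sigma_algebraI sI _ (resI _ mC)).
  exact: observed_information HA.
have Hm : observed L `<=` measurable.
  by move=> A /(observed_information Ls); exact: information_upto_measurable.
(* In terms of the residual at s and the increment of B, the innovation has coefficients sigma (t -
   s) and 1, and the residual at t has 1 - gain(t) sigma (t - s) and - gain(t). This is their zero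
   covariance. *)
have orth : sigma * (t - s) * (1 - gain t * sigma * (t - s)) * residual_var s
    + 1 * (- gain t) * (t - s) = 0.
  by rewrite /gain /residual_var; field; rewrite !gt_eqF.
have := normal_indep_residual Hm (sigma_algebra_observed L) IH (noise_increment s0 st)
  HH' rv0 ts0 (oner_neq0 _) orth.
set W := (X in join_sigma _ X).
have WE w : W w = observation t w + (- (1 + sigma * (t - s) * gain s)) * observation s w.
  by rewrite /W /residual /observation; ring.
have -> : (1 - gain t * sigma * (t - s)) ^+ 2 * residual_var s + (- gain t) ^+ 2 * (t - s) = residual_var t.
  by rewrite /gain /residual_var; field; rewrite !gt_eqF.
have -> : (fun w => (1 - gain t * sigma * (t - s)) * residual s w + - gain t * (B t w - B s w)) = residual t.
  apply/funext => w; rewrite /residual /observation /gain.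
  by field; rewrite !gt_eqF.
apply: normal_indepS; apply: join_sigma_sub; first exact: smallest_sigma_algebra.
  exact: sub_join_sigma.
have -> : observation t = (fun w => W w + (1 + sigma * (t - s) * gain s) * observation s w).
  by apply/funext => w; rewrite WE; ring.
apply: adaptedD; [exact: smallest_sigma_algebra|exact: adapted_join_sigma|].
apply: adaptedZ; first exact: smallest_sigma_algebra.
apply: (@adaptedS _ _ _ (observed L)); first exact: sub_join_sigma.
(* For the empty list s is the default head 0, whose observation is null almost surely; otherwise s
   is the time joined last. *)
rewrite /s; case: L {pL Lpos Lpos' IH s s0 st Ls ds rv0 ts0 sI obsI resI HH' Hm orth W WE} => [|a L] /=.
  exact: (adapted_observation0 [::]).
exact: adapted_join_sigma.
Qed.

End kalman.

(** * Conditional expectation and price *)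

Section normal_versions.
Context {d : measure_display} {Omega : measurableType d} {R : realType}
        (P : probability Omega R).
Local Notation n01 := (@normal_prob R 0 1).

Lemma integrable_std_normal_affine (a s : R) :
  n01.-integrable setT (fun z : R => (a + s * z)%:E).
Proof.
have : n01.-integrable setT ((EFin \o cst a) \+ (fun z : R => s%:E * z%:E))%E.
  apply: integrableD => //; first exact: finite_measure_integrable_cst.
  by apply: integrableZl => //; exact: integrable_std_normal_id.
by apply: eq_integrable.
Qed.

Lemma integral_std_normal_affine (a s : R) : (\int[n01]_z (a + s * z)%:E = a%:E)%E.
Proof.
have Is : n01.-integrable setT (fun z : R => s%:E * z%:E)%E.
  by apply: integrableZl => //; exact: integrable_std_normal_id.
have Ia : n01.-integrable setT (EFin \o cst a) by exact: finite_measure_integrable_cst.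
transitivity (\int[n01]_z ((EFin \o cst a) z + s%:E * z%:E))%E.
  by apply: eq_integral => z _; rewrite -EFinM -EFinD.
rewrite integralD// integralZl//; last exact: integrable_std_normal_id.
rewrite std_normal_first_moment mule0 adde0.
have e : (\int[n01]_z a%:E = a%:E)%E.
  rewrite integral_cst// -[RHS]mule1; congr (_ * _)%E; exact: probability_setT.
exact: e.
Qed.

Lemma normal_integrable H v Y : H setT -> normal_indep P H v Y ->
  P.-integrable setT (EFin \o Y).
Proof.
move=> HT hY; have mY := hY.1.
apply/integrableP; split; first exact/measurable_EFinP.
have mabs : measurable_fun [set: R] (fun z : R => `|z|%:E) by exact/measurable_EFinP.
have := normal_indep_ge0_integral (f := fun z : R => `|z|%:E) hY HT measurableT mabs
  (fun z => (normr_ge0 z : (0 <= `|z|%:E)%E)).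
have PTfin : P setT \is a fin_num by rewrite fin_num_measure.
rewrite /= => ->; rewrite -(fineK PTfin) lte_mul_pinfty ?lee_fin ?fine_ge0//.
have /integrableP[_ h] := integrable_std_normal_affine 0 (Num.sqrt v).
by move: h; under eq_integral => z _ do rewrite add0r.
Qed.

Lemma normal_centered H v Y A : H A -> measurable A -> normal_indep P H v Y ->
  (\int[P]_(w in A) (Y w)%:E = 0)%E.
Proof.
move=> HA mA hY.
have mid : measurable_fun [set: R] (fun z : R => z) by [].
have Iid : n01.-integrable setT (fun z : R => (Num.sqrt v * z)%:E).
  have := integrable_std_normal_affine 0 (Num.sqrt v).
  by apply: eq_integrable => // z _; rewrite add0r.
have -> := normal_indep_integral (f := fun z : R => z) hY HA mA mid Iid.
have := integral_std_normal_affine 0 (Num.sqrt v).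
under eq_integral => z _ do rewrite add0r.
by move=> ->; rewrite mule0.
Qed.

(** The vanishing integrals are tested on the events f > 0 and f < 0, which belong to [G]. *)
Lemma ae_eq0_adapted G (f : Omega -> R) : sigma_algebra setT G -> G `<=` measurable ->
  adapted G f -> P.-integrable setT (EFin \o f) ->
  (forall A, G A -> \int[P]_(w in A) (f w)%:E = 0)%E ->
  {ae P, forall w, f w = 0}.
Proof.
move=> sG Gm Gf If f0; have mf := adapted_measurable Gm Gf.
have GA (C : set R) : measurable C -> G (f @^-1` C) by exact: Gf.
have mEf : measurable_fun setT (EFin \o f) by exact/measurable_EFinP.
pose A1 := f @^-1` `]0, +oo[; pose A2 := f @^-1` `]-oo, 0[.
have GA1 : G A1 by apply: GA; exact: measurable_itv.
have GA2 : G A2 by apply: GA; exact: measurable_itv.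
have mA1 := Gm _ GA1; have mA2 := Gm _ GA2.
have ae1 : ae_eq P A1 (EFin \o f) (cst 0%E).
  apply/(ae_eq_integral_abs _ mA1); first exact: measurable_funTS.
  rewrite -[RHS](f0 _ GA1); apply: eq_integral => w; rewrite inE /A1/= in_itv/= andbT => fw.
  by rewrite gtr0_norm.
have ae2 : ae_eq P A2 (EFin \o f) (cst 0%E).
  apply/(ae_eq_integral_abs _ mA2); first exact: measurable_funTS.
  have e : (\int[P]_(w in A2) (- (f w)%:E) = 0)%E.
    rewrite integralN ?f0 ?oppe0//.
    by apply: integrable_add_def => //; apply: integrableS If.
  rewrite -[RHS]e; apply: eq_integral => w; rewrite inE /A2/= in_itv/= => fw.
  by rewrite ltr0_norm.
apply: filterS2 ae1 ae2 => w h1 h2.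
have [fw|fw|//] := ltgtP (f w) 0.
  have /h2 [->//] : A2 w by rewrite /A2/= in_itv.
have /h1 [->//] : A1 w by rewrite /A1/= in_itv/= andbT.
Qed.

Lemma ae_normal_integral v Y S (m : R) (f : R -> R) :
  normal_indep P [set setT] v Y -> measurable_fun setT S ->
  {ae P, forall w, S w = m + Y w} -> measurable_fun setT f ->
  n01.-integrable setT (fun z : R => (f (m + Num.sqrt v * z))%:E) ->
  (\int[P]_w (f (S w))%:E = \int[n01]_z (f (m + Num.sqrt v * z))%:E)%E.
Proof.
move=> hY mS SY mf If.
transitivity (\int[P]_w (f (m + Y w))%:E)%E.
  apply: ae_eq_integral => //.
  - by apply/measurable_EFinP; exact: measurableT_comp.
  - apply/measurable_EFinP; apply: measurableT_comp => //.
    by apply: measurable_funD => //; exact: hY.1.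
  - by apply: filterS SY => w -> _.
have mg : measurable_fun setT (fun z : R => f (m + z)).
  by apply: measurableT_comp => //; exact: measurable_funD.
rewrite (normal_indep_integral (f := fun z : R => f (m + z)) hY _ measurableT mg If)//.
by rewrite probability_setT mul1e.
Qed.

Lemma integrable_std_normal_sqr : n01.-integrable setT (fun z : R => (z ^+ 2)%:E).
Proof.
apply/integrableP; split; first by apply/measurable_EFinP; exact: measurable_funX.
under eq_integral => z _ do rewrite abse_EFin ger0_norm ?sqr_ge0//.
by rewrite std_normal_second_moment ltry.
Qed.

Lemma normal_call_price v Y S (m K : R) : 0 < v ->
  normal_indep P [set setT] v Y -> measurable_fun setT S ->
  {ae P, forall w, S w = m + Y w} ->
  [/\ ('E_P[S] = m%:E)%E, ('V_P[S] = v%:E)%E &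
   ('E_P[(fun w => Num.max (S w - K) 0)%R] =
     (Num.sqrt (v / (2 * pi)) * expR (- ((m - K) ^+ 2 / (2 * v)))
      + (m - K) * std_normal_cdf ((m - K) / Num.sqrt v))%:E)%E].
Proof.
move=> v0 hY mS SY.
have s0 : 0 < Num.sqrt v by rewrite sqrtr_gt0.
have sE : Num.sqrt v ^+ 2 = v by rewrite sqr_sqrtr// ltW.
have ES : ('E_P[S] = m%:E)%E.
  rewrite unlock.
  have := ae_normal_integral (f := fun z => z) hY mS SY (@measurable_id _ _ _)
    (integrable_std_normal_affine _ _).
  by rewrite integral_std_normal_affine.
split => //.
- rewrite /variance unlock ES /= unlock.
  have mg : measurable_fun [set: R] (fun z : R => (z - m) ^+ 2).
    by apply: measurable_funX; exact: measurable_funB.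
  have e2 z : ((m + Num.sqrt v * z - m) ^+ 2)%:E = (v%:E * (z ^+ 2)%:E)%E.
    by rewrite addrAC subrr add0r exprMn sE.
  have Ig : n01.-integrable setT (fun z : R => ((m + Num.sqrt v * z - m) ^+ 2)%:E).
    under eq_fun => z do rewrite e2.
    by apply: integrableZl => //; exact: integrable_std_normal_sqr.
  have := ae_normal_integral (f := fun z : R => (z - m) ^+ 2) hY mS SY mg Ig.
  under [X in _ = X -> _]eq_integral => z _ do rewrite e2.
  rewrite integralZl//; last exact: integrable_std_normal_sqr.
  rewrite std_normal_second_moment mule1 => <-.
  by apply: eq_integral => w _; rewrite expr2.
- rewrite unlock.
  have mg : measurable_fun [set: R] (fun z : R => Num.max (z - K) 0).
    by apply: measurable_maxr => //; exact: measurable_funB.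
  have e z : m + Num.sqrt v * z - K = (m - K) + Num.sqrt v * z by ring.
  have call := integral_normal_call (m - K) s0.
  rewrite sE in call; rewrite -call.
  have mh : measurable_fun [set: measurableTypeR R]
      (fun z : measurableTypeR R => (Num.max (m - K + Num.sqrt v * z) 0)%:E).
    have h : measurable_fun [set: R] (fun z : R => Num.max (m - K + Num.sqrt v * z) 0).
      have h1 : measurable_fun [set: R] (fun z : R => m - K + Num.sqrt v * z).
        by apply: measurable_funD => //; exact: measurable_funM.
      exact: (measurable_maxr h1 (measurable_cst _)).
    by apply/measurable_EFinP; exact: h.
  have Ig : n01.-integrable setT (fun z : R => (Num.max (m + Num.sqrt v * z - K) 0)%:E).
    under eq_fun => z do rewrite e.
    apply/integrableP; split => //.
    under eq_integral => z _ do rewrite gee0_abs ?lee_fin ?le_max ?lexx ?orbT//.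
    by rewrite call ltry.
  rewrite (ae_normal_integral (f := fun z : R => Num.max (z - K) 0) hY mS SY mg Ig).
  by under eq_integral => z _ do rewrite e.
Qed.

End normal_versions.

Section filtering.
Context {d : measure_display} {Omega : measurableType d} {R : realType}
        (P : probability Omega R) (sigma : R) (beta B : R -> {RV P >-> R})
        (hB : brownian_motion B) (hindep : indep_processes beta B)
        (T V : R) (N : Omega -> R) (hT : 0 < T) (V0 : 0 <= V)
        (NS : adapted (whole_signal beta) N)
        (NV : normal_indep P (past_signal beta T) V N).
Local Notation observed := (observed sigma beta B T N).
Local Notation observation := (observation sigma B N).

(** Every list contains T as its largest time, so one and the same residual, that at T, is
    independent of all the [observed L]. *)
Definition observed_finitely : set (set Omega) := [set A | exists2 L,
  T \in L /\ (forall s, s \in L -> 0 < s <= T) & observed L A].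

Definition observed_upto := <<s observed_finitely >>.

Lemma sigma_algebra_observed_upto : sigma_algebra setT observed_upto.
Proof. exact: smallest_sigma_algebra. Qed.

Lemma observed_finitely_measurable : observed_finitely `<=` measurable.
Proof.
move=> A [L [_ LT] LA]; apply: (@information_upto_measurable _ _ _ P beta B T).
apply: (@observed_information _ _ _ P sigma beta B T N NS L) LA => u /LT /andP[u0 uT].
by rewrite ltW.
Qed.

Lemma observed_upto_measurable : observed_upto `<=` measurable.
Proof.
apply: smallest_sub; first exact: sigma_algebra_measurable.
exact: observed_finitely_measurable.
Qed.

Lemma past_signal_observed_upto : past_signal beta T `<=` observed_upto.
Proof.
move=> A HA; apply: sub_gen_smallest; exists [:: T]; last exact: past_signal_observed.
by split => [|s]; rewrite mem_seq1// => /eqP ->; rewrite hT lexx.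
Qed.

Lemma adapted_observation s : 0 <= s <= T -> adapted observed_upto (observation s).
Proof.
move=> /andP[]; rewrite le_eqVlt => /predU1P[<- _|s0 sT] C mC; apply: sub_gen_smallest.
  exists [:: T]; last exact: (adapted_observation0 sigma hB NV).
  by split => [|u]; rewrite mem_seq1// => /eqP ->; rewrite hT lexx.
exists [:: s; T]; last by apply: adapted_observed => //; rewrite mem_head.
split; first by rewrite !inE eqxx orbT.
by move=> u; rewrite !inE => /orP[]/eqP ->; rewrite ?s0 ?sT ?hT ?lexx.
Qed.

Lemma residual_indep_upto :
  normal_indep P observed_upto (residual_var sigma V T) (residual sigma B V N T).
Proof.
apply: normal_indep_generated.
- exact: observed_finitely_measurable.
(* Two finite sets of times have a common refinement, so the union of the finite sigma-algebras is a
   pi-system although it need not be a sigma-algebra. *)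
- move=> A A' [L [TL LT] LA] [L' [TL' LT'] LA']; exists (L ++ L').
    split; first by rewrite mem_cat TL.
    by move=> s; rewrite mem_cat => /orP[/LT|/LT'].
  apply: (sigma_algebraI (sigma_algebra_observed sigma beta B T N (L ++ L'))).
    by apply: observedS LA => s sL; rewrite mem_cat sL.
  by apply: observedS LA' => s sL; rewrite mem_cat sL orbT.
- exists [:: T]; first by split => [|s]; rewrite mem_seq1// => /eqP ->; rewrite hT lexx.
  have [h0 hC _] := sigma_algebra_observed sigma beta B T N [:: T].
  by rewrite -setC0 -setTD; exact: hC.
have key L : T \in L -> (forall s, s \in L -> 0 < s <= T) -> 
    normal_indep P (observed L) (residual_var sigma V T) (residual sigma B V N T).
  (* The same times in strictly decreasing order, as the Kalman recursion requires; the head is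
     T. *)
  move=> TL LT; pose S := rev (sort <=%R (undup L)).
  have LS : L =i S by move=> s; rewrite mem_rev mem_sort mem_undup.
  have sS : sorted (fun a b => b < a) S.
    by rewrite /S rev_sorted sort_lt_sorted undup_uniq.
  have SP s : s \in S -> 0 < s <= T by rewrite -LS; exact: LT.
  have hS : head 0 S = T.
    move: TL; rewrite LS; case: S sS SP {LS} => [//|a l] /= sal SP.
    rewrite in_cons => /predU1P[//|Tl].
    have /allP := order_path_min (rev_trans (@lt_trans _ R)) sal.
    by move=> /(_ _ Tl); have /andP[_] := SP a (mem_head _ _); rewrite leNgt => /negbTE ->.
  have := residual_indep sigma hB hindep V0 NS NV sS (fun s sL => proj1 (andP (SP s sL))).
  by rewrite hS; apply: normal_indepS; apply: observedS => s; rewrite LS.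
split.
  have TT : T \in [:: T] by rewrite mem_head.
  have TP s : s \in [:: T] -> 0 < s <= T by rewrite mem_seq1 => /eqP ->; rewrite hT lexx.
  by have [] := key _ TT TP.
by move=> A C [L [TL LT] LA] mC; have [_] := key _ TL LT; exact.
Qed.

End filtering.

(** * The conditional expectation of the discounted dividends *)

Section conditional_estimate.
Context {d : measure_display} {Omega : measurableType d} {R : realType}
        (P : probability Omega R) (kappa theta psi x0 sigma r : R)
        (beta B X : R -> {RV P >-> R})
        (hkappa : 0 < kappa) (hpsi : 0 < psi) (hsigma : 0 < sigma) (hr : 0 < r)
        (hbeta : brownian_motion beta) (hB : brownian_motion B)
        (hindep : indep_processes beta B)
        (hX : ornstein_uhlenbeck kappa theta psi x0 beta X)
        (T : R) (hT : 0 < T).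
Local Notation x := (frozen X).
Local Notation F := (ou_potential kappa theta X).
Local Notation E := (fun w => primitive (expX X (- r) w)).
Local Notation Y := (discounted_dividends r X T).
Local Notation N := (tail_noise kappa theta r X T).
Local Notation M := (tail_mean kappa theta r X T).
Local Notation V := (tail_var kappa psi r T).
Local Notation past := (past_signal beta T).
Local Notation market := (market_filtration sigma r X B T).
Local Notation known := (observed_upto sigma beta B T N).

Let T0 : 0 <= T. Proof. exact: ltW. Qed.
Let rk : r + kappa != 0. Proof. by rewrite gt_eqF// addr_gt0. Qed.

Lemma tail_var_gt0 : 0 < V.
Proof. by rewrite /tail_var divr_gt0 ?mulr_gt0 ?exprn_gt0 ?expR_gt0 ?addr_gt0. Qed.

Lemma adapted_noise : adapted (whole_signal beta) N.
Proof.
apply: (adapted_tail_noise hkappa hr hbeta hX) => //.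
- exact: sigma_algebra_whole_signal.
- exact: null_ext_sub.
- exact: whole_signal_null.
- exact: adapted_whole_signal.
Qed.

Lemma noise_law : normal_indep P past V N.
Proof.
apply: normal_indep_null_ext; first exact: sigma_gen_measurable.
exact: (tail_noise_law hkappa hr hbeta hX T0).
Qed.

Lemma adapted_past_ou s : 0 <= s <= T -> adapted past (x s).
Proof.
move=> /andP[s0 sT]; apply: (adapted_ou hkappa hbeta hX) => //.
- exact: sigma_algebra_past_signal.
- exact: past_signal_measurable.
- exact: past_signal_null.
- move=> v /andP[v0 vs]; apply: adapted_past_signal.
  by rewrite v0 (le_trans vs).
Qed.

(** Solving [ou_potential (- r)] for its primitive, of coefficient r + kappa, expresses this time
    integral through a potential increment and the values of x at s and T, all known to be
    adapted. *)
Lemma adapted_past_primitive s : 0 <= s <= T -> adapted past (fun w => E w T - E w s).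
Proof.
move=> sT; have /andP[s0 sT'] := sT.
have sP := sigma_algebra_past_signal beta T.
have e : (fun w => E w T - E w s) = (fun w => (r + kappa)^-1 * (F (- r) T w - F (- r) s w)
    + ((- ((r + kappa)^-1 * expR (- r * T))) * x T w +
       ((r + kappa)^-1 * expR (- r * s) * x s w +
        - ((r + kappa)^-1 * (kappa * theta / r) * (expR (- r * T) - expR (- r * s)))))).
  apply/funext => w; rewrite /ou_potential.
  by field; rewrite rk gt_eqF.
rewrite e; apply: adaptedD => //.
  apply: adaptedZ => //; apply: (adapted_ou_potential hX) => //.
  - exact: past_signal_measurable.
  - exact: past_signal_null.
  - by move=> u; exact: adapted_past_signal.
  - by rewrite oppr_eq0 gt_eqF.
apply: adaptedD => //.
  by apply: adaptedZ => //; apply: adapted_past_ou; rewrite T0 lexx.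
by apply: adapted_affine => //; exact: adapted_past_ou.
Qed.

Lemma adapted_past_mean : adapted past M.
Proof.
have sP := sigma_algebra_past_signal beta T.
have e : M = (fun w => expR (- r * T) / (r + kappa) * x T w
    + expR (- r * T) * (kappa * theta / (r * (r + kappa)))).
  by apply/funext => w; rewrite /tail_mean; field; rewrite rk gt_eqF.
by rewrite e; apply: adapted_affine => //; apply: adapted_past_ou; rewrite T0 lexx.
Qed.

Lemma information_split s : 0 <= s <= T -> {ae P, forall w,
  information sigma r X B s w =
  observation sigma B N s w + sigma * s * (M w + (E w T - E w s))}.
Proof.
move=> /andP[s0 sT].
have := discounted_dividends_split hkappa hr hbeta hX T0.
apply: filterS => w /(_ s s0 sT) e.
by rewrite /information e /observation /tail_noise; ring.
Qed.

Lemma market_filtration_observed : market `<=` known.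
Proof.
have sK := sigma_algebra_observed_upto sigma beta B T N.
have pK := @past_signal_observed_upto _ _ _ P sigma beta B T N hT.
have mK := observed_upto_measurable adapted_noise (sigma := sigma) (B := B) (T := T).
apply: smallest_sub => //; rewrite subUset; split; apply: sigma_gen_sub => // s;
  rewrite /= in_itv/= => sT; have /andP[s0 _] := sT.
- refine (@adapted_ae_eq _ _ _ P known (information sigma r X B s)
      (fun w => observation sigma B N s w + sigma * s * (M w + (E w T - E w s))) sK mK _ _ _ _).
  + by move=> A mA PA; apply: pK; exact: past_signal_null.
  + apply: measurable_funD => //; apply: measurable_funM => //.
    exact: (measurable_discounted_dividends r hX).
  + apply: adaptedD => //; first exact: (adapted_observation hB hT noise_law).
    apply: adaptedZ => //; apply: (adaptedS pK).
    apply: adaptedD; [exact: sigma_algebra_past_signal|exact: adapted_past_mean|].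
    exact: adapted_past_primitive.
  + exact: information_split.
- have e : (fun w => X s w) = x s by apply/funext => w; rewrite frozenE.
  by rewrite e; apply: (adaptedS pK); exact: adapted_past_ou.
Qed.

Lemma residual_law :
  normal_indep P known (residual_var sigma V T) (residual sigma B V N T).
Proof.
exact: (residual_indep_upto sigma hB hindep hT (ltW tail_var_gt0) adapted_noise noise_law).
Qed.

Definition estimate (w : Omega) : R := M w + gain sigma V T * observation sigma B N T w.

Lemma estimate_residual w : Y w = estimate w + residual sigma B V N T w.
Proof. by rewrite /estimate /residual /tail_noise; ring. Qed.

Lemma adapted_estimate : adapted market estimate.
Proof.
have sM : sigma_algebra setT market by exact: smallest_sigma_algebra.
have inT : `[0, T]%classic T by rewrite /= in_itv/= T0 lexx.
have aX : adapted market (x T).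
  have -> : x T = (fun w => X T w) by apply/funext => w; rewrite frozenE.
  move=> C mC; apply: sub_gen_smallest; right.
  exact: (@adapted_sigma_gen _ _ _ R `[0, T]%classic (fun u w => X u w)).
have aI : adapted market (information sigma r X B T).
  move=> C mC; apply: sub_gen_smallest; left.
  exact: (@adapted_sigma_gen _ _ _ R `[0, T]%classic (information sigma r X B)).
(* At every sample point [observation] at T is xi_T - sigma T M, so M enters the estimate with
   coefficient q and no null event intervenes. *)
pose q := 1 - gain sigma V T * (sigma * T).
have e : estimate = (fun w => gain sigma V T * information sigma r X B T w
    + (q * (expR (- r * T) / (r + kappa)) * x T w
    + q * (expR (- r * T) * (kappa * theta / (r * (r + kappa)))))).
  apply/funext => w; rewrite /estimate /observation /information /tail_noise /tail_mean /q.
  by field; rewrite rk gt_eqF.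
rewrite e; apply: adaptedD => //; first exact: adaptedZ.
exact: adapted_affine.
Qed.

Lemma mean_integrable : P.-integrable setT (EFin \o M).
Proof.
have sT : sigma_gen `[0, 0] (fun u w => beta u w) setT.
  have [h0 hC _] := sigma_algebra_sigma_gen `[0, 0] (fun u w => beta u w).
  by rewrite -setC0 -setTD; exact: hC.
have IX := normal_integrable sT (ou_law hkappa hbeta hX T0).
pose a := expR (- r * T) / (r + kappa).
pose b := expR (- r * T) * (ou_mean kappa theta x0 T / (r + kappa)
  + kappa * theta / (r * (r + kappa))).
have e : EFin \o M = (fun w => (a%:E * (x T w - ou_mean kappa theta x0 T)%:E + b%:E)%E).
  apply/funext => w; rewrite /= -EFinM -EFinD /tail_mean /a /b; congr (_%:E).
  by field; rewrite rk gt_eqF.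
rewrite e; apply: integrableD => //; first exact: integrableZl.
exact: finite_measure_integrable_cst.
Qed.

(** The difference Z - [estimate] has zero integral over each market event: there Z integrates like
    Y, and the residual is centered and independent of a larger sigma-algebra. *)
Lemma cond_exp_estimate Z : @is_cond_exp _ _ _ P market Y Z ->
  {ae P, forall w, Z w = estimate w}.
Proof.
move=> [aZ IZ cZ].
have sM : sigma_algebra setT market by exact: smallest_sigma_algebra.
have mM : market `<=` measurable.
  by move=> A /market_filtration_observed; exact: (observed_upto_measurable adapted_noise).
have kT : known setT.
  have [h0 hC _] := sigma_algebra_observed_upto sigma beta B T N.
  by rewrite -setC0 -setTD; exact: hC.
have pT : past setT.
  have [h0 hC _] := sigma_algebra_past_signal beta T.
  by rewrite -setC0 -setTD; exact: hC.
have IN := normal_integrable pT noise_law.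
have IR := normal_integrable kT residual_law.
have IY : P.-integrable setT (EFin \o Y).
  have -> : EFin \o Y = (fun w => (M w)%:E + (N w)%:E)%E.
    by apply/funext => w; rewrite /= -EFinD /tail_noise addrC subrK.
  by apply: integrableD => //; exact: mean_integrable.
have Ie : P.-integrable setT (EFin \o estimate).
  have -> : EFin \o estimate = (fun w => (Y w)%:E - (residual sigma B V N T w)%:E)%E.
    by apply/funext => w; rewrite /= -EFinB estimate_residual addrK.
  by apply: integrableB.
have : {ae P, forall w, Z w + (-1) * estimate w = 0}.
  apply: (ae_eq0_adapted sM mM).
  - have aZ' : adapted market Z := aZ.
    exact: (adaptedD sM aZ' (adaptedZ (-1) sM adapted_estimate)).
  - have -> : EFin \o (fun w => Z w + (-1) * estimate w)
        = (fun w => (Z w)%:E - (estimate w)%:E)%E.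
      by apply/funext => w; rewrite /= -EFinB mulN1r.
    exact: integrableB.
  - move=> A GA; have mA := mM A GA.
    have IS f : P.-integrable setT f -> P.-integrable A f.
      by apply: integrableS.
    transitivity (\int[P]_(w in A) ((Z w)%:E - (estimate w)%:E))%E.
      by apply: eq_integral => w _; rewrite -EFinB mulN1r.
    rewrite integralB//; [|exact: IS|exact: IS].
    rewrite cZ//.
    have -> : (\int[P]_(w in A) (Y w)%:E = \int[P]_(w in A) (estimate w)%:E)%E.
      under eq_integral => w _ do rewrite estimate_residual EFinD.
      rewrite integralD//; [|exact: IS|exact: IS].
      rewrite [X in (_ + X)%E](normal_centered (market_filtration_observed GA) mA residual_law).
      by rewrite adde0.
    by apply: subee; apply: integrable_fin_num => //; exact: IS.
by apply: filterS => w; rewrite mulN1r => /subr0_eq.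
Qed.

End conditional_estimate.

(** * Law of the commodity price *)

Section pricing.
Context {d : measure_display} {Omega : measurableType d} {R : realType}
        (P : probability Omega R) (kappa theta psi x0 sigma r : R)
        (beta B X : R -> {RV P >-> R})
        (hkappa : 0 < kappa) (hpsi : 0 < psi) (hsigma : 0 < sigma) (hr : 0 < r)
        (hbeta : brownian_motion beta) (hB : brownian_motion B)
        (hindep : indep_processes beta B)
        (hX : ornstein_uhlenbeck kappa theta psi x0 beta X)
        (T : R) (hT : 0 < T).
Local Notation x := (frozen X).
Local Notation N := (tail_noise kappa theta r X T).
Local Notation M := (tail_mean kappa theta r X T).
Local Notation V := (tail_var kappa psi r T).
Local Notation past := (past_signal beta T).
Local Notation market := (market_filtration sigma r X B T).

Let T0 : 0 <= T. Proof. exact: ltW. Qed.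
Let rk : r + kappa != 0. Proof. by rewrite gt_eqF// addr_gt0. Qed.

Definition price_mean := ou_mean kappa theta x0 T / (r + kappa) + kappa * theta / (r * (r + kappa)).

(** Kept in the shape produced by two uses of [normal_indep_sum], with the increment of B over
    [0, T]; [price_varE] brings it to closed form. *)
Definition price_var := (r + kappa)^-1 ^+ 2 * ou_var kappa psi T
  + (expR (r * T) * gain sigma V T) ^+ 2 * ((sigma * T) ^+ 2 * V + 1 ^+ 2 * (T - 0)).

Definition price_fluctuation (w : Omega) := (r + kappa)^-1 * (x T w - ou_mean kappa theta x0 T)
  + expR (r * T) * gain sigma V T * (sigma * T * N w + 1 * (B T w - B 0 w)).

Lemma gain_gt0 : 0 < gain sigma V T.
Proof.
have V0 := tail_var_gt0 hkappa hpsi hr T.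
apply: divr_gt0; first exact: mulr_gt0.
apply: addr_gt0 => //; apply: mulr_gt0 => //; apply: mulr_gt0 => //.
exact: exprn_gt0.
Qed.

Lemma signal_noise_gt0 : 0 < (sigma * T) ^+ 2 * V + 1 ^+ 2 * (T - 0).
Proof.
have V0 := tail_var_gt0 hkappa hpsi hr T.
by rewrite expr1n mul1r subr0 addr_gt0// mulr_gt0// exprn_gt0// mulr_gt0.
Qed.

Lemma price_var_gt0 : 0 < price_var.
Proof.
rewrite /price_var ltr_wpDl//.
  by apply: mulr_ge0; [exact: sqr_ge0|exact: ou_var_ge0].
apply: mulr_gt0; last exact: signal_noise_gt0.
by apply: exprn_gt0; apply: mulr_gt0; [exact: expR_gt0|exact: gain_gt0].
Qed.

Lemma price_fluctuation_law : normal_indep P [set setT] price_var price_fluctuation.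
Proof.
have sP := sigma_algebra_past_signal beta T.
have V0 := ltW (tail_var_gt0 hkappa hpsi hr T).
have hN := noise_law hkappa hr hbeta hX hT.
have aN := adapted_noise hkappa hr hbeta hX hT.
(* [information_upto] at time 0 already contains the whole signal, so the increment of B is
   independent of N and the past jointly. *)
have hD := noise_increment hB hindep (lexx 0) hT.
have T00 : 0 < T - 0 by rewrite subr0.
have obs : normal_indep P past ((sigma * T) ^+ 2 * V + 1 ^+ 2 * (T - 0))
    (fun w => sigma * T * N w + 1 * (B T w - B 0 w)).
  apply: (normal_indep_sum _ _ hN hD) => //; first exact: past_signal_measurable.
  move=> A C HA mC.
  apply: sigma_algebraI (sigma_algebra_information_upto beta B 0) _ _.
    by apply: whole_signal_information; exact: past_signalS HA.
  by apply: whole_signal_information; exact: aN.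
have hx : normal_indep P [set setT] (ou_var kappa psi T) (fun w => x T w - ou_mean kappa theta x0 T).
  apply: normal_indepS (ou_law hkappa hbeta hX T0) => _ ->.
  have [h0 hC _] := sigma_algebra_sigma_gen `[0, 0] (fun u w => beta u w).
  by rewrite -setC0 -setTD; exact: hC.
apply: (normal_indep_sum _ _ hx obs).
- by move=> _ ->.
- move=> _ C -> mC; rewrite setTI.
  have ax : adapted past (fun w => 1 * x T w + (- ou_mean kappa theta x0 T)).
    apply: adapted_affine => //.
    by apply: (adapted_past_ou hkappa hbeta hX); rewrite T0 lexx.
  have := ax C mC; congr (past _); apply/seteqP.
  by split => w /=; rewrite mul1r.
- exact: ou_var_ge0.
- exact: signal_noise_gt0.
- by rewrite gt_eqF// mulr_gt0 ?expR_gt0 ?gain_gt0.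
Qed.

Lemma commodity_price_fluctuation S : @commodity_price _ _ _ P sigma r X B T S ->
  measurable_fun setT S /\ {ae P, forall w, S w = price_mean + price_fluctuation w}.
Proof.
move=> [Z hZ SZ].
have aZ : adapted market Z by case: hZ.
have mM : market `<=` measurable.
  move=> A /(market_filtration_observed hkappa hr hbeta hB hX hT).
  exact: (observed_upto_measurable (adapted_noise hkappa hr hbeta hX hT)).
have mZ : measurable_fun setT Z.
  by move=> _ C mC; rewrite setTI; apply: mM; exact: aZ.
split.
  have -> : S = (fun w => expR (r * T) * Z w) by apply/funext.
  exact: measurable_funM.
have hE := cond_exp_estimate hkappa hpsi hr hbeta hB hindep hX hT hZ.
have [B0 _ _ _] := hB.
apply: filterS2 hE B0 => w ZE B0w.
rewrite SZ ZE /price_mean /price_fluctuation /estimate /observation B0w subr0 mul1r.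
have eT : expR (r * T) * expR (- r * T) = 1 by rewrite -expRD mulNr subrr expR0.
have -> : expR (r * T) * (M w + gain sigma V T * (sigma * T * N w + B T w)) =
    (expR (r * T) * expR (- r * T)) * (x T w / (r + kappa) + kappa * theta / (r * (r + kappa)))
    + expR (r * T) * (gain sigma V T * (sigma * T * N w + B T w)).
  by rewrite mulrDr -[X in _ = X + _]mulrA.
by rewrite eT; ring.
Qed.

Lemma price_meanE : price_mean = 1 / r * (kappa / (r + kappa) * theta
  + r / (r + kappa) * (expR (- (kappa * T)) * x0 + theta * (1 - expR (- (kappa * T))))).
Proof. by rewrite /price_mean /ou_mean; field; rewrite rk gt_eqF. Qed.

(** Here z is sigma T [gain]. Hence gain^2 (sigma T)^2 V = z^2 V and gain^2 T = z^2 / (sigma^2 T),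
    while the factor exp(2 r T) cancels the discounting in V. *)
Lemma price_varE :
  let z := sigma ^+ 2 * psi ^+ 2 * T
           / (2 * r * (r + kappa) ^+ 2 * expR (2 * r * T) + sigma ^+ 2 * psi ^+ 2 * T) in
  price_var = psi ^+ 2 / (2 * kappa * (r + kappa) ^+ 2) * (1 - expR (- (2 * kappa * T)))
    + z ^+ 2 * (psi ^+ 2 / (2 * r * (r + kappa) ^+ 2) + expR (2 * r * T) / (sigma ^+ 2 * T)).
Proof.
move=> z; rewrite /price_var /ou_var /gain /tail_var {}/z !expRN.
have e2 : expR (2 * r * T) = expR (r * T) ^+ 2 by rewrite -mulrA expRM_natl.
rewrite e2; set e := expR (r * T); have e0 : 0 < e by exact: expR_gt0.
have d0 : 0 < 2 * r * (r + kappa) ^+ 2 * e ^+ 2 + sigma ^+ 2 * psi ^+ 2 * T.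
  by rewrite addr_gt0// ?mulr_gt0 ?exprn_gt0 ?addr_gt0.
field.
by rewrite exprMn rk !gt_eqF ?expR_gt0.
Qed.

End pricing.

Theorem mainTheorem2 (d : measure_display) (Omega : measurableType d)
  (R : realType) (P : probability Omega R)
  (kappa theta psi x0 sigma r : R) (beta B X : R -> {RV P >-> R})
  (hkappa : 0 < kappa) (hpsi : 0 < psi) (hsigma : 0 < sigma) (hr : 0 < r)
  (hbeta : brownian_motion beta) (hB : brownian_motion B)
  (hindep : indep_processes beta B)
  (hX : ornstein_uhlenbeck kappa theta psi x0 beta X)
  (T K : R) (hT : 0 < T)
  (S : Omega -> R) (hS : commodity_price sigma r X B T S) :
  let C0 := ((expR (- (r * T)))%:E
              * 'E_P[(fun w => Num.max (S w - K) 0)%R])%E in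
  let m := fine ('E_P[S])%E in
  let v := fine ('V_P[S])%E in
  let z := sigma ^+ 2 * psi ^+ 2 * T
           / (2 * r * (r + kappa) ^+ 2 * expR (2 * r * T)
              + sigma ^+ 2 * psi ^+ 2 * T) in
  [/\ C0 = (expR (- (r * T))
            * (Num.sqrt (v / (2 * pi)) * expR (- ((m - K) ^+ 2 / (2 * v)))
               + (m - K) * std_normal_cdf ((m - K) / Num.sqrt v)))%:E,
      ('E_P[S])%E =
        (1 / r * (kappa / (r + kappa) * theta
                  + r / (r + kappa)
                    * (expR (- (kappa * T)) * x0
                       + theta * (1 - expR (- (kappa * T))))))%:E
    & ('V_P[S])%E =
        (psi ^+ 2 / (2 * kappa * (r + kappa) ^+ 2)
           * (1 - expR (- (2 * kappa * T)))
         + z ^+ 2 * (psi ^+ 2 / (2 * r * (r + kappa) ^+ 2)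
                     + expR (2 * r * T) / (sigma ^+ 2 * T)))%:E].
Proof.
move=> C0 m v z.
have [mS SE] := commodity_price_fluctuation hkappa hpsi hr hbeta hB hindep hX hT hS.
have [ES VS call] := normal_call_price K (price_var_gt0 hkappa hpsi hsigma hr hT)
  (price_fluctuation_law hkappa hpsi hsigma hr hbeta hB hindep hX hT) mS SE.
have mE : m = price_mean kappa theta x0 r T by rewrite /m ES.
have vE : v = price_var kappa psi sigma r T by rewrite /v VS.
split.
- by rewrite /C0 call mE vE EFinM.
- by rewrite ES price_meanE.
- by rewrite VS price_varE.
Qed.
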